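(* Let $\alpha\in(0,1)$ and let $A$ be an index set. A subset $\mathcal A=\{\zeta_a=(\mathcal T_a,\ast_a,d_a,M_a):a\in A\}$ of $\mathbb T^\alpha_{\mathrm{sp}}$ is relatively compact (for the metric $\Delta_{\mathrm{sp}}$) if and only if for every $r>0$ and $\varepsilon>0$ there exist 1. a finite integer $N(r;\varepsilon)$ such that, uniformly over all $a\in A$, $\mathcal N_{d_a}(\mathcal T_a^{(r)},\varepsilon)\le N(r;\varepsilon)$, where $\mathcal N_{d_a}(\mathcal T_a^{(r)},\varepsilon)$ is the cardinality of the minimal $\varepsilon$-net in $\mathcal T_a^{(r)}$ with respect to the metric $d_a$; 2. a finite constant $C=C(r)>0$ and $\delta=\delta(r,\varepsilon)>0$ such that $\sup_{a\in A}\sup_{\mathfrak z\in\mathcal T_a^{(r)}}\|M_a(\mathfrak z)\|\le C$ and $\sup_{a\in A}\delta^{-\alpha}\,\omega^{(r)}(M_a,\delta)<\varepsilon$; 3. a finite constant $C'=C'(r)>0$ such that $b_{\zeta_a}(r)\le C'$ uniformly over $a\in A$.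
   Context: Conventions: $\mathbb N=\{0,1,2,\dots\}$, $\|\cdot\|$ is the Euclidean norm on $\mathbb R^2$. R-trees. A metric space $(\mathcal T,d)$ is an $\mathbb R$-tree if for all $\mathfrak z_1,\mathfrak z_2\in\mathcal T$ there is a unique isometric map $f:[0,d(\mathfrak z_1,\mathfrak z_2)]\to\mathcal T$ with $f(0)=\mathfrak z_1$, $f(d(\mathfrak z_1,\mathfrak z_2))=\mathfrak z_2$, and every continuous injective $q:[0,1]\to\mathcal T$ with $q(0)=\mathfrak z_1,q(1)=\mathfrak z_2$ has the same range as $f$. Space. For $\alpha\in(0,1)$, $\mathbb T^\alpha_{\mathrm{sp}}$ is the set of equivalence classes of quadruplets $\zeta=(\mathcal T,\ast,d,M)$ where $(\mathcal T,d)$ is a complete separable $\mathbb R$-tree in which every closed bounded set is compact, $\ast\in\mathcal T$, and $M=(M_t,M_x):\mathcal T\to\mathbb R^2$ is proper (preimages of compact sets are compact) and locally little $\alpha$-Hölder, i.e. for every compact $K\subset\mathcal T$, $\lim_{\varepsilon\to0}\sup_{\mathfrak z\in K}\sup_{0<d(\mathfrak z,\mathfrak z')\le\varepsilon}\|M(\mathfrak z)-M(\mathfrak z')\|/d(\mathfrak z,\mathfrak z')^\alpha=0$. Two quadruplets are identified if there is a bijective isometry $\phi:\mathcal T\to\mathcal T'$ with $\phi(\ast)=\ast'$ and $M'\circ\phi=M$. $\mathcal T^{(r)}$ is the closed ball of radius $r$ around $\ast$, and $\omega^{(r)}(M,\delta)=\sup\{\|M(\mathfrak z)-M(\mathfrak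 w)\|:\mathfrak z,\mathfrak w\in\mathcal T^{(r)},\ d(\mathfrak z,\mathfrak w)\le\delta\}$. Metric. The properness map $b_\zeta:\mathbb R\to\mathbb R_+$ is $b_\zeta(r)=0$ for $r<0$ and $b_\zeta(r)=\sup\{d(\ast,\mathfrak z):M(\mathfrak z)\in[-r,r]^2\}$ for $r\ge0$ ($\sup\emptyset=0$). On càdlàg functions $[-1,\infty)\to\mathbb R_+$ let $d_{\mathrm{M1}}(f,g)=\int_0^\infty e^{-t}\big(1\wedge d^{\mathrm c}_{\mathrm{M1}}(f|_{[-1,t]},g|_{[-1,t]})\big)dt$, where $d^{\mathrm c}_{\mathrm{M1}}$ is a fixed standard metric on càdlàg functions on a compact interval which induces Skorokhod's M1 topology and is complete. A correspondence $\mathcal C$ between $\mathcal T$ and $\mathcal T'$ is a subset of $\mathcal T\times\mathcal T'$ projecting onto both factors; $\mathrm{dis}\,\mathcal C=\sup\{|d(\mathfrak z,\mathfrak w)-d'(\mathfrak z',\mathfrak w')|:(\mathfrak z,\mathfrak z'),(\mathfrak w,\mathfrak w')\in\mathcal C\}$. Fix a smooth $\psi:\mathbb R_+\to[0,1]$ equal to $1$ on $[1,2]$ and $0$ outside $[1/2,4]$, and set $\psi_n(x)=\psi(2^nx)$, $\delta_{\mathfrak z,\mathfrak w}M=M(\mathfrak z)-M(\mathfrak w)$. Put $$\boldsymbol\Delta^{\mathrm c,\mathcal C}(\zeta,\zeta')=\tfrac12\mathrm{dis}\,\mathcal C+\sup_{(\mathfrak z,\mathfrak z')\in\mathcal C}\|M(\mathfrak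 z)-M'(\mathfrak z')\|+\sup_{n\in\mathbb N}2^{n\alpha}\sup_{(\mathfrak z,\mathfrak z'),(\mathfrak w,\mathfrak w')\in\mathcal C}\|\psi_n(d(\mathfrak z,\mathfrak w))\delta_{\mathfrak z,\mathfrak w}M-\psi_n(d'(\mathfrak z',\mathfrak w'))\delta_{\mathfrak z',\mathfrak w'}M'\|,$$ and, for compact spaces, $\boldsymbol\Delta^{\mathrm c}(\zeta,\zeta')=\inf\{\boldsymbol\Delta^{\mathrm c,\mathcal C}(\zeta,\zeta'):(\ast,\ast')\in\mathcal C\}$. Let $\zeta^{(r)}$ be the restriction of $\zeta$ to $\mathcal T^{(r)}$. Then $\Delta_{\mathrm{sp}}(\zeta,\zeta')=\int_0^\infty e^{-r}[1\wedge\boldsymbol\Delta^{\mathrm c}(\zeta^{(r)},\zeta'^{(r)})]dr+d_{\mathrm{M1}}(b_\zeta,b_{\zeta'})$.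
   Formalization: In condition 2 the bound δ^{-α} ω^{(r)}(M_a,δ) < ε is required for all δ' in (0,δ], not one δ: with a single δ (possibly huge) it follows from the bound C(r), and the claim fails, e.g. for T_a=[0,1], M_a(x)=(sin(ax),0), a in N. *)

(* Defs.v *)
From HB Require Import structures.
From mathcomp Require Import all_boot all_order all_algebra.
From mathcomp Require Import all_classical all_reals all_analysis.
Set Implicit Arguments.
Unset Strict Implicit.
Unset Printing Implicit Defensive.
Import Order.TTheory GRing.Theory Num.Theory.
Import numFieldNormedType.Exports.
Local Open Scope classical_set_scope.
Local Open Scope ring_scope.

(* Supremum in [0, +oo]: in contrast with ereal_sup, it is 0 on set0. *)
Definition nnsup (R : realType) (S : set (\bar R)) : \bar R :=
  ereal_sup (0%E |` S).

(* The library norm of R * R is the maximum norm. *)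
Definition enorm (R : realType) (p : R * R) : R :=
  Num.sqrt (p.1 ^+ 2 + p.2 ^+ 2).

Definition isometric_on (R : realType) (T : metricType R) (l : R)
    (f : R -> T) :=
  forall s t : R, s \in `[0, l] -> t \in `[0, l] -> mdist (f s) (f t) = `|s - t|.

Definition is_Rtree (R : realType) (T : metricType R) := forall z1 z2 : T,
  let l := mdist z1 z2 in
  exists f : R -> T,
    [/\ isometric_on l f, f 0 = z1, f l = z2,
        (forall g : R -> T, isometric_on l g -> g 0 = z1 -> g l = z2 ->
           {in `[0, l], g =1 f}) &
        (forall q : R -> T, {within `[0, 1], continuous q} ->
           {in `[0, 1] &, injective q} -> q 0 = z1 -> q 1 = z2 ->
           q @` `[0, 1] = f @` `[0, l])].

Definition cball (R : realType) (T : metricType R) (x : T) (r : R) : set T :=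
  [set z | mdist x z <= r].

Definition locally_little_holder (R : realType) (T : metricType R) (alpha : R)
    (M : T -> R * R) := forall K : set T, compact K ->
  nnsup [set x | exists z z' : T, [/\ K z, 0 < mdist z z' <= e &
           x = (enorm (M z - M z') / mdist z z' `^ alpha)%:E]]
    @[e --> 0^'+] --> 0%E.

(* A record with a field in metricType R would live in a universe too large for
   topologicalType, hence this presentation of metric spaces by their data;
   they are given the library structure of metricType. *)
Record metric_space (R : realType) := MetricSpace {
  points :> Type ;
  dist : points -> points -> R ;
  distxx : forall x, dist x x = 0 ;
  dist_positivity : forall x y, dist x y = 0 -> x = y ;
  dist_sym : forall x y, dist x y = dist y x ;
  dist_triangle : forall y x z, dist x z <= dist x y + dist y z
}.

HB.instance Definition _ (R : realType) (T : metric_space R) :=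
  gen_eqMixin (points T).
HB.instance Definition _ (R : realType) (T : metric_space R) :=
  gen_choiceMixin (points T).
HB.instance Definition _ (R : realType) (T : metric_space R) :=
  isMetric.Build R (points T) (@distxx R T) (@dist_positivity R T)
    (@dist_sym R T) (@dist_triangle R T).

(* The quadruplets (T, *, d, M). *)
Record spatial_tree (R : realType) (alpha : R) := SpatialTree {
  tree : metric_space R ;
  basept : tree ;
  evalM : tree -> R * R ;
  tree_Rtree : is_Rtree tree ;
  tree_complete : forall F : set_system tree,
    ProperFilter F -> cauchy F -> exists z : tree, F --> z ;
  tree_separable : exists2 D : set tree, countable D & dense D ;
  tree_compact : forall K : set tree, closed K ->
    (exists (x : tree) (r : R), K `<=` cball x r) -> compact K ;
  evalM_proper : forall K : set (R * R), compact K -> compact (evalM @^-1` K) ;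
  evalM_holder : locally_little_holder alpha evalM
}.
Arguments evalM {R alpha} s _.

HB.instance Definition _ (R : realType) (alpha : R) :=
  gen_eqMixin (spatial_tree alpha).
HB.instance Definition _ (R : realType) (alpha : R) :=
  gen_choiceMixin (spatial_tree alpha).

Definition tree_equiv (R : realType) (alpha : R)
    (zeta zeta' : spatial_tree alpha) : Prop :=
  exists phi : tree zeta -> tree zeta',
    [/\ bijective phi, {mono phi : z w / mdist z w},
        phi (basept zeta) = basept zeta' & evalM zeta' \o phi = evalM zeta].

Definition tree_equivb (R : realType) (alpha : R) : rel (spatial_tree alpha) :=
  fun zeta zeta' => `[< tree_equiv zeta zeta' >].

Lemma tree_equiv_refl (R : realType) (alpha : R) :
  reflexive (@tree_equivb R alpha).
Proof. by move=> z; apply/asboolP; exists id; split=> //; exists id. Qed.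

Lemma tree_equiv_imp (R : realType) (alpha : R) (z z' : spatial_tree alpha) :
  tree_equiv z z' -> tree_equiv z' z.
Proof.
move=> [f [[g fg gf] df fr fM]]; exists g; split.
- by exists f.
- by move=> x y; rewrite -df !gf.
- by rewrite -fr fg.
- by apply/funext => x /=; rewrite -fM /= gf.
Qed.

Lemma tree_equiv_sym (R : realType) (alpha : R) :
  symmetric (@tree_equivb R alpha).
Proof. by move=> z z'; apply/asboolP/asboolP; exact: tree_equiv_imp. Qed.

Lemma tree_equiv_trans (R : realType) (alpha : R) :
  transitive (@tree_equivb R alpha).
Proof.
move=> z2 z1 z3 /asboolP[f [bf df fr fM]] /asboolP[g [bg dg gr gM]].
apply/asboolP; exists (g \o f); split.
- exact: bij_comp.
- by move=> x y /=; rewrite dg df.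
- by rewrite /= fr gr.
- by rewrite compA gM fM.
Qed.

Canonical tree_equiv_rel (R : realType) (alpha : R) :=
  EquivRel (@tree_equivb R alpha) (@tree_equiv_refl R alpha)
    (@tree_equiv_sym R alpha) (@tree_equiv_trans R alpha).

Definition tball (R : realType) (alpha : R) (zeta : spatial_tree alpha)
  (r : R) : set (tree zeta) := cball (basept zeta) r.
Arguments tball {R alpha} zeta r _.

Definition modulus (R : realType) (alpha : R) (zeta : spatial_tree alpha)
    (r delta : R) : \bar R :=
  nnsup [set x | exists z w : tree zeta,
    [/\ tball zeta r z, tball zeta r w, mdist z w <= delta &
        x = (enorm (evalM zeta z - evalM zeta w))%:E]].

(* The set below is bounded because M is proper, and sup set0 = 0. *)
Definition properness_map (R : realType) (alpha : R)
    (zeta : spatial_tree alpha) (r : R) : R :=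
  if r < 0 then 0 else
  sup [set mdist (basept zeta) z | z in
        [set z | (evalM zeta z).1 \in `[- r, r] /\
                 (evalM zeta z).2 \in `[- r, r]]].

(* Functions on [-1, t] are represented by functions on R, whose values outside
   [-1, t] are irrelevant. *)
Definition cadlag (R : realType) (t : R) (f : R -> R) :=
  [/\ forall x : R, -1 <= x <= t -> 0 <= f x,
      forall x : R, -1 <= x < t -> f y @[y --> x^'+] --> f x &
      forall x : R, -1 < x <= t -> cvg (f y @[y --> x^'-])].

Definition left_value (R : realType) (f : R -> R) (x : R) : R :=
  if x <= -1 then f (-1) else lim (f y @[y --> x^'-]).

Definition completed_graph (R : realType) (t : R) (f : R -> R)
    : set (R * R) :=
  [set p | -1 <= p.2 <= t /\
     Num.min (left_value f p.2) (f p.2) <= p.1 <=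
     Num.max (left_value f p.2) (f p.2)].

(* Parametric representations (u, r) of the completed graph (space, time),
   nondecreasing for the order of the graph. *)
Definition param_repr (R : realType) (t : R) (f u r : R -> R) :=
  [/\ {within `[0, 1], continuous u}, {within `[0, 1], continuous r},
      [set (u s, r s) | s in `[0, 1]] = completed_graph t f &
      forall s s' : R, 0 <= s -> s <= s' -> s' <= 1 ->
        r s < r s' \/
        (r s = r s' /\
         `|left_value f (r s) - u s| <= `|left_value f (r s) - u s'|)].

Definition M1_dist (R : realType) (t : R) (f g : R -> R) : \bar R :=
  ereal_inf [set x | exists uf rf ug rg : R -> R,
    [/\ param_repr t f uf rf, param_repr t g ug rg &
        x = maxe (nnsup [set `|uf s - ug s|%:E | s in `[0, 1]])
                 (nnsup [set `|rf s - rg s|%:E | s in `[0, 1]])]].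

(* d t is, for each t >= 0, a complete metric on the cadlag functions from
   [-1, t] to R_+ which induces the M1 topology, i.e. the topology of M1_dist.
   The last clause makes the integral over t defining dM1 meaningful: the
   library integral of a non measurable function is only a lower integral. *)
Record M1_metric_family (R : realType)
    (d : R -> (R -> R) -> (R -> R) -> R) : Prop := {
  M1_ge0 : forall (t : R) (f g : R -> R), 0 <= t ->
    cadlag t f -> cadlag t g -> 0 <= d t f g ;
  M1_eq0 : forall (t : R) (f g : R -> R), 0 <= t ->
    cadlag t f -> cadlag t g -> (d t f g = 0 <-> {in `[-1, t], f =1 g}) ;
  M1_sym : forall (t : R) (f g : R -> R), 0 <= t ->
    cadlag t f -> cadlag t g -> d t f g = d t g f ;
  M1_triangle : forall (t : R) (f g h : R -> R), 0 <= t ->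
    cadlag t f -> cadlag t g -> cadlag t h -> d t f h <= d t f g + d t g h ;
  M1_topology : forall (t : R) (f : R -> R), 0 <= t -> cadlag t f ->
    forall e : R, 0 < e ->
    (exists2 eta : R, 0 < eta & forall g : R -> R, cadlag t g ->
       (M1_dist t f g < eta%:E)%E -> d t f g < e) /\
    (exists2 eta : R, 0 < eta & forall g : R -> R, cadlag t g ->
       d t f g < eta -> (M1_dist t f g < e%:E)%E) ;
  M1_complete : forall (t : R) (u : nat -> R -> R), 0 <= t ->
    (forall n, cadlag t (u n)) ->
    (forall e : R, 0 < e -> exists N : nat, forall m n : nat,
       (N <= m)%N -> (N <= n)%N -> d t (u m) (u n) < e) ->
    exists2 f : R -> R, cadlag t f & d t (u n) f @[n --> \oo] --> (0 : R) ;
  M1_measurable : forall f g : R -> R,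
    (forall t : R, 0 <= t -> cadlag t f) ->
    (forall t : R, 0 <= t -> cadlag t g) ->
    measurable_fun (`[0, +oo[ : set R) (fun t : R => d t f g)
}.

Definition dM1 (R : realType) (d : R -> (R -> R) -> (R -> R) -> R)
    (f g : R -> R) : \bar R :=
  (\int[lebesgue_measure]_(t in `[0%R, +oo[)
     (expR (- t) * Num.min 1 (d t f g))%R%:E)%E.

(* psi is only relevant on R_+; at 0 it is smooth because it vanishes on
   [0, 1/2[. *)
Definition dyadic_cutoff (R : realType) (psi : R -> R) :=
  [/\ forall (n : nat) (x : R), 0 < x -> derivable (derive1n n psi) x 1,
      forall x : R, 0 <= x -> 0 <= psi x <= 1,
      forall x : R, x \in `[1, 2] -> psi x = 1 &
      forall x : R, 0 <= x -> x \notin `[2^-1, 4] -> psi x = 0].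

Definition correspondence (T T' : Type) (S : set T) (S' : set T')
    (C : set (T * T')) :=
  [set p.1 | p in C] = S /\ [set p.2 | p in C] = S'.

Definition distortion (R : realType) (T T' : metricType R) (C : set (T * T'))
    : \bar R :=
  nnsup [set `|mdist p.1 q.1 - mdist p.2 q.2|%:E | p in C & q in C].

Definition scaled_incr (R : realType) (psi : R -> R) (T : metricType R)
    (M : T -> R * R) (n : nat) (z w : T) : R * R :=
  psi (2 ^+ n * mdist z w) *: (M z - M w).

Definition DeltaC (R : realType) (alpha : R) (psi : R -> R)
    (zeta zeta' : spatial_tree alpha) (C : set (tree zeta * tree zeta'))
    : \bar R :=
  ((2^-1)%:E * distortion C
   + nnsup [set (enorm (evalM zeta p.1 - evalM zeta' p.2))%:E | p in C]
   + nnsup [set (2 `^ (n%:R * alpha))%:E *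
        nnsup [set (enorm (scaled_incr psi (evalM zeta) n p.1 q.1
                           - scaled_incr psi (evalM zeta') n p.2 q.2))%:E
              | p in C & q in C] | n in [set: nat]])%E.

(* The distance of the compact spaces zeta^(r) and zeta'^(r): correspondences
   between the closed balls are subsets of the product of the whole trees. *)
Definition Delta_ball (R : realType) (alpha : R) (psi : R -> R)
    (zeta zeta' : spatial_tree alpha) (r : R) : \bar R :=
  ereal_inf [set DeltaC psi C | C in
    [set C | correspondence (tball zeta r) (tball zeta' r) C /\
             C (basept zeta, basept zeta')]].

Definition Delta_sp (R : realType) (alpha : R) (psi : R -> R)
    (d : R -> (R -> R) -> (R -> R) -> R) (zeta zeta' : spatial_tree alpha)
    : \bar R :=
  (\int[lebesgue_measure]_(r in `[0%R, +oo[)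
     ((expR (- r))%:E * mine 1 (Delta_ball psi zeta zeta' r))
   + dM1 d (properness_map zeta) (properness_map zeta'))%E.

(* The parameters psi and d are those of the metric. *)
Definition T_sp (R : realType) (alpha : R) (psi : R -> R)
    (d : R -> (R -> R) -> (R -> R) -> R) : Type :=
  {eq_quot (@tree_equivb R alpha)}%qT.
HB.instance Definition _ (R : realType) (alpha : R) psi d :=
  EqQuotient.on (@T_sp R alpha psi d).
HB.instance Definition _ (R : realType) (alpha : R) psi d :=
  Choice.on (@T_sp R alpha psi d).

Section metric_topology.
Variables (R : realType) (alpha : R) (psi : R -> R).
Variable d : R -> (R -> R) -> (R -> R) -> R.
Local Notation X := (T_sp alpha psi d).

Definition sp_ball (x : X) (e : R) : set X :=
  [set y | (Delta_sp psi d (repr x) (repr y) < e%:E)%E].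

Definition sp_open (U : set X) :=
  forall x, U x -> exists2 e : R, 0 < e & sp_ball x e `<=` U.

Let sp_openT : sp_open setT.
Proof. by move=> x _; exists 1. Qed.

Let sp_openI (U V : set X) : sp_open U -> sp_open V -> sp_open (U `&` V).
Proof.
move=> oU oV x [/oU[e e0 eU] /oV[e' e'0 eV]].
exists (Num.min e e'); first by rewrite lt_min e0.
move=> y yB; split; [apply: eU|apply: eV]; apply: (lt_le_trans yB).
  by rewrite lee_fin ge_min lexx.
by rewrite lee_fin ge_min lexx orbT.
Qed.

Let sp_open_bigU (I : Type) (f : I -> set X) :
  (forall i, sp_open (f i)) -> sp_open (\bigcup_i f i).
Proof.
move=> of_ x [i _ /of_[e e0 eU]]; exists e => // y /eU fy; by exists i.
Qed.

HB.instance Definition _ :=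
  isOpenTopological.Build X sp_openT sp_openI sp_open_bigU.
End metric_topology.

(* Cardinality of a minimal e-net of S (+oo if there is no finite one). *)
Definition net_number (R : realType) (T : metricType R) (S : set T) (e : R)
    : \bar R :=
  ereal_inf [set (size s)%:R%:E | s in
    [set s : seq T | [set` s] `<=` S /\
       forall z, S z -> exists2 w, w \in s & mdist z w <= e]].

(* Main.v *)
(* Necessity: each of the bounds holds uniformly on a small Delta_sp-ball around
   every tree, and finitely many such balls cover the closure. For the properness
   maps, a sequence converging in dM1 comes, for some t > r, arbitrarily close to
   its limit in the M1 topology of [-1, t], which bounds its values at r.

   Sufficiency: given a sequence of trees, let U be a nonprincipal ultrafilter on
   nat. Bounded families of points modulo vanishing U-limit of the distances form
   a limit tree: geodesics and Gromov's four-point condition pass to the limit and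
   characterize R-trees, and the nets make closed balls compact. Under the Hoelder
   condition, correspondences of small distortion along which the maps M are close
   have small Delta, so that the balls converge uniformly for bounded radii; the
   properness maps converge in the Levy sense, hence for the M1 distance at every
   continuity point t of the limit. A subsequence along which the errors vanish
   and dominated convergence conclude. *)
Require Import Defs.
From mathcomp Require Import all_boot all_order all_algebra.
From mathcomp Require Import all_classical all_reals all_analysis.
From mathcomp Require Import measurable_realfun.
From mathcomp Require Import ring lra.
Set Implicit Arguments.
Unset Strict Implicit.
Unset Printing Implicit Defensive.
Import Order.TTheory GRing.Theory Num.Theory.
Import numFieldNormedType.Exports.
Local Open Scope classical_set_scope.
Local Open Scope ring_scope.

(** An integral over radii only shows that some radius near a given one is good. Necessity therefore
    looks at a ball inside a slightly larger one, and the triangle inequality for [Delta_sp] needs a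
    measurable integrand. Geodesics towards the root make the integrand continuous in the radius;
    comparing balls of different radii, [Dball], serves that purpose.

    The Hoelder term is a supremum over infinitely many dyadic scales. Uniform little Hoelder moduli
    make both scaled increments small beyond some scale, so closeness of distances and of values has
    to settle only finitely many scales.

    An ultrafilter provides all limits at once, of points, distances and values, without diagonal
    extraction, but it grants only finitely many conditions simultaneously. Statements uniform in
    the radius or in the level of the properness map hence go through finite grids, completed by
    equicontinuity or by monotonicity. Integrals are the one place where a sequence is
    indispensable. *)

Section nnsup.
Variable R : realType.
Implicit Types (S : set (\bar R)) (b x : \bar R).

Lemma nnsup_ge0 S : (0 <= nnsup S)%E.
Proof. by apply: ereal_sup_ubound; left. Qed.

Lemma nnsup_ubound S x : S x -> (x <= nnsup S)%E.
Proof. by move=> Sx; apply: ereal_sup_ubound; right. Qed.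

Lemma ge_nnsup S b : (0 <= b)%E -> (forall x, S x -> x <= b)%E ->
  (nnsup S <= b)%E.
Proof. by move=> b0 Sb; apply: ge_ereal_sup => x [->|/Sb]. Qed.

End nnsup.

(** * The Euclidean norm of the plane *)

Section enorm.
Variable R : realType.
Implicit Types p q : R * R.

Lemma enorm_ge0 p : 0 <= enorm p.
Proof. exact: sqrtr_ge0. Qed.

Lemma sqr_enorm p : enorm p ^+ 2 = p.1 ^+ 2 + p.2 ^+ 2.
Proof. by rewrite sqr_sqrtr// addr_ge0// sqr_ge0. Qed.

Lemma enorm0 : enorm (0 : R * R) = 0.
Proof. by rewrite /enorm/= expr0n/= addr0 sqrtr0. Qed.

Lemma enormZ (a : R) p : enorm (a *: p) = `|a| * enorm p.
Proof.
by rewrite /enorm/= !exprMn -mulrDr sqrtrM ?sqr_ge0// sqrtr_sqr.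
Qed.

Lemma enormN p : enorm (- p) = enorm p.
Proof. by rewrite -scaleN1r enormZ normrN1 mul1r. Qed.

Lemma enormD p q : enorm (p + q) <= enorm p + enorm q.
Proof.
have p0 := enorm_ge0 p; have q0 := enorm_ge0 q.
have := sqr_enorm p; have := sqr_enorm q => Eq Ep.
rewrite -(@ler_pXn2r _ 2)// ?nnegrE ?enorm_ge0 ?addr_ge0//.
rewrite [leRHS]sqrrD Eq Ep sqr_enorm /=.
have pq : p.1 * q.1 + p.2 * q.2 <= enorm p * enorm q.
  apply: (le_trans (ler_norm _)).
  rewrite -(@ler_pXn2r _ 2)// ?nnegrE ?mulr_ge0 ?normr_ge0//.
  rewrite real_normK ?num_real// exprMn Ep Eq -subr_ge0.
  rewrite (_ : _ - _ = (p.1 * q.2 - p.2 * q.1) ^+ 2) ?sqr_ge0//; ring.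
lra.
Qed.

Lemma enorm_distC p q : enorm (p - q) = enorm (q - p).
Proof. by rewrite -enormN opprB. Qed.

Lemma enorm_dist3 p q r : enorm (p - r) <= enorm (p - q) + enorm (q - r).
Proof. by apply: le_trans (enormD _ _); rewrite addrA subrK. Qed.

Lemma enormB_le p q : enorm (p - q) <= enorm p + enorm q.
Proof. by rewrite -(enormN q); exact: enormD. Qed.

Lemma enorm_le_sum p : enorm p <= `|p.1| + `|p.2|.
Proof.
rewrite -(@ler_pXn2r _ 2)// ?nnegrE ?enorm_ge0 ?addr_ge0//.
rewrite sqr_enorm [leRHS]sqrrD !real_normK ?num_real//.
have : 0 <= `|p.1| * `|p.2| by rewrite mulr_ge0.
lra.
Qed.

Lemma norm1_le_enorm p : `|p.1| <= enorm p.
Proof.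
rewrite -(@ler_pXn2r _ 2)// ?nnegrE ?enorm_ge0//.
by rewrite sqr_enorm real_normK ?num_real// lerDl sqr_ge0.
Qed.

Lemma norm2_le_enorm p : `|p.2| <= enorm p.
Proof.
rewrite -(@ler_pXn2r _ 2)// ?nnegrE ?enorm_ge0//.
by rewrite sqr_enorm real_normK ?num_real// lerDr sqr_ge0.
Qed.

End enorm.

(** * R-trees and the four-point condition *)

Section interval_paths.
Variable R : realType.

(** Connectedness of a segment: local constancy carries [P] to the supremum of the points where it
    holds, and past this supremum if it were below [b]. *)
Lemma locally_constant_itv (a b : R) (P : R -> Prop) : a <= b ->
  (forall t, a <= t <= b -> exists2 d, 0 < d &
     forall s, a <= s <= b -> `|t - s| < d -> (P s <-> P t)) ->
  P a -> P b.
Proof.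
move=> ab loc Pa; pose S := [set t | a <= t <= b /\ P t].
have Sa : S a by split => //; rewrite lexx.
have hS : has_sup S by split; [exists a | exists b => t [/andP[]]].
have ubS t : S t -> t <= sup S by exact: sup_upper_bound.
have sS : a <= sup S <= b.
  by rewrite ubS//= ge_sup//; [exists a | move=> t [/andP[]]].
have [d d0 locS] := loc _ sS.
have [t St St'] := sup_adherent d0 hS.
have PS : P (sup S).
  apply/(locS t); [exact: St.1| |exact: St.2].
  by rewrite ger0_norm ?subr_ge0 ?ubS// ltrBlDr -ltrBlDl.
have [Sb|Sb] := ltP (sup S) b; last first.
  by rewrite (_ : b = sup S)//; apply/eqP; rewrite eq_le Sb (andP sS).2.
pose s := Num.min b (sup S + d / 2).
have sS' : sup S < s by rewrite lt_min Sb ltrDl divr_gt0.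
have sB : a <= s <= b.
  by rewrite ge_min lexx/= andbT (le_trans (andP sS).1)// ltW.
suff /ubS : S s by rewrite leNgt sS'.
split => //; apply/(locS s sB) => //.
rewrite ltr0_norm ?subr_lt0// opprB ltrBlDr gt_min addrC ltrD2l.
by rewrite ltr_pdivrMr// ltr_pMr// ltr1n orbT.
Qed.

Lemma within_itv_continuousP (T : metricType R) (a b : R) (q : R -> T) :
  {within `[a, b], continuous q} <->
  (forall t, a <= t <= b -> forall e, 0 < e -> exists2 d, 0 < d &
     forall s, a <= s <= b -> `|t - s| < d -> mdist (q t) (q s) < e).
Proof.
split.
  move=> /subspace_continuousP cq t tab e e0.
  have /cq : `[a, b]%classic t by rewrite /= in_itv.
  move=> /metricType_numDomainType.cvgrPdist_lt/(_ _ e0).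
  rewrite near_withinE => -[d/= d0 dq]; exists d => // s sab ts.
  by apply: dq => //=; rewrite in_itv.
move=> cq; apply/subspace_continuousP => t; rewrite /= in_itv/= => tab.
apply/metricType_numDomainType.cvgrPdist_lt => e e0.
have [d d0 dq] := cq t tab e e0.
rewrite near_withinE; exists d => //= s/= ts; rewrite in_itv/= => sab.
exact: dq.
Qed.

End interval_paths.

Section four_point.
Variables (R : realType) (T : metricType R).
Implicit Types x y z w : T.

(* Gromov's 0-hyperbolicity. *)
Definition four_point := forall x y z w,
  mdist x y + mdist z w <= mdist x z + mdist y w \/
  mdist x y + mdist z w <= mdist x w + mdist y z.

Lemma isometric_on_start l (f : R -> T) s : isometric_on l f ->
  0 <= s <= l -> mdist (f 0) (f s) = s.
Proof.
move=> fi /andP[s0 sl]; rewrite fi ?in_itv/= ?lexx ?s0 ?(le_trans s0)//.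
by rewrite sub0r normrN ger0_norm.
Qed.

Lemma isometric_on_end l (f : R -> T) s : isometric_on l f ->
  0 <= s <= l -> mdist (f s) (f l) = l - s.
Proof.
move=> fi /andP[s0 sl]; rewrite fi ?in_itv/= ?lexx ?s0 ?(le_trans s0)//.
by rewrite distrC ger0_norm ?subr_ge0.
Qed.

(* Beyond their last common point, f run backwards and then g form an injective
   path, whose range is therefore the geodesic from x to y. *)
Lemma rtree_tripod x y w (f g : R -> T) : is_Rtree T ->
  isometric_on (mdist w x) f -> f 0 = w -> f (mdist w x) = x ->
  isometric_on (mdist w y) g -> g 0 = w -> g (mdist w y) = y ->
  let s := (mdist w x + mdist w y - mdist x y) / 2 in
  [/\ 0 <= s, s <= mdist w x, s <= mdist w y & f s = g s].
Proof.
move=> RT fi f0 fx gi g0 gy s.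
have wx0 := mdist_ge0 w x; have wy0 := mdist_ge0 w y.
have tri1 := metric_triangle x w y; have tri2 := metric_triangle w x y.
have tri3 := metric_triangle w y x.
rewrite (metric_sym x w) in tri1; rewrite (metric_sym y x) in tri3.
split; rewrite /s; [lra|lra|lra|].
have fi' a b : 0 <= a <= mdist w x -> 0 <= b <= mdist w x ->
    mdist (f a) (f b) = `|a - b| by move=> *; apply: fi; rewrite in_itv.
have gi' a b : 0 <= a <= mdist w y -> 0 <= b <= mdist w y ->
    mdist (g a) (g b) = `|a - b| by move=> *; apply: gi; rewrite in_itv.
have df a : 0 <= a <= mdist w x -> mdist w (f a) = a.
  by move/(isometric_on_start fi); rewrite f0.
have dg a : 0 <= a <= mdist w y -> mdist w (g a) = a.
  by move/(isometric_on_start gi); rewrite g0.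
pose S := [set t | [/\ 0 <= t, t <= mdist w x, t <= mdist w y & f t = g t]].
have S0 : S 0 by split => //; rewrite f0 g0.
have hS : has_sup S by split; [exists 0 | exists (mdist w x) => t []].
have ubS t : S t -> t <= sup S by exact: sup_upper_bound.
have s0x : sup S <= mdist w x by apply: ge_sup; [exists 0|move=> t []].
have s0y : sup S <= mdist w y by apply: ge_sup; [exists 0|move=> t []].
have s00 : 0 <= sup S by exact: ubS.
have fgS : f (sup S) = g (sup S).
  apply: mdist_positivity; apply/eqP; rewrite eq_le mdist_ge0 andbT leNgt.
  apply/negP => e0; have := e0; rewrite -(@pmulr_lgt0 _ (1 / 2))//.
  move=> /sup_adherent/(_ hS)[t [t0 tx ty fgt] St].
  have tS : t <= sup S by apply: ubS.
  have := metric_triangle (f (sup S)) (f t) (g (sup S)).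
  rewrite fi' ?s00 ?t0// fgt gi' ?s00 ?t0//.
  rewrite ger0_norm ?subr_ge0// (distrC t) ger0_norm ?subr_ge0//; lra.
have S_max t : 0 <= t -> t <= mdist w x -> t <= mdist w y -> f t = g t ->
  t <= sup S by move=> *; apply: ubS.
clear S0 hS ubS; move: (sup S) s0x s0y s00 fgS S_max => s0 s0x s0y s00 fgS s0m.
clear S.
have [A EA] : exists A, A = mdist w x - s0 by exists (mdist w x - s0).
have [B EB] : exists B, B = mdist w y - s0 by exists (mdist w y - s0).
have [L EL] : exists L, L = A + B by exists (A + B).
pose h u := if u <= A then f (mdist w x - u) else g (s0 + (u - A)).
(* If [f s0] lies between [x] and [y], its distances to them, [mdist w x - s0] and [mdist w y - s0],
   add up to [mdist x y], so that [s0] is the Gromov product [s]. *)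
suff xc : mdist x y = mdist x (f s0) + mdist (f s0) y.
  suff -> : (mdist w x + mdist w y - mdist x y) / 2 = s0 by [].
  have e1 : mdist x (f s0) = mdist w x - s0.
    by rewrite -{1}fx fi' ?wx0 ?lexx ?s00// ger0_norm ?subr_ge0.
  have e2 : mdist (f s0) y = mdist w y - s0.
    rewrite fgS -{1}gy gi' ?wy0 ?lexx ?s00//.
    by rewrite distrC ger0_norm ?subr_ge0.
  by rewrite xc e1 e2; lra.
have h0 : h 0 = x by rewrite /h ifT ?EA ?subr_ge0// subr0.
have hA : h A = f s0 by rewrite /h lexx EA; congr f; ring.
have hL : h L = y.
  rewrite /h; case: ifPn => [|_].
    move=> B0; have e : mdist w y = s0 by lra.
    rewrite (_ : _ - _ = s0) ?fgS -?e//.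
    by lra.
  by rewrite -[RHS]gy; congr g; lra.
have hlip a b : 0 <= a -> a <= b -> b <= L -> mdist (h a) (h b) <= b - a.
  rewrite /h => a0 ab bL; case: ifPn => aA; case: ifPn => bA.
  - rewrite fi' ?ler_norml; try lra.
  - rewrite -ltNge in bA; apply: (le_trans (metric_triangle _ (f s0) _)).
    rewrite {2}fgS fi'; try lra.
    rewrite gi'; try lra.
    rewrite ger0_norm; last by lra.
    rewrite ler0_norm; last by lra.
    by lra.
  - by rewrite (le_trans ab) in aA.
  - rewrite -ltNge in bA; rewrite -ltNge in aA.
    rewrite gi' ?ler_norml; lra.
have hlip2 a b : 0 <= a <= L -> 0 <= b <= L -> mdist (h a) (h b) <= `|a - b|.
  move=> /andP[a0 aL] /andP[b0 bL]; have [ab|/ltW ab] := leP a b.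
    by rewrite distrC ger0_norm ?subr_ge0//; exact: hlip.
  by rewrite ger0_norm ?subr_ge0// metric_sym; exact: hlip.
have A0 : 0 <= A by rewrite EA subr_ge0.
have B0 : 0 <= B by rewrite EB subr_ge0.
have L0 : 0 <= L by rewrite EL addr_ge0.
(* A path of length 0 cannot be rescaled to the unit interval. *)
have [L00|Lp] := eqVneq L 0.
  have A00 : A = 0 by lra.
  rewrite -hL L00 -A00 hA (_ : x = f s0) ?mdistxx ?addr0//.
  by rewrite -hA A00 h0.
have {Lp}Lp : 0 < L by rewrite lt_def Lp.
have hinj a b : 0 <= a -> a < b -> b <= L -> h a = h b -> False.
  rewrite /h => a0 ab bL; case: ifPn => aA; case: ifPn => bA.
  - move=> /(congr1 (mdist (f (mdist w x - a)))).
    rewrite mdistxx fi'; try lra.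
    rewrite ger0_norm; try lra.
  (* Equal points on the two branches are equally far from [w], hence give a common point of [f] and
     [g] at a time beyond [s0]. *)
  - rewrite -ltNge in bA => e.
    have : mdist w x - a = s0 + (b - A).
      by have := congr1 (mdist w) e; rewrite df ?dg//; lra.
    move=> e2; rewrite -e2 in e; have := s0m _ _ _ _ e.
    by lra.
  - by rewrite (le_trans (ltW ab)) in aA.
  - rewrite -ltNge in bA; rewrite -ltNge in aA.
    move=> /(congr1 (mdist (g (s0 + (a - A))))).
    rewrite mdistxx gi' ?ler0_norm; lra.
have [k [ki k0 ky _ arc]] := RT x y.
pose q t := h (t * L).
have := arc q; rewrite /q mul0r mul1r h0 hL.
have itv t : 0 <= t <= 1 -> 0 <= t * L <= L.
  by move=> /andP[t0 t1]; rewrite mulr_ge0//= ler_piMl.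
move=> /(_ _ _ erefl erefl) imq.
have : [set h (t * L) | t in `[0, 1]] (f s0).
  exists (A / L); last by rewrite divfK ?gt_eqF.
  by rewrite /= in_itv/= divr_ge0//= ler_pdivrMr// mul1r EL lerDl.
rewrite imq.
- move=> [t /=]; rewrite in_itv/= => t0l <-.
  have := isometric_on_start ki t0l; have := isometric_on_end ki t0l.
  by rewrite k0 ky => -> ->; rewrite addrC subrK.
- apply/within_itv_continuousP => t /itv tL e e0.
  exists (e / L); first by rewrite divr_gt0.
  move=> u /itv uL tu; apply: (le_lt_trans (hlip2 _ _ tL uL)).
  by rewrite -mulrBl normrM (ger0_norm L0) -ltr_pdivlMr.
- move=> t u; rewrite !in_itv/= => /itv /andP[tL0 tL1] /itv /andP[uL0 uL1] e.
  apply: (mulIf (lt0r_neq0 Lp)).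
  have [lt|lt|//] := ltgtP (t * L) (u * L).
    by have := hinj _ _ tL0 lt uL1 e.
  by have := hinj _ _ uL0 lt tL1 (esym e).
Qed.

(** The geodesics from [w] to [x] and to [z] branch off the one to [y] at the heights [a] and [b],
    which are Gromov products. Travelling from [x] to [z] through both branching points bounds
    [mdist x z], and the order of [a] and [b] decides which alternative holds. *)
Lemma rtree_four_point : is_Rtree T -> four_point.
Proof.
move=> RT x z y w.
have [fx [fxi fx0 fxx _ _]] := RT w x.
have [fy [fyi fy0 fyy _ _]] := RT w y.
have [fz [fzi fz0 fzz _ _]] := RT w z.
have /= [] := rtree_tripod RT fxi fx0 fxx fyi fy0 fyy.
set a := _ / 2 => a0 ax ay fxy.
have /= [] := rtree_tripod RT fyi fy0 fyy fzi fz0 fzz.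
set b := _ / 2 => b0 b_y bz fyz.
have : mdist x z <= mdist x (fx a) + mdist (fy a) (fy b) + mdist (fz b) z.
  rewrite -fxy -fyz; apply: le_trans (metric_triangle _ (fy b) _) _.
  by rewrite lerD2r metric_triangle.
have a_itv : 0 <= a <= mdist w x by rewrite a0.
have b_itv : 0 <= b <= mdist w z by rewrite b0.
have := isometric_on_end fxi a_itv; rewrite fxx metric_sym => ->.
have := isometric_on_end fzi b_itv; rewrite fzz => ->.
rewrite fyi ?in_itv/= ?a0 ?b0//.
rewrite !(metric_sym _ w) (metric_sym z y).
have [ab|/ltW ab] := leP a b.
  rewrite distrC ger0_norm ?subr_ge0// => H.
  by left; rewrite /a /b in H ab *; lra.
rewrite ger0_norm ?subr_ge0// => H.
by right; rewrite /a /b in H ab *; lra.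
Qed.

(* The points separated from v by m form a clopen part of the complement of m. *)
Lemma four_point_hits u v m (a b : R) (q : R -> T) : four_point ->
  a <= b -> {within `[a, b], continuous q} -> q a = u -> q b = v ->
  mdist u m + mdist m v = mdist u v -> exists2 t, a <= t <= b & q t = m.
Proof.
move=> fp ab /within_itv_continuousP cq qa qb muv.
apply: contrapT => nhit.
pose P t := mdist (q t) m + mdist m v = mdist (q t) v.
(* Two points closer to each other than through [m] lie on the same side of [m]: the strict
   inequality excludes one alternative of the four-point condition. *)
have side z w : mdist z w < mdist z m + mdist w m ->
    mdist z m + mdist m v = mdist z v -> mdist w m + mdist m v = mdist w v.
  move=> zw zP; have tri := metric_triangle w m v.
  have := fp z v m w; rewrite -zP (metric_sym v w) (metric_sym v m).
  by rewrite (metric_sym m w); case; lra.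
have : P b.
  apply: (locally_constant_itv ab); last by rewrite /P qa.
  move=> t tab; have qtm : 0 < mdist (q t) m.
    by rewrite mdist_gt0; apply/eqP => e; apply: nhit; exists t.
  have [d d0 dq] := cq t tab _ qtm; exists d => // s sab ts.
  have := dq s sab ts; have := mdist_ge0 (q s) m => sm0 H.
  by split; apply: side => //; rewrite ?(metric_sym (q s) (q t)); lra.
rewrite /P qb mdistxx (metric_sym v m) => e.
have /mdist_positivity bm : mdist v m = 0 by rewrite (metric_sym v m); lra.
by apply: nhit; exists b => //; rewrite ?ab ?lexx// qb.
Qed.

(** In both alternatives for the pairs [z], [w] and [x], [y] the right-hand side equals [mdist x y],
    which leaves no room for [mdist z w]. *)
Lemma four_point_geodesic_eq x y z w : four_point ->
  mdist x z + mdist z y = mdist x y -> mdist x w = mdist x z ->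
  mdist w y = mdist z y -> z = w.
Proof.
move=> fp e1 e2 e3; apply: mdist_positivity; apply/eqP.
rewrite eq_le mdist_ge0 andbT.
have := fp z w x y.
by rewrite !(metric_sym _ x) e2 e3; case; lra.
Qed.

(** By [four_point_hits] a path visits the whole geodesic. Were an injective path to visit a point
    [z] off the geodesic, it would pass the branching point of the tripod [x], [y], [z] both before
    and after [z]. *)
Lemma four_point_rtree : four_point ->
  (forall x y, exists f, [/\ isometric_on (mdist x y) f, f 0 = x &
     f (mdist x y) = y]) -> is_Rtree T.
Proof.
move=> fp geo x y l; rewrite /l; clear l.
have [f [fi f0 fl]] := geo x y; exists f.
have onf g : isometric_on (mdist x y) g -> g 0 = x -> g (mdist x y) = y ->
    forall s, 0 <= s <= mdist x y ->
    mdist x (g s) = s /\ mdist (g s) y = mdist x y - s.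
  move=> gi g0 gl s sl; have := isometric_on_end gi sl.
  by have := isometric_on_start gi sl; rewrite g0 gl.
have onfE s z : 0 <= s <= mdist x y -> mdist x z = s ->
    mdist z y = mdist x y - s -> f s = z.
  move=> sl e1 e2; have [e3 e4] := onf f fi f0 fl s sl.
  by apply: (four_point_geodesic_eq fp (x:=x) (y:=y)); rewrite ?e3 ?e4//; lra.
split => //.
  move=> g gi g0 gl s; rewrite in_itv/= => sl.
  have [e3 e4] := onf g gi g0 gl s sl.
  by symmetry; apply: onfE.
move=> q cq qi q0 q1.
have hit (a b : R) m : 0 <= a -> a <= b -> b <= 1 ->
    mdist (q a) m + mdist m (q b) = mdist (q a) (q b) ->
    exists2 t, a <= t <= b & q t = m.
  move=> a0 ab b1; apply: four_point_hits => //.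
  apply: continuous_subspaceW cq => t; rewrite /= !in_itv/=.
  by move=> /andP[at_ tb]; rewrite (le_trans a0)//= (le_trans tb).
apply/seteqP; split => z /=.
  move=> [t]; rewrite in_itv/= => t01 qt.
  have [xzy|xzy] := eqVneq (mdist x z + mdist z y) (mdist x y).
    have tri := mdist_ge0 z y.
    exists (mdist x z); first by rewrite /= in_itv/= mdist_ge0/=; lra.
    by apply: onfE => //; rewrite ?mdist_ge0/=; lra.
  have xzy' : mdist x y < mdist x z + mdist z y.
    by rewrite lt_neqAle eq_sym xzy metric_triangle.
  have [f1 [f1i f10 f1l]] := geo z x.
  have [f2 [f2i f20 f2l]] := geo z y.
  (* The Gromov product of [x] and [y] seen from [z]; it is positive because [z] is off the
     geodesic. *)
  pose a := (mdist x z + mdist z y - mdist x y) / 2.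
  have a0 : 0 < a by rewrite /a; lra.
  have tri1 := metric_triangle x y z; have tri2 := metric_triangle z x y.
  rewrite (metric_sym y z) in tri1; rewrite (metric_sym z x) in tri2.
  have ax : a <= mdist z x by rewrite (metric_sym z x) /a; lra.
  have ay : a <= mdist z y by rewrite /a; lra.
  have ax' : 0 <= a <= mdist z x by rewrite (ltW a0).
  have ay' : 0 <= a <= mdist z y by rewrite (ltW a0).
  have := isometric_on_start f1i ax'; rewrite f10 => d1.
  have := isometric_on_start f2i ay'; rewrite f20 => d2.
  have := isometric_on_end f1i ax'; rewrite f1l => d3.
  have := isometric_on_end f2i ay'; rewrite f2l => d4.
  (* The quadruple with [x] bounds the distance from [f1 a] to [y] by [mdist z y - a]; given this,
     both alternatives for the other quadruple identify the two points. *)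
  have e12 : f1 a = f2 a.
    apply: mdist_positivity; apply/eqP; rewrite eq_le mdist_ge0 andbT.
    have := fp (f1 a) y x z; have := fp (f1 a) (f2 a) y z.
    rewrite !(metric_sym _ z) (metric_sym y x) d1 d2 d3 d4.
    by rewrite /a (metric_sym z x); case; case; lra.
  have [t1 t1b qt1] := hit 0 t (f1 a) (lexx _) (andP t01).1 (andP t01).2
    ltac:(by rewrite q0 qt (metric_sym x (f1 a)) d3 (metric_sym (f1 a) z) d1
             metric_sym subrK).
  have [t2 t2b qt2] := hit t 1 (f2 a) (andP t01).1 (andP t01).2 (lexx _)
    ltac:(by rewrite q1 qt d4 d2 addrC subrK).
  have t12 : t1 = t2.
    apply: qi; rewrite ?in_itv/= ?qt1 ?qt2 ?e12//; lra.
  have t1t : t1 = t by lra.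
  have : mdist z (f1 a) = 0 by rewrite -qt1 t1t qt mdistxx.
  by rewrite d1; lra.
move=> [s]; rewrite in_itv/= => sl <-.
have [e3 e4] := onf f fi f0 fl s sl.
have [t t01 <-] := hit 0 1 (f s) (lexx _) ler01 (lexx _)
  ltac:(by rewrite q0 q1 e3 e4 addrC subrK).
by exists t => //; rewrite /= in_itv.
Qed.

End four_point.

(** * Correspondences between balls *)

(** On the compact segment from [4^-1] to [5] the derivative is bounded and the mean value theorem
    applies. Since [psi] vanishes below [2^-1] and beyond [4], arguments outside the segment can be
    moved to its ends, changing neither the value of [psi] nor increasing their distance. *)
Lemma dyadic_cutoff_lipschitz (R : realType) (psi : R -> R) :
  dyadic_cutoff psi -> exists2 K, 0 <= K &
  forall x y, 0 <= x -> 0 <= y -> `|psi x - psi y| <= K * `|x - y|.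
Proof.
move=> [dpsi _ _ psi0].
have dpsi0 (x : R) : 0 < x -> derivable psi x 1 by move=> /(dpsi 0%N).
have dpsi1 (x : R) : 0 < x -> derivable (derive1 psi) x 1 by move=> /(dpsi 1%N).
have pos (x : R) : x \in `[4^-1, 5] -> 0 < x.
  by rewrite in_itv/= => /andP[+ _]; apply: lt_le_trans.
have : {within `[4^-1, 5], continuous (derive1 psi)}.
  by apply: derivable_within_continuous => x /pos/dpsi1.
move=> /continuous_compact/(_ (@segment_compact _ _ _)).
move=> /compact_bounded[K [_ /(_ (`|K| + 1))]].
rewrite (le_lt_trans (ler_norm _)) ?ltrDl// => /(_ isT) Kpsi.
have K0 : 0 <= `|K| + 1 by rewrite addr_ge0.
exists (`|K| + 1) => //.
have mvt a b : 4^-1 <= a -> a <= b -> b <= 5 ->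
    `|psi b - psi a| <= (`|K| + 1) * `|b - a|.
  move=> a4 ab b5.
  have sub x : a <= x -> x <= b -> x \in `[4^-1, 5].
    by move=> ax xb; rewrite in_itv/= (le_trans a4)//= (le_trans xb).
  have [||c] := @MVT_segment _ psi (derive1 psi) a b ab.
  - move=> x; rewrite in_itv/= => /andP[ax xb].
    by rewrite derive1E; apply/derivableP/dpsi0/pos/sub; exact: ltW.
  - apply: derivable_within_continuous => x; rewrite in_itv/= => /andP[ax xb].
    exact/dpsi0/pos/sub.
  - rewrite in_itv/= => /andP[ac cb] ->; rewrite normrM ler_wpM2r//.
    by apply: Kpsi; exists c => //; apply: sub.
suff main x y : 0 <= x -> x <= y -> `|psi y - psi x| <= (`|K| + 1) * `|y - x|.
  move=> x y x0 y0; have [xy|/ltW xy] := leP x y; last exact: main.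
  by rewrite distrC (distrC x); exact: main.
move=> x0 xy; have y0 := le_trans x0 xy.
have z0 z : 0 <= z -> z < 2^-1 -> psi z = 0.
  by move=> *; apply: psi0 => //; rewrite in_itv/= leNgt; apply/negP; lra.
have z4 z : 4 < z -> psi z = 0.
  move=> z4; apply: psi0; first lra.
  by rewrite in_itv/= negb_and -!ltNge z4 orbT.
have [y2|y2] := ltP y 2^-1; first by rewrite !z0 ?subrr ?normr0 ?mulr_ge0//; lra.
have [x4|x4] := ltP 4 x; first by rewrite !z4 ?subrr ?normr0 ?mulr_ge0//; lra.
pose x' := Num.max x 4^-1; pose y' := Num.min y 5.
have xE : psi x = psi x'.
  rewrite /x'; case: ltP => // xlt; rewrite !z0//; lra.
have yE : psi y = psi y'.
  rewrite /y'; case: ltP => // ylt; rewrite !z4//; lra.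
have [Ex Ey] : (x' = Num.max x 4^-1) /\ (y' = Num.min y 5) by [].
have x'1 : 4^-1 <= x' by rewrite Ex le_max lexx orbT.
have x'2 : x <= x' by rewrite Ex le_max lexx.
have y'1 : y' <= y by rewrite Ey ge_min lexx.
have y'2 : y' <= 5 by rewrite Ey ge_min lexx orbT.
have xy' : x' <= y'.
  by rewrite Ex Ey ge_max !le_min xy /= ; lra.
rewrite xE yE (le_trans (mvt _ _ x'1 xy' y'2))// ler_wpM2l//.
by rewrite !ger0_norm; lra.
Qed.

Section DeltaC.
Variables (R : realType) (alpha : R) (psi : R -> R).
Implicit Types (z : spatial_tree alpha) (r e : R).

Let scale_gt0 n : 0 < (2 `^ (n%:R * alpha) : R).
Proof. by rewrite powR_gt0. Qed.
Let scale_ge0 n : 0 <= (2 `^ (n%:R * alpha) : R).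
Proof. exact: ltW. Qed.

Lemma ge_DeltaC z1 z2 (C : set (tree z1 * tree z2)) (b1 b2 b3 : \bar R) :
  (0 <= b1)%E -> (0 <= b2)%E -> (0 <= b3)%E ->
  (forall p q, C p -> C q ->
     (`|mdist p.1 q.1 - mdist p.2 q.2|%:E <= b1)%E) ->
  (forall p, C p -> ((enorm (evalM z1 p.1 - evalM z2 p.2))%:E <= b2)%E) ->
  (forall n p q, C p -> C q -> ((2 `^ (n%:R * alpha) *
     enorm (scaled_incr psi (evalM z1) n p.1 q.1
            - scaled_incr psi (evalM z2) n p.2 q.2))%:E <= b3)%E) ->
  (DeltaC psi C <= (2^-1)%:E * b1 + b2 + b3)%E.
Proof.
move=> b10 b20 b30 h1 h2 h3; rewrite /DeltaC; apply: leeD; first apply: leeD.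
- rewrite lee_wpmul2l// ?lee_fin//.
  by apply: ge_nnsup => // _ [p Cp [q Cq <-]]; exact: h1.
- by apply: ge_nnsup => // _ [p Cp <-]; exact: h2.
- apply: ge_nnsup => // _ [n _ <-]; rewrite -lee_pdivlMl//; apply: ge_nnsup.
    by rewrite mule_ge0// lee_fin ltW// invr_gt0.
  move=> _ [p Cp [q Cq <-]]; rewrite lee_pdivlMl// -EFinM; exact: h3.
Qed.

Lemma DeltaC_dist z1 z2 (C : set (tree z1 * tree z2)) p q : C p -> C q ->
  ((2^-1 * `|mdist p.1 q.1 - mdist p.2 q.2|)%:E <= DeltaC psi C)%E.
Proof.
move=> Cp Cq; rewrite /DeltaC -addeA; apply: le_trans (leeDl _ _).
  rewrite EFinM lee_wpmul2l// ?lee_fin//.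
  by apply: nnsup_ubound; exists p => //; exists q.
by rewrite adde_ge0// nnsup_ge0.
Qed.

Lemma DeltaC_evalM z1 z2 (C : set (tree z1 * tree z2)) p : C p ->
  ((enorm (evalM z1 p.1 - evalM z2 p.2))%:E <= DeltaC psi C)%E.
Proof.
move=> Cp; rewrite /DeltaC addeAC; apply: le_trans (leeDr _ _).
  by apply: nnsup_ubound; exists p.
by rewrite adde_ge0// ?mule_ge0// ?nnsup_ge0// lee_fin.
Qed.

Lemma DeltaC_holder z1 z2 (C : set (tree z1 * tree z2)) n p q :
  C p -> C q -> ((2 `^ (n%:R * alpha) *
     enorm (scaled_incr psi (evalM z1) n p.1 q.1
            - scaled_incr psi (evalM z2) n p.2 q.2))%:E <= DeltaC psi C)%E.
Proof.
move=> Cp Cq; rewrite /DeltaC; apply: le_trans (leeDr _ _).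
  apply: (@le_trans _ _ ((2 `^ (n%:R * alpha))%:E *
    nnsup [set (enorm (scaled_incr psi (evalM z1) n p.1 q.1
                       - scaled_incr psi (evalM z2) n p.2 q.2))%:E
              | p in C & q in C])%E); last by apply: nnsup_ubound; exists n.
  rewrite EFinM lee_wpmul2l ?lee_fin ?scale_ge0//.
  by apply: nnsup_ubound; exists p => //; exists q.
by rewrite adde_ge0// ?mule_ge0// ?nnsup_ge0// lee_fin.
Qed.

Lemma DeltaC_ge0 z1 z2 (C : set (tree z1 * tree z2)) : (0 <= DeltaC psi C)%E.
Proof.
rewrite /DeltaC !adde_ge0 ?nnsup_ge0// mule_ge0 ?nnsup_ge0// lee_fin//.
Qed.

Definition corr_comp (T1 T2 T3 : Type) (C : set (T1 * T2)) (D : set (T2 * T3)) :=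
  [set p | exists2 y, C (p.1, y) & D (y, p.2)].

Lemma correspondenceP (T1 T2 : Type) (A : set T1) (B : set T2) C :
  correspondence A B C <-> [/\ forall x y, C (x, y) -> A x /\ B y,
    forall x, A x -> exists y, C (x, y) & forall y, B y -> exists x, C (x, y)].
Proof.
split=> [[<- <-]|[h1 h2 h3]].
  split=> [x y Cxy|x [[x' y'] Cxy /= <-]|y [[x' y'] Cxy /= <-]].
  - by split; [exists (x, y)|exists (x, y)].
  - by exists y'.
  - by exists x'.
split; apply/seteqP; split => x /=.
- by move=> [[x' y'] /h1[? _] /= <-].
- by move=> /h2[y Cxy]; exists (x, y).
- by move=> [[x' y'] /h1[_ ?] /= <-].
- by move=> /h3[y Cxy]; exists (y, x).
Qed.

Lemma correspondence_comp (T1 T2 T3 : Type) (A : set T1) (B : set T2)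
    (D : set T3) C C' : correspondence A B C -> correspondence B D C' ->
  correspondence A D (corr_comp C C').
Proof.
move=> /correspondenceP[h1 h2 h3] /correspondenceP[k1 k2 k3].
apply/correspondenceP; split.
- by move=> x z [y /h1[? _] /k1[_ ?]].
- by move=> x /h2[y Cxy]; have [_ /k2[w Cyw]] := h1 _ _ Cxy; exists w; exists y.
- by move=> z /k3[y Cyz]; have [/h3[w Cwy] _] := k1 _ _ Cyz; exists w; exists y.
Qed.

Lemma DeltaC_comp z1 z2 z3 (C : set (tree z1 * tree z2))
    (D : set (tree z2 * tree z3)) :
  (DeltaC psi (corr_comp C D) <= DeltaC psi C + DeltaC psi D)%E.
Proof.
rewrite /(DeltaC psi C) /(DeltaC psi D).
rewrite addeACA [X in (_ <= X + _)%E]addeACA -ge0_muleDr ?nnsup_ge0//.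
apply: ge_DeltaC; rewrite ?adde_ge0 ?nnsup_ge0//.
- move=> [p1 p3] [q1 q3] [p2 /= Cp Dp] [q2 /= Cq Dq].
  apply: (@le_trans _ _ ((`|mdist p1 q1 - mdist p2 q2|)%:E
    + (`|mdist p2 q2 - mdist p3 q3|)%:E)%E).
    by rewrite -EFinD lee_fin ler_distD.
  apply: leeD; apply: nnsup_ubound.
    by exists (p1, p2) => //; exists (q1, q2).
  by exists (p2, p3) => //; exists (q2, q3).
- move=> [p1 p3] [p2 /= Cp Dp].
  apply: (@le_trans _ _ ((enorm (evalM z1 p1 - evalM z2 p2))%:E
    + (enorm (evalM z2 p2 - evalM z3 p3))%:E)%E).
    by rewrite -EFinD lee_fin enorm_dist3.
  apply: leeD; apply: nnsup_ubound; first by exists (p1, p2).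
  by exists (p2, p3).
- move=> n [p1 p3] [q1 q3] [p2 /= Cp Dp] [q2 /= Cq Dq].
  set x1 := scaled_incr _ _ _ p1 _; set x3 := scaled_incr _ _ _ p3 _.
  pose x2 := scaled_incr psi (evalM z2) n p2 q2.
  apply: (@le_trans _ _ ((2 `^ (n%:R * alpha) * enorm (x1 - x2))%:E
    + (2 `^ (n%:R * alpha) * enorm (x2 - x3))%:E)%E).
    by rewrite -EFinD lee_fin -mulrDr ler_wpM2l ?enorm_dist3 ?scale_ge0.
  apply: leeD.
    apply: (@le_trans _ _ ((2 `^ (n%:R * alpha))%:E *
      nnsup [set (enorm (scaled_incr psi (evalM z1) n p.1 q.1
                       - scaled_incr psi (evalM z2) n p.2 q.2))%:E
              | p in C & q in C])%E); last by apply: nnsup_ubound; exists n.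
    rewrite EFinM lee_wpmul2l ?lee_fin ?scale_ge0//.
    by apply: nnsup_ubound; exists (p1, p2) => //; exists (q1, q2).
  apply: (@le_trans _ _ ((2 `^ (n%:R * alpha))%:E *
    nnsup [set (enorm (scaled_incr psi (evalM z2) n p.1 q.1
                     - scaled_incr psi (evalM z3) n p.2 q.2))%:E
            | p in D & q in D])%E); last by apply: nnsup_ubound; exists n.
  rewrite EFinM lee_wpmul2l ?lee_fin ?scale_ge0//.
  by apply: nnsup_ubound; exists (p2, p3) => //; exists (q2, q3).
Qed.

Lemma DeltaC_inv z1 z2 (C : set (tree z1 * tree z2)) :
  (DeltaC psi [set p | C (p.2, p.1)] <= DeltaC psi C)%E.
Proof.
rewrite [leRHS]/DeltaC; apply: ge_DeltaC; rewrite ?nnsup_ge0//.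
- move=> [p1 p2] [q1 q2] /= Cp Cq; rewrite distrC; apply: nnsup_ubound.
  by exists (p2, p1) => //; exists (q2, q1).
- move=> [p1 p2] /= Cp; rewrite enorm_distC; apply: nnsup_ubound.
  by exists (p2, p1).
- move=> n [p1 p2] [q1 q2] /= Cp Cq; rewrite enorm_distC.
  apply: (@le_trans _ _ ((2 `^ (n%:R * alpha))%:E *
    nnsup [set (enorm (scaled_incr psi (evalM z1) n p.1 q.1
                     - scaled_incr psi (evalM z2) n p.2 q.2))%:E
            | p in C & q in C])%E); last by apply: nnsup_ubound; exists n.
  rewrite EFinM lee_wpmul2l ?lee_fin ?scale_ge0//.
  by apply: nnsup_ubound; exists (p2, p1) => //; exists (q2, q1).
Qed.

(* Delta_ball is the case r1 = r2; with two radii, the triangle inequality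
   yields the continuity of Delta_ball in the radius. *)
Definition Dball z1 z2 r1 r2 : \bar R :=
  ereal_inf [set DeltaC psi C | C in
    [set C | correspondence (tball z1 r1) (tball z2 r2) C /\
             C (basept z1, basept z2)]].

Lemma Dball_ge0 z1 z2 r1 r2 : (0 <= Dball z1 z2 r1 r2)%E.
Proof. by apply: le_ereal_inf_tmp => _ [C _ <-]; exact: DeltaC_ge0. Qed.

Lemma Dball_le z1 z2 r1 r2 C b :
  correspondence (tball z1 r1) (tball z2 r2) C ->
  C (basept z1, basept z2) -> (DeltaC psi C <= b)%E -> (Dball z1 z2 r1 r2 <= b)%E.
Proof. by move=> h1 h2; apply: le_trans; apply: ereal_inf_lbound; exists C. Qed.

Lemma Dball_sym z1 z2 r1 r2 : Dball z1 z2 r1 r2 = Dball z2 z1 r2 r1.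
Proof.
have main z z' r r' : (Dball z z' r r' <= Dball z' z r' r)%E.
  apply: le_ereal_inf_tmp => _ [C [/correspondenceP[h1 h2 h3] Cb] <-].
  apply: (@Dball_le _ _ _ _ [set p | C (p.2, p.1)]) => //; last exact: DeltaC_inv.
  apply/correspondenceP; split; [by move=> x y /h1[]|exact: h3|exact: h2].
by apply/eqP; rewrite eq_le !main.
Qed.

Lemma Dball_triangle z1 z2 z3 r1 r2 r3 :
  (Dball z1 z3 r1 r3 <= Dball z1 z2 r1 r2 + Dball z2 z3 r2 r3)%E.
Proof.
have [->|] := eqVneq (Dball z1 z2 r1 r2) +oo%E.
  by rewrite addye ?leey// gt_eqF// (lt_le_trans _ (Dball_ge0 _ _ _ _))// ltNy0.
have [->|] := eqVneq (Dball z2 z3 r2 r3) +oo%E.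
  by rewrite addey ?leey// gt_eqF// (lt_le_trans _ (Dball_ge0 _ _ _ _))// ltNy0.
rewrite -!ltey => f2 f1; apply/lee_addgt0Pr => e e0.
have e2 : 0 < e / 2 by rewrite divr_gt0.
have fin1 : Dball z1 z2 r1 r2 \is a fin_num by rewrite ge0_fin_numE ?Dball_ge0.
have fin2 : Dball z2 z3 r2 r3 \is a fin_num by rewrite ge0_fin_numE ?Dball_ge0.
have [_ [C [C1 C2] <-] Ce] := lb_ereal_inf_adherent e2 fin1.
have [_ [D [D1 D2] <-] De] := lb_ereal_inf_adherent e2 fin2.
apply: (@Dball_le _ _ _ _ (corr_comp C D)).
- exact: correspondence_comp D1.
- by exists (basept z2).
- apply: (le_trans (DeltaC_comp _ _)).
  apply: (le_trans (leeD (ltW Ce) (ltW De))).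
  by rewrite addeACA -EFinD -splitr.
Qed.

Lemma tree_equiv_Dball0 z1 z2 r : 0 <= r -> tree_equiv z1 z2 ->
  Dball z1 z2 r r = 0%E.
Proof.
move=> r0 [f [[g fg gf] fd fr fM]]; apply/eqP; rewrite eq_le Dball_ge0 andbT.
pose C := [set p : tree z1 * tree z2 | tball z1 r p.1 /\ p.2 = f p.1].
have fM' x : evalM z2 (f x) = evalM z1 x by rewrite -fM.
have e0 : (0 : \bar R)%E = ((2^-1)%:E * 0 + 0 + 0)%E by rewrite mule0 !adde0.
apply: (@Dball_le _ _ _ _ C).
- apply/correspondenceP; split => /=.
  + by move=> x y [/= xr ->]; split => //; rewrite /tball /cball/= -fr fd.
  + by move=> x xr; exists (f x).
  + move=> y yr; exists (g y); split; rewrite /= ?gf//.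
    by rewrite /tball /cball/= -fd fr gf.
- by split; rewrite /= ?fr// /tball /cball/= mdistxx.
- rewrite [leRHS]e0; apply: ge_DeltaC => //.
  + by move=> [p1 p2] [q1 q2] [/= _ ->] [/= _ ->]; rewrite fd subrr normr0.
  + by move=> [p1 p2] [/= _ ->]; rewrite fM' subrr enorm0.
  + move=> n [p1 p2] [q1 q2] [/= _ ->] [/= _ ->].
    by rewrite /scaled_incr fd !fM' subrr enorm0 mulr0.
Qed.

End DeltaC.

Section small_correspondence.
Variables (R : realType) (alpha : R) (psi : R -> R).
Hypothesis halpha : 0 < alpha < 1.
Hypothesis hpsi : dyadic_cutoff psi.
Implicit Types (z : spatial_tree alpha) (r e : R).

Let alpha_gt0 : 0 < alpha. Proof. by case/andP: halpha. Qed.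
Let alpha_ge0 : 0 <= alpha. Proof. exact: ltW. Qed.
Let alpha_le1 : alpha <= 1. Proof. by case/andP: halpha => _ /ltW. Qed.

Definition evalM_bound z r C := forall x, tball z r x -> enorm (evalM z x) <= C.

(** The little Hoelder condition in a form that can be uniform over trees: all scales up to [d] are
    controlled with the same small constant [e], as the dyadic supremum in [DeltaC] demands. *)
Definition evalM_modulus z r d e := forall x y, tball z r x -> tball z r y ->
  mdist x y <= d -> enorm (evalM z x - evalM z y) <= e * mdist x y `^ alpha.

Lemma powR_exprn (x : R) n : 0 <= x -> x `^ (n%:R * alpha) = (x ^+ n) `^ alpha.
Proof. by move=> x0; rewrite powRrM powR_mulrn. Qed.

Lemma psi01 x : 0 <= x -> 0 <= psi x <= 1.
Proof. by case: hpsi => _ + _ _; exact. Qed.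

Lemma enorm_scaled_incr z n x y : enorm (scaled_incr psi (evalM z) n x y) =
  psi (2 ^+ n * mdist x y) * enorm (evalM z x - evalM z y).
Proof.
rewrite /scaled_incr enormZ ger0_norm//.
by have /andP[] : 0 <= psi (2 ^+ n * mdist x y) <= 1
  by apply: psi01; rewrite mulr_ge0 ?exprn_ge0 ?mdist_ge0.
Qed.

(** The cutoff kills the increment unless [2 ^+ n * mdist x y] is at most 4. In that case the dyadic
    weight times [mdist x y]^ alpha[is at most]4 [^ alpha], hence at most 4. *)
Lemma scaled_incr_small z r d e n x y : 0 <= e -> evalM_modulus z r d e ->
  tball z r x -> tball z r y -> 4 / 2 ^+ n <= d ->
  2 `^ (n%:R * alpha) * enorm (scaled_incr psi (evalM z) n x y) <= 4 * e.
Proof.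
move=> e0 Me xr yr nd; rewrite enorm_scaled_incr.
have d0 : 0 <= 2 ^+ n * mdist x y by rewrite mulr_ge0 ?exprn_ge0 ?mdist_ge0.
have [d4|d4] := leP (2 ^+ n * mdist x y) 4; last first.
  case: hpsi => _ _ _ -> //; first by rewrite mul0r mulr0 mulr_ge0.
  by rewrite in_itv/= negb_and -!ltNge d4 orbT.
have xyd : mdist x y <= d.
  by apply: le_trans nd; rewrite ler_pdivlMr ?exprn_gt0// mulrC.
have /andP[p0 p1] := psi01 d0.
apply: (@le_trans _ _ (2 `^ (n%:R * alpha) * (e * mdist x y `^ alpha))).
  rewrite ler_wpM2l ?powR_ge0// -[leRHS]mul1r ler_pM// ?enorm_ge0//.
  exact: Me.
rewrite powR_exprn// mulrCA -powRM ?exprn_ge0 ?mdist_ge0// mulrC ler_wpM2r//.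
apply: (@le_trans _ _ (4 `^ alpha)).
  by rewrite ge0_ler_powR// ?nnegrE.
by rewrite -[leRHS]powRr1// ler_powR// ler1n.
Qed.

(* For large n both scaled increments are small by the modulus; for the finitely
   many remaining n, psi is Lipschitz. *)
Lemma DeltaC_small e d K : 0 < e -> 0 < d -> 0 <= K -> exists2 eta, 0 < eta &
  forall z1 z2 r1 r2 (C : set (tree z1 * tree z2)),
  evalM_bound z1 r1 K -> evalM_modulus z1 r1 d e -> evalM_modulus z2 r2 d e ->
  (forall x y, C (x, y) -> tball z1 r1 x /\ tball z2 r2 y) ->
  (forall x y x' y', C (x, y) -> C (x', y') ->
     `|mdist x x' - mdist y y'| <= eta) ->
  (forall x y, C (x, y) -> enorm (evalM z1 x - evalM z2 y) <= eta) ->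
  (DeltaC psi C <= (10 * e)%:E)%E.
Proof.
move=> e0 d0 K0; have [L L0 Lpsi] := dyadic_cutoff_lipschitz hpsi.
(* For the remaining scales [2 ^+ n] is at most [4 / d], and this bounds the dyadic weight as well
   as the dilation inside [psi]; [L] is the Lipschitz constant of [psi] and [2 * K] bounds an
   increment of [M]. *)
pose B := 4 / d * (L * (4 / d) * (2 * K) + 2).
have B0 : 0 <= B by rewrite !mulr_ge0 ?addr_ge0 ?mulr_ge0 ?invr_ge0 ?(ltW d0).
have B1 : 0 < B + 1 by rewrite ltr_pwDr.
pose eta := e / (B + 1).
have eta0 : 0 < eta by rewrite divr_gt0.
have etae : eta <= e by rewrite ler_pdivrMr// ler_peMr ?(ltW e0)// lerDr.
have Beta : B * eta <= e.
  rewrite /eta mulrCA ler_piMr ?(ltW e0)// ler_pdivrMr// mul1r lerDl//.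
exists eta => // z1 z2 r1 r2 C bd1 mod1 mod2 Cball Cdist CM.
(* Half the distortion takes [e / 2], the values of the maps take [e], and the scaled increments
   [8 * e], namely [4 * e] for each tree at small scales. *)
apply: (@le_trans _ _ ((2^-1)%:E * e%:E + e%:E + (8 * e)%:E)%E); last first.
  by rewrite -EFinM -!EFinD lee_fin; lra.
apply: ge_DeltaC; rewrite ?lee_fin ?mulr_ge0 ?(ltW e0)//.
- move=> [x y] [x' y'] /= Cp Cq; rewrite lee_fin (le_trans _ etae)//.
  exact: Cdist.
- by move=> [x y] /= Cp; rewrite lee_fin (le_trans _ etae)//; exact: CM.
move=> n [x y] [x' y'] /= Cp Cq; rewrite lee_fin.
have [xr1 yr2] := Cball _ _ Cp; have [xr1' yr2'] := Cball _ _ Cq.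
have [nd|nd] := leP (4 / 2 ^+ n) d.
  have h1 := scaled_incr_small (ltW e0) mod1 xr1 xr1' nd.
  have h2 := scaled_incr_small (ltW e0) mod2 yr2 yr2' nd.
  apply: (le_trans (ler_wpM2l (powR_ge0 _ _) (enormB_le _ _))).
  rewrite mulrDr; lra.
have n4 : 2 ^+ n <= 4 / d.
  by rewrite ler_pdivlMr// mulrC -ler_pdivlMr ?exprn_gt0// ltW.
set a := mdist x x'; set b := mdist y y'.
have an0 : 0 <= 2 ^+ n * a by rewrite mulr_ge0 ?exprn_ge0 ?mdist_ge0.
have bn0 : 0 <= 2 ^+ n * b by rewrite mulr_ge0 ?exprn_ge0 ?mdist_ge0.
have /andP[b0 b1] := psi01 bn0.
set u := evalM z1 x; set u' := evalM z1 x'.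
set v := evalM z2 y; set v' := evalM z2 y'.
(* The change of the cutoff is separated from the change of the increment. *)
have -> : scaled_incr psi (evalM z1) n x x' - scaled_incr psi (evalM z2) n y y'
    = (psi (2 ^+ n * a) - psi (2 ^+ n * b)) *: (u - u')
      + psi (2 ^+ n * b) *: ((u - v) - (u' - v')).
  rewrite /scaled_incr -/a -/b -/u -/u' -/v -/v' scalerBl -addrA; congr (_ + _).
  rewrite (_ : (u - v) - (u' - v') = (u - u') - (v - v')); last first.
    by rewrite !opprB !addrA addrAC -!addrA; congr (_ + _); rewrite addrC -!addrA.
  by rewrite [in RHS](scalerBr _ (u - u')) addKr.
apply: (@le_trans _ _ ((4 / d) * (L * (4 / d * eta) * (2 * K) + 2 * eta))).
  apply: ler_pM; rewrite ?powR_ge0 ?enorm_ge0//.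
    apply: le_trans n4; rewrite powR_exprn// -[leRHS]powRr1 ?exprn_ge0//.
    by rewrite ler_powR// exprn_ege1// ler1n.
  apply: (le_trans (enormD _ _)); rewrite !enormZ; apply: lerD.
    apply: ler_pM; rewrite ?enorm_ge0//.
      apply: (le_trans (Lpsi _ _ an0 bn0)); rewrite ler_wpM2l// -mulrBr normrM.
      rewrite ger0_norm ?exprn_ge0//; apply: ler_pM => //.
      exact: Cdist.
    rewrite mulr2n mulrDl mul1r; apply: (le_trans (enormB_le _ _)).
    by apply: lerD; exact: bd1.
  rewrite ger0_norm// -[leRHS]mul1r; apply: ler_pM; rewrite ?enorm_ge0//.
  rewrite mulr2n mulrDl mul1r; apply: (le_trans (enormB_le _ _)).
  by apply: lerD; exact: CM.
rewrite (_ : _ * _ = B * eta); last by rewrite /B; ring.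
by apply: (le_trans Beta); rewrite ler_peMl ?(ltW e0)// ler1n.
Qed.

(** Geodesics to the root make concentric balls of nearby radii close to each other, which fails in
    a general metric space. The continuity of [Dball] in the radii and the lifting of balls of the
    limit tree rest on this. *)
Lemma rtree_toward_root z r r' x : 0 <= r' -> r' <= r -> tball z r x ->
  exists2 y, tball z r' y & mdist x y <= r - r'.
Proof.
move=> r0 rr xr; have [xr'|xr'] := leP (mdist (basept z) x) r'.
  by exists x => //; rewrite mdistxx subr_ge0.
have [f [fi f0 fl _ _]] := tree_Rtree (basept z) x.
have itv : 0 <= r' <= mdist (basept z) x by rewrite r0 ltW.
have := isometric_on_start fi itv; rewrite f0 => d0.
have := isometric_on_end fi itv; rewrite fl => dl.
exists (f r'); first by rewrite /tball /cball /= d0.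
by rewrite metric_sym dl lerD2r.
Qed.

Lemma ge0_tball_basept z r : 0 <= r -> tball z r (basept z).
Proof. by rewrite /tball /cball/= mdistxx. Qed.

Lemma tball_subset z r r' x : r <= r' -> tball z r x -> tball z r' x.
Proof. by move=> rr; rewrite /tball /cball/= => /le_trans; exact. Qed.

Lemma evalM_bound_le z r r' K : r' <= r ->
  evalM_bound z r K -> evalM_bound z r' K.
Proof. by move=> rr bd x /(tball_subset rr)/bd. Qed.

Lemma evalM_modulus_le z r r' d d' e : r' <= r -> d' <= d ->
  evalM_modulus z r d e -> evalM_modulus z r' d' e.
Proof.
move=> rr dd md x y /(tball_subset rr) xr /(tball_subset rr) yr xy.
by apply: md => //; exact: le_trans dd.
Qed.

(** The point is uniformity: [h] depends on the tree only through the bound [K] and the modulus [d],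
    so that one mesh of radii serves a whole sequence of trees. Points at distance at most [r - r']
    are paired. *)
Lemma Dball_radius e d K : 0 < e -> 0 < d -> 0 <= K -> exists2 h, 0 < h &
  forall z s r r', evalM_bound z s K -> evalM_modulus z s d e ->
  0 <= r <= s -> 0 <= r' <= s -> `|r - r'| <= h ->
  (Dball psi z z r r' <= (10 * e)%:E)%E.
Proof.
move=> e0 d0 K0; have [eta eta0 small] := DeltaC_small e0 d0 K0.
pose h := Num.min (eta / 2) (Num.min d ((eta / e) `^ (alpha^-1))).
have h0 : 0 < h by rewrite !lt_min d0 powR_gt0 divr_gt0.
have [h1 h2 h3] : [/\ h <= eta / 2, h <= d & h <= (eta / e) `^ (alpha^-1)].
  by rewrite /h !ge_min !lexx !orbT.
have heta : e * h `^ alpha <= eta.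
  rewrite mulrC -ler_pdivlMr//.
  apply: (@le_trans _ _ (((eta / e) `^ (alpha^-1)) `^ alpha)).
    by rewrite ge0_ler_powR// ?nnegrE ?powR_ge0// ltW.
  by rewrite -powRrM mulVf ?gt_eqF// powRr1// ltW// divr_gt0.
exists h => // z s r r' bd md.
wlog rr : r r' / r' <= r => [wl|].
  move=> rs rs' rr; have [rr'|/ltW rr'] := leP r' r; first exact: wl.
  by rewrite Dball_sym; apply: wl => //; rewrite distrC.
move=> /andP[r0 rs] /andP[r0' rs']; rewrite ger0_norm ?subr_ge0// => rrh.
pose C := [set p : tree z * tree z | [/\ tball z r p.1, tball z r' p.2 &
             mdist p.1 p.2 <= r - r']].
have CM x y : C (x, y) -> mdist x y <= h.
  by move=> [/= _ _ /le_trans]; exact.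
apply: (@Dball_le _ _ _ _ _ _ _ C).
- apply/correspondenceP; split => [x y []//|x xr|y yr].
    by have [y yr xy] := rtree_toward_root r0' rr xr; exists y.
  exists y; split => //=; first exact: tball_subset yr.
  by rewrite mdistxx subr_ge0.
- split; rewrite /= ?mdistxx ?subr_ge0//; exact: ge0_tball_basept.
apply: (small z z r r').
- exact: evalM_bound_le bd.
- exact: evalM_modulus_le md.
- exact: evalM_modulus_le md.
- by move=> x y [].
- move=> x y x' y' /CM xy /CM xy'.
  have t1 := metric_triangle x y x'; have t2 := metric_triangle y y' x'.
  have t3 := metric_triangle y x y'; have t4 := metric_triangle x x' y'.
  rewrite (metric_sym y' x') in t2; rewrite (metric_sym y x) in t3.
  by rewrite ler_norml; lra.
- move=> x y Cxy; have xy := CM _ _ Cxy; have [/= xr yr _] := Cxy.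
  apply: (le_trans (md x y _ _ _)).
  + exact: tball_subset xr.
  + exact: tball_subset yr.
  + exact: le_trans h2.
  + apply: le_trans heta; rewrite ler_wpM2l ?(ltW e0)// ge0_ler_powR//.
      by rewrite nnegrE mdist_ge0.
    by rewrite nnegrE ltW.
Qed.

End small_correspondence.

(** * Compactness and the properness map of a single tree *)

(** Along the filter of ever larger finite sequences each point of [K] eventually has a covered
    neighbourhood, so near-covering compactness yields one sequence for all of [K]. Members outside
    [K] are discarded at the end. *)
Lemma compact_nbhs_cover (T : topologicalType) (K : set T) (V : T -> set T) :
  compact K -> (forall x, K x -> nbhs x (V x)) ->
  exists s : seq T, [set` s] `<=` K /\
    forall z, K z -> exists2 w, w \in s & V w z.
Proof.
move=> /compact_near_coveringP cK nV.
pose F : set_system (seq T) :=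
  filter_from setT (fun s0 : seq T => [set s : seq T | {subset s0 <= s}]).
have FF : Filter F.
  apply: filter_from_filter; first by exists [::].
  move=> s1 s2 _ _; exists (s1 ++ s2) => // s /= sub.
  by split=> x xs; apply: sub; rewrite mem_cat xs ?orbT.
pose P (s : seq T) z := exists w, [/\ w \in s, K w & V w z].
have [|s0 _] := cK _ F P FF.
  move=> x Kx; exists (V x, [set s : seq T | {subset [:: x] <= s}]).
    split; first exact: nV.
    by exists [:: x].
  by move=> [z s] [/= xz sub]; exists x; split => //; rewrite sub ?inE.
move=> /(_ s0 (fun _ => @id _)) sub; exists [seq x <- s0 | `[< K x >]].
split; first by move=> x /=; rewrite mem_filter => /andP[/asboolP].
move=> z /sub[w [ws Kw zw]]; exists w => //.
by rewrite mem_filter ws andbT; apply/asboolP.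
Qed.

Section metric_space_facts.
Variables (R : realType) (T : metricType R).

Lemma mdist_continuous (x : T) : continuous (mdist x : T -> R).
Proof.
move=> y; apply/(@cvgrPdist_lt _ R^o) => e e0.
apply/metricType_numDomainType.nbhs_mdistP; exists e => // z /= yz.
apply: le_lt_trans yz; rewrite ler_norml.
have t1 := metric_triangle x y z; have t2 := metric_triangle x z y.
by rewrite (metric_sym z y) in t2; lra.
Qed.

Lemma closed_cball (x : T) r : closed (cball x r).
Proof.
apply: (@preimage_closed _ _ (mdist x : T -> R) [set s | s <= r]).
  by move=> y _; exact: mdist_continuous.
exact: closed_le.
Qed.

Lemma compact_finite_net (S : set T) e : 0 < e -> compact S ->
  exists s : seq T, [set` s] `<=` S /\
    forall z, S z -> exists2 w, w \in s & mdist z w <= e.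
Proof.
move=> e0 cS; have [|s [sS cov]] := compact_nbhs_cover (V := ball^~ e) cS.
  by move=> x _; exact: nbhsx_ballx.
exists s; split => // z /cov[w ws wz]; exists w => //.
by rewrite metric_sym ltW//; move: wz; rewrite ballEmdist.
Qed.

Lemma net_number_le (S : set T) e (s : seq T) : [set` s] `<=` S ->
  (forall z, S z -> exists2 w, w \in s & mdist z w <= e) ->
  (net_number S e <= (size s)%:R%:E)%E.
Proof. by move=> sS cov; apply: ereal_inf_lbound; exists s. Qed.

Lemma net_number_ex (S : set T) e N : (net_number S e <= N%:R%:E)%E ->
  exists s : seq T, [/\ (size s <= N)%N, [set` s] `<=` S &
    forall z, S z -> exists2 w, w \in s & mdist z w <= e].
Proof.
move=> H; have : (net_number S e < N.+1%:R%:E)%E.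
  by rewrite (le_lt_trans H)// lte_fin ltr_nat.
move=> /ereal_inf_lt[_ [s [sS cov] <-]]; rewrite lte_fin ltr_nat ltnS => sN.
by exists s.
Qed.

(* The points of s need not lie in S, whence the doubled mesh. *)
Lemma net_number_sub (S : set T) e (s : seq T) :
  (forall z, S z -> exists2 w, w \in s & mdist z w <= e) ->
  (net_number S (2 * e) <= (size s)%:R%:E)%E.
Proof.
move=> cov.
pose P w z := S z /\ mdist z w <= e.
pose s1 := [seq w <- s | `[< exists z, P w z >]].
pose g w := xget w (P w).
have gP w z : P w z -> P w (g w).
  by move=> h; exact: (xgetPex w (ex_intro _ _ h)).
apply: (@le_trans _ _ (size (map g s1))%:R%:E).
  apply: net_number_le.
    move=> z /= /mapP[w]; rewrite mem_filter => /andP[/asboolP[z' /gP[? _]] _].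
    by move=> ->.
  move=> z Sz; have [w ws zw] := cov z Sz.
  have Pwz : P w z by [].
  exists (g w).
    apply: map_f; rewrite mem_filter ws andbT; apply/asboolP; by exists z.
  have [_ gw] := gP _ _ Pwz.
  have := metric_triangle z w (g w); rewrite (metric_sym w (g w)); lra.
by rewrite size_map lee_fin ler_nat size_filter count_size.
Qed.

Variable alpha : R.
Hypothesis alpha_gt0 : 0 < alpha.

Lemma powR_small e : 0 < e ->
  exists2 h, 0 < h & forall x, 0 <= x -> x <= h -> x `^ alpha <= e.
Proof.
move=> e0; exists (e `^ (alpha^-1)); first by rewrite powR_gt0.
move=> x x0 xh; apply: (@le_trans _ _ ((e `^ (alpha^-1)) `^ alpha)).
  by rewrite ge0_ler_powR ?nnegrE ?powR_ge0// ltW.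
by rewrite -powRrM mulVf ?gt_eqF// powRr1// ltW.
Qed.

Lemma norm_le_enorm (p : R * R) : `|p| <= enorm p.
Proof. by rewrite prod_normE ge_max norm1_le_enorm norm2_le_enorm. Qed.

Lemma enorm_le_norm (p : R * R) : enorm p <= 2 * `|p|.
Proof.
apply: (le_trans (enorm_le_sum p)); rewrite prod_normE.
have a1 : `|p.1| <= Num.max `|p.1| `|p.2| by rewrite le_max lexx.
have a2 : `|p.2| <= Num.max `|p.1| `|p.2| by rewrite le_max lexx orbT.
lra.
Qed.

Lemma holder_continuous (M : T -> R * R) :
  (forall x, exists2 d, 0 < d & exists2 K, 0 <= K & forall y,
     mdist x y <= d -> enorm (M x - M y) <= K * mdist x y `^ alpha) ->
  continuous M.
Proof.
move=> hM x; have [d d0 [K K0 MK]] := hM x.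
apply/cvgrPdist_le => e e0.
have K1 : 0 < K + 1 by rewrite ltr_pwDr.
have [h h0 hx] := powR_small (divr_gt0 e0 K1).
apply/metricType_numDomainType.nbhs_mdistP.
exists (Num.min d h); first by rewrite /= lt_min d0.
move=> y /=; rewrite lt_min => /andP[xd xh].
apply: (le_trans (norm_le_enorm _)); apply: (le_trans (MK _ (ltW xd))).
have := hx _ (mdist_ge0 x y) (ltW xh); rewrite ler_pdivlMr// => H.
apply: le_trans H; rewrite mulrC ler_wpM2l ?powR_ge0//; lra.
Qed.

End metric_space_facts.

Section spatial_tree_facts.
Variables (R : realType) (alpha : R).
Hypothesis halpha : 0 < alpha < 1.
Implicit Types (z : spatial_tree alpha) (r e : R).

Let alpha_gt0 : 0 < alpha. Proof. by case/andP: halpha. Qed.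

Lemma compact_tball z r : compact (tball z r).
Proof.
apply: tree_compact; first exact: closed_cball.
by exists (basept z), r.
Qed.

Lemma locally_little_holder_ex (T : metricType R) (M : T -> R * R) (K : set T) e :
  0 < e -> locally_little_holder alpha M -> compact K ->
  exists2 d, 0 < d & forall x y, K x -> mdist x y <= d ->
    enorm (M x - M y) <= e * mdist x y `^ alpha.
Proof.
move=> e0 hM cK.
pose H d := nnsup [set x : \bar R | exists z z' : T,
  [/\ K z, 0 < mdist z z' <= d &
      x = (enorm (M z - M z') / mdist z z' `^ alpha)%:E]].
have [d [d0 de]] : exists d, 0 < d /\ (H d < e%:E)%E.
  have /= He : \forall d \near 0^'+, (H d < e%:E)%E.
    by have := hM K cK _ (@nbhs_open_ereal_lt _ 0 (fun=> e) e0).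
  near (0:R)^'+ => d; exists d; split; near: d; last exact: He.
  exact: nbhs_right_gt.
exists d => // x y Kx xyd.
have [xy0|xy0] := eqVneq (mdist x y) 0.
  by rewrite (mdist_positivity _ _ xy0) subrr enorm0 mulr_ge0 ?powR_ge0 ?ltW.
have {}xy0 : 0 < mdist x y by rewrite lt_def xy0 mdist_ge0.
rewrite -ler_pdivrMr ?powR_gt0// -lee_fin; apply: le_trans (ltW de).
by apply: nnsup_ubound; exists x, y; rewrite xy0 xyd.
Unshelve. all: by end_near. Qed.

Lemma evalM_modulus_ex z r e : 0 < e ->
  exists2 d, 0 < d & evalM_modulus z r d e.
Proof.
move=> e0; have [d d0 H] :=
  locally_little_holder_ex e0 (@evalM_holder _ _ z) (@compact_tball z r).
by exists d => // x y xr _; exact: H.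
Qed.

Lemma evalM_continuous z : continuous (evalM z).
Proof.
apply: (holder_continuous alpha_gt0) => x.
have [d d0 H] := locally_little_holder_ex ltr01 (@evalM_holder _ _ z)
  (@compact_tball z (mdist (basept z) x)).
exists d => //; exists 1 => // y; apply: H.
by rewrite /tball /cball/=.
Qed.

Lemma evalM_bound_ex z r : exists2 K, 0 <= K & evalM_bound z r K.
Proof.
have : compact (evalM z @` tball z r).
  apply: continuous_compact; last exact: compact_tball.
  by apply: continuous_subspaceT; exact: evalM_continuous.
move=> /compact_bounded[K [_ /(_ (`|K| + 1))]].
rewrite (le_lt_trans (ler_norm _)) ?ltrDl// => /(_ isT) HK.
exists (2 * (`|K| + 1)); first by rewrite mulr_ge0// addr_ge0.
move=> x xr; apply: (le_trans (enorm_le_norm _)); rewrite ler_pM2l//.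
by apply: HK; exists x.
Qed.

Lemma net_ex z r e : 0 < e -> exists s : seq (tree z),
  [set` s] `<=` tball z r /\
  forall x, tball z r x -> exists2 w, w \in s & mdist x w <= e.
Proof. by move=> e0; apply: compact_finite_net => //; exact: compact_tball. Qed.

(** The norm on pairs being the maximum norm, the square in the definition of the properness map is
    its closed ball. *)
Definition norm_box z r : set (tree z) := [set x | `|evalM z x| <= r].
Arguments norm_box : clear implicits.

Let norm_boxE z r : [set mdist (basept z) x | x in
   [set x | (evalM z x).1 \in `[- r, r] /\ (evalM z x).2 \in `[- r, r]]] =
   mdist (basept z) @` norm_box z r.
Proof.
congr (_ @` _); apply/funext => x /=; apply/propext.
rewrite /norm_box/= prod_normE ge_max !ler_norml !in_itv/=.
by split=> [[-> ->]|/andP[]].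
Qed.

Let compact_norm_box z r : compact (norm_box z r).
Proof.
have -> : norm_box z r = evalM z @^-1` (`[- r, r] `*` `[- r, r]).
  apply/funext => x; apply/propext.
  rewrite /norm_box/= prod_normE ge_max !ler_norml.
  by rewrite !in_itv/=; split=> [/andP[]|[-> ->]].
by apply: evalM_proper; apply: compact_setX; exact: segment_compact.
Qed.

Let has_ubound_box z r : has_ubound (mdist (basept z) @` norm_box z r).
Proof.
have : compact (mdist (basept z) @` norm_box z r).
  apply: continuous_compact; last exact: compact_norm_box.
  by apply: continuous_subspaceT; exact: mdist_continuous.
move=> /compact_bounded[K [_ /(_ (`|K| + 1))]].
rewrite (le_lt_trans (ler_norm _)) ?ltrDl// => /(_ isT) HK.
by exists (`|K| + 1) => x Bx; rewrite (le_trans (ler_norm _))//; exact: HK.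
Qed.

Lemma properness_map_lt0 z r : r < 0 -> properness_map z r = 0.
Proof. by rewrite /properness_map => ->. Qed.

Lemma properness_map_ub z r x : `|evalM z x| <= r ->
  mdist (basept z) x <= properness_map z r.
Proof.
move=> xr; have r0 := le_trans (normr_ge0 _) xr.
rewrite /properness_map ltNge r0/= norm_boxE; apply: ub_le_sup => //.
Qed.

Lemma properness_map_gt z r c : 0 <= c -> c < properness_map z r ->
  exists2 x, `|evalM z x| <= r & c < mdist (basept z) x.
Proof.
move=> c0; rewrite /properness_map.
case: (ltP r 0) => r0; first by rewrite ltNge c0.
rewrite norm_boxE => cs.
have [E|/set0P ne] := eqVneq (mdist (basept z) @` norm_box z r) set0.
  by move: cs; rewrite E sup0 ltNge c0.
have [_ [x bx <-] cx] := sup_gt ne cs; by exists x.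
Qed.

Lemma properness_map_ge0 z r : 0 <= properness_map z r.
Proof.
rewrite /properness_map; case: ltP => // r0; rewrite norm_boxE.
have [->|/set0P[_ [x bx _]]] := eqVneq (mdist (basept z) @` norm_box z r) set0.
  by rewrite sup0.
apply: (le_trans (mdist_ge0 (basept z) x)); apply: ub_le_sup => //.
Qed.

Lemma properness_map_le z r c : 0 <= c ->
  (forall x, `|evalM z x| <= r -> mdist (basept z) x <= c) ->
  properness_map z r <= c.
Proof.
move=> c0 H; rewrite leNgt; apply/negP => /(properness_map_gt c0)[x /H].
by rewrite leNgt => /negbTE ->.
Qed.

Lemma properness_map_nd z : {homo properness_map z : r s / r <= s}.
Proof.
move=> r s rs; apply: properness_map_le; first exact: properness_map_ge0.
by move=> x xr; apply: properness_map_ub; exact: le_trans rs.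
Qed.

(** Right continuity comes from compactness: the points of [norm_box z (r + 1)] at distance at least
    [properness_map z r + e] from the root form a compact set, on which the norm of [M] has a
    minimum larger than [r]. An [h] below this gap works. *)
Lemma properness_map_right z r e : 0 < e ->
  exists2 h, 0 < h & properness_map z (r + h) <= properness_map z r + e.
Proof.
move=> e0; have [r0|r0] := ltP r 0.
  exists (- r / 2); first by rewrite divr_gt0// oppr_gt0.
  rewrite !properness_map_lt0// ?addr0 ?add0r ?ltW//; lra.
pose K := norm_box z (r + 1) `&`
  [set x | properness_map z r + e <= mdist (basept z) x].
have cK : compact K.
  apply: compact_closedI; first exact: compact_norm_box.
  apply: (@preimage_closed _ _ (mdist (basept z)) [set s | _ <= s]).
    by move=> x _; exact: mdist_continuous.
  exact: closed_ge.
have b0 := properness_map_ge0 z r.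
have cont : continuous (fun x => `|evalM z x|).
  move=> x; apply: (@continuous_comp _ _ _ (evalM z) (fun p => `|p|)).
    exact: evalM_continuous.
  exact: norm_continuous.
have small h : 0 < h -> h <= 1 -> (forall x, K x -> r + h < `|evalM z x|) ->
    properness_map z (r + h) <= properness_map z r + e.
  move=> h0 h1 Kh; apply: properness_map_le; first by rewrite addr_ge0// ltW.
  move=> x xh; rewrite leNgt; apply/negP => xe; have /Kh : K x.
    by split; [rewrite /norm_box/= (le_trans xh)// lerD2l|exact: ltW].
  by rewrite ltNge xh.
have [K0|/set0P Kne] := eqVneq K set0.
  by exists 1 => //; apply: small => // x; rewrite K0.
have [c cin cmin] := compact_EVT_min Kne cK (continuous_subspaceT cont).
have [cb ce] : K c by rewrite inE in cin.
have rc : r < `|evalM z c|.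
  rewrite ltNge; apply/negP => /properness_map_ub; move: ce => /=; lra.
exists (Num.min 1 ((`|evalM z c| - r) / 2)).
  by rewrite lt_min ltr01 divr_gt0// subr_gt0.
apply: small.
- by rewrite lt_min ltr01 divr_gt0// subr_gt0.
- by rewrite ge_min lexx.
move=> x Kx; have : `|evalM z c| <= `|evalM z x| by apply: cmin; rewrite inE.
have : Num.min 1 ((`|evalM z c| - r) / 2) <= (`|evalM z c| - r) / 2.
  by rewrite ge_min lexx orbT.
lra.
Qed.

Lemma properness_map_cadlag z t : cadlag t (properness_map z).
Proof.
split => [x _|x _|x _]; first exact: properness_map_ge0.
  apply/cvgrPdist_le => e e0; have [h h0 hb] := properness_map_right z x e0.
  near=> y.
  have xy : x <= y by [].
  have yh : y <= x + h by near: y; apply: nbhs_right_le; rewrite ltrDl.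
  have := properness_map_nd z yh; have := properness_map_nd z xy => b1 b2.
  by rewrite ler_norml; lra.
apply: nondecreasing_at_left_is_cvgr.
  by near=> y => a b _ _; exact: properness_map_nd.
near=> y; exists (properness_map z x) => _ [a + <-].
rewrite /= in_itv/= => /andP[_ ax]; apply: properness_map_nd; exact: ltW.
Unshelve. all: by end_near. Qed.

End spatial_tree_facts.

(** * The pseudometric Delta_sp and its topology *)

Section exp_weighted_integral.
Variable R : realType.
Local Notation mu := (@lebesgue_measure R).
Implicit Types h : R -> R.

Definition exp_integral h : \bar R :=
  (\int[mu]_(t in `[0%R, +oo[) (expR (- t) * h t)%:E)%E.

Let measurable_exp (D : set R) : measurable_fun D (fun t : R => expR (- t)).
Proof.
apply: measurable_funTS; apply: continuous_measurable_fun => t.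
apply: continuous_comp; first exact: opp_continuous.
exact: continuous_expR.
Qed.

Let mE h : measurable_fun (`[0, +oo[ : set R) h ->
  measurable_fun (`[0, +oo[ : set R) (fun t => (expR (- t) * h t)%:E).
Proof. by move=> mh; apply/measurable_EFinP; exact: measurable_funM. Qed.

Lemma exp_integral_ge0 h : (forall t, 0 <= t -> 0 <= h t) ->
  (0 <= exp_integral h)%E.
Proof.
move=> h0; apply: integral_ge0 => t /=; rewrite in_itv/= andbT => t0.
by rewrite lee_fin mulr_ge0 ?expR_ge0 ?h0.
Qed.

Lemma exp_integral_eq h h' : (forall t, 0 <= t -> h t = h' t) ->
  exp_integral h = exp_integral h'.
Proof.
move=> hh; apply: eq_integral => t; rewrite inE/= in_itv/= andbT => t0.
by rewrite hh.
Qed.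

Lemma exp_integral0 h : (forall t, 0 <= t -> h t = 0) -> exp_integral h = 0%E.
Proof.
move=> h0; apply: integral0_eq => t /=; rewrite in_itv/= andbT => t0.
by rewrite h0// mulr0.
Qed.

Lemma exp_integral_triangle h h1 h2 :
  measurable_fun (`[0, +oo[ : set R) h -> measurable_fun (`[0, +oo[ : set R) h1 ->
  measurable_fun (`[0, +oo[ : set R) h2 ->
  (forall t, 0 <= t -> 0 <= h t) -> (forall t, 0 <= t -> 0 <= h1 t) ->
  (forall t, 0 <= t -> 0 <= h2 t) -> (forall t, 0 <= t -> h t <= h1 t + h2 t) ->
  (exp_integral h <= exp_integral h1 + exp_integral h2)%E.
Proof.
move=> mh mh1 mh2 h0 h10 h20 hh; rewrite /exp_integral -ge0_integralD//=.
- apply: ge0_le_integral => //=.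
  + move=> t; rewrite in_itv/= andbT => t0.
    by rewrite lee_fin mulr_ge0 ?expR_ge0 ?h0.
  + exact: mE.
  + by apply: emeasurable_funD; exact: mE.
  + move=> t; rewrite in_itv/= andbT => t0.
    by rewrite -EFinD lee_fin -mulrDr ler_wpM2l ?expR_ge0 ?hh.
- move=> t; rewrite in_itv/= andbT => t0.
  by rewrite lee_fin mulr_ge0 ?expR_ge0 ?h10.
- exact: mE.
- move=> t; rewrite in_itv/= andbT => t0.
  by rewrite lee_fin mulr_ge0 ?expR_ge0 ?h20.
- exact: mE.
Qed.

Let integrable_exp : mu.-integrable `[0, +oo[ (fun t : R => (expR (- t))%:E).
Proof.
have I1 := @integrable_exponential_pdf R 1 ltr01.
have : mu.-integrable `[0, +oo[ (EFin \o exponential_pdf 1).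
  apply: (integrableS _ _ _ I1) => //; exact: measurable_itv.
apply: eq_integrable => [|t]; first exact: measurable_itv.
rewrite inE/= in_itv/= andbT => t0.
by rewrite /= exponential_pdfE// mul1r mulN1r.
Qed.

Lemma exp_integral_cvg0 (h : nat -> R -> R) :
  (forall n, measurable_fun (`[0, +oo[ : set R) (h n)) ->
  (forall n t, 0 <= t -> 0 <= h n t <= 1) ->
  {ae mu, forall t, 0 <= t -> h n t @[n --> \oo] --> 0} ->
  (exp_integral (h n) @[n --> \oo] --> 0)%E.
Proof.
move=> mh h01 h0.
have [|||||_ _] := @dominated_convergence _ _ R mu `[0, +oo[ (measurable_itv _)
  (fun n t => (expR (- t) * h n t)%:E) (cst 0%E) (fun t => (expR (- t))%:E).
- by move=> n; exact: mE.
- exact: measurable_cst.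
- move: h0 => [N [mN N0 sN]]; exists N; split => // t /= nt; apply: sN => /= ht.
  apply: nt; rewrite in_itv/= andbT => /ht ht0.
  apply/cvg_EFin; first by apply: nearW.
  rewrite /comp/= -[X in _ --> X](mulr0 (expR (- t))).
  exact: cvgMr.
- exact: integrable_exp.
- apply: aeW => t n /=; rewrite in_itv/= andbT => t0.
  have /andP[h1 h2] := h01 n t t0.
  by rewrite lee_fin ger0_norm ?mulr_ge0 ?expR_ge0// ler_piMr ?expR_ge0.
by rewrite /exp_integral integral0.
Qed.

(** Markov's inequality on the segment from [a] to [b], where the weight is at least
    [expR (- b)]. *)
Lemma exp_integral_lt h (a b c : R) : 0 <= a -> a < b -> 0 <= c ->
  (forall t, 0 <= t -> 0 <= h t) -> measurable_fun (`[0, +oo[ : set R) h ->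
  (exp_integral h < (expR (- b) * c * (b - a))%:E)%E ->
  exists2 t, a <= t <= b & h t < c.
Proof.
move=> a0 ab c0 h0 mh H; apply: contrapT => nh.
have ht t : a <= t -> t <= b -> c <= h t.
  move=> at_ tb; rewrite leNgt; apply/negP => hc.
  by apply: nh; exists t; rewrite ?at_.
move: H; rewrite ltNge => /negP; apply.
apply: (@le_trans _ _ (\int[mu]_(t in `[a, b]) (expR (- b) * c)%:E)%E).
  rewrite integral_cst//= lebesgue_measure_itv/= lte_fin ab -EFinB -EFinM//.
apply: (@le_trans _ _ (\int[mu]_(t in `[a, b]) (expR (- t) * h t)%:E)%E).
  apply: ge0_le_integral => //=.
  - by move=> t _; rewrite lee_fin mulr_ge0 ?expR_ge0.
  - apply: (measurable_funS _ _ (mE mh)) => //.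
    by move=> t /=; rewrite !in_itv/= andbT => /andP[/(le_trans a0)].
  - move=> t; rewrite in_itv/= => /andP[at_ tb].
    by rewrite lee_fin ler_pM ?expR_ge0 ?ler_expR ?lerN2 ?ht.
apply: ge0_subset_integral => //=.
- exact: mE.
- move=> t; rewrite in_itv/= andbT => t0.
  by rewrite lee_fin mulr_ge0 ?expR_ge0 ?h0.
- by move=> t /=; rewrite !in_itv/= andbT => /andP[/(le_trans a0)].
Qed.

(** The pointwise infimum of the integrands has integral 0, hence vanishes almost everywhere and so
    somewhere between [a] and [b]. It matters that a single [t] serves every [e]: in [M1_topology]
    the comparison of the metrics depends on [t]. *)
Lemma exp_integral_inf (h : nat -> R -> R) (a b : R) : 0 <= a -> a < b ->
  (forall n t, 0 <= t -> 0 <= h n t) ->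
  (forall n, measurable_fun (`[0, +oo[ : set R) (h n)) ->
  (forall e, 0 < e -> exists n, (exp_integral (h n) < e%:E)%E) ->
  exists2 t, a <= t <= b & forall e, 0 < e -> exists n, h n t < e.
Proof.
move=> a0 ab h0 mh H.
pose g n (t : R) := (expR (- t) * h n t)%:E.
pose m (t : R) := einfs (g^~ t) 0%N.
have g0 n t : 0 <= t -> (0 <= g n t)%E.
  by move=> t0; rewrite lee_fin mulr_ge0 ?expR_ge0 ?h0.
have m0 t : 0 <= t -> (0 <= m t)%E.
  by move=> t0; apply: le_ereal_inf_tmp => _ [k _ <-]; exact: g0.
have mm : measurable_fun (`[0, +oo[ : set R) m.
  by apply: (@measurable_fun_einfs _ _ _ _ g) => n; exact: mE.
have : (\int[mu]_(t in `[0%R, +oo[) `|m t| = 0)%E.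
  apply/eqP; rewrite eq_le integral_ge0 ?andbT//.
  apply/lee_addgt0Pr => e e0; have [n hn] := H _ e0; rewrite add0e.
  apply: le_trans (ltW hn); apply: ge0_le_integral => //=.
  - exact: measurableT_comp.
  - exact: mE.
  - move=> t; rewrite in_itv/= andbT => t0; rewrite gee0_abs ?m0//.
    by apply: ereal_inf_lbound; exists n.
move=> /ae_eq_integral_abs[//|//|N [mN N0 sN]].
have [t tab tN] : exists2 t, a <= t <= b & ~ N t.
  apply: contrapT => nt; have sub : `[a, b]%classic `<=` N.
    move=> t /=; rewrite in_itv/= => tab; apply: contrapT => tN.
    by apply: nt; exists t.
  have : (mu `[a, b]%classic <= mu N)%E by apply: le_measure; rewrite ?inE.
  rewrite /= N0 lebesgue_measure_itv/= lte_fin ab -EFinB lee_fin subr_le0.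
  by rewrite leNgt ab.
exists t => // e e0; have t0 : 0 <= t by case/andP: tab => /(le_trans a0).
have mt0 : m t = 0%E.
  apply: contrapT => mt; apply: tN; apply: sN => /= H'; apply: mt; apply: H'.
  by rewrite in_itv/= t0.
have : (m t < (expR (- t) * e)%:E)%E by rewrite mt0 lte_fin mulr_gt0 ?expR_gt0.
move=> /ereal_inf_lt[_ [n _ <-]]; rewrite lte_fin ltr_pM2l ?expR_gt0// => ht.
by exists n.
Qed.

End exp_weighted_integral.

Section Delta_sp_pseudometric.
Variables (R : realType) (alpha : R) (psi : R -> R).
Variable dM1c : R -> (R -> R) -> (R -> R) -> R.
Hypothesis halpha : 0 < alpha < 1.
Hypothesis hpsi : dyadic_cutoff psi.
Hypothesis hdM1c : M1_metric_family dM1c.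
Implicit Types (z : spatial_tree alpha) (r e : R).

Definition ball_gap z z' r : R := fine (mine 1%E (Dball psi z z' r r)).

Definition M1_gap z z' t : R :=
  Num.min 1 (dM1c t (properness_map z) (properness_map z')).

Lemma ball_gapE z z' r : (ball_gap z z' r)%:E = mine 1%E (Dball psi z z' r r).
Proof.
rewrite /ball_gap fineK// ge0_fin_numE; first by rewrite gt_min ltry.
by rewrite le_min Dball_ge0 lee01.
Qed.

Lemma ball_gap01 z z' r : 0 <= ball_gap z z' r <= 1.
Proof. by rewrite -!lee_fin ball_gapE ge_min lexx le_min Dball_ge0 lee01. Qed.

Lemma ball_gap_ge0 z z' r : 0 <= ball_gap z z' r.
Proof. by case/andP: (ball_gap01 z z' r). Qed.

Lemma ball_gap_lt z z' r e : e <= 1 -> ball_gap z z' r < e ->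
  (Dball psi z z' r r < e%:E)%E.
Proof.
move=> e1; rewrite -lte_fin ball_gapE gt_min => /orP[|//].
by rewrite lte_fin ltNge e1.
Qed.

Lemma ball_gap_le z z' r e : (Dball psi z z' r r <= e%:E)%E ->
  ball_gap z z' r <= e.
Proof. by move=> De; rewrite -lee_fin ball_gapE ge_min De orbT. Qed.

Let mine1D (x y w : \bar R) : (0 <= y)%E -> (0 <= w)%E -> (x <= y + w)%E ->
  (mine 1%E x <= mine 1%E y + mine 1%E w)%E.
Proof.
move=> y0 w0 xyw; have [y1|y1] := leP 1%E y.
  by rewrite ge_min leeDl ?le_min ?lee01// w0.
have [w1|w1] := leP 1%E w; first by rewrite ge_min leeDr.
by rewrite ge_min xyw orbT.
Qed.

Lemma ball_gap_triangle z1 z2 z3 r :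
  ball_gap z1 z3 r <= ball_gap z1 z2 r + ball_gap z2 z3 r.
Proof.
rewrite -lee_fin EFinD !ball_gapE; apply: mine1D; rewrite ?Dball_ge0//.
exact: Dball_triangle.
Qed.

(** The gap is even continuous on the half-line: passing from one radius to another costs a change
    of radius in each of the two trees, which [Dball_radius] controls. *)
Lemma measurable_ball_gap z z' : measurable_fun (`[0, +oo[ : set R) (ball_gap z z').
Proof.
apply: subspace_continuous_measurable_fun => //.
apply/subspace_continuousP => r /=; rewrite in_itv/= andbT => r0.
apply/cvgrPdist_le => e e0.
(* Two changes of radius, each costing [10 * (e / 20)]. *)
have e1 : 0 < e / 20 by rewrite divr_gt0.
have [K1 K10 bd1] := evalM_bound_ex halpha z (r + 1).
have [K2 K20 bd2] := evalM_bound_ex halpha z' (r + 1).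
have [d1 d10 md1] := evalM_modulus_ex z (r + 1) e1.
have [d2 d20 md2] := evalM_modulus_ex z' (r + 1) e1.
have [h1 h10 H1] := Dball_radius halpha hpsi e1 d10 K10.
have [h2 h20 H2] := Dball_radius halpha hpsi e1 d20 K20.
have main a b : 0 <= a -> a <= r + 1 -> 0 <= b -> b <= r + 1 ->
    `|a - b| <= h1 -> `|a - b| <= h2 -> ball_gap z z' a <= ball_gap z z' b + e.
  move=> a0 ar b0 br ab1 ab2; rewrite -lee_fin EFinD !ball_gapE.
  have le1 : (Dball psi z z a b <= (10 * (e / 20))%:E)%E.
    by apply: H1 bd1 md1 _ _ ab1; rewrite ?a0 ?b0.
  have le2 : (Dball psi z' z' b a <= (10 * (e / 20))%:E)%E.
    by apply: H2 bd2 md2 _ _ _; rewrite ?a0 ?b0// distrC.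
  apply: (@le_trans _ _ (mine 1%E (Dball psi z z' b b) + mine 1%E e%:E)%E).
    apply: mine1D; rewrite ?Dball_ge0 ?lee_fin ?(ltW e0)//.
    apply: (le_trans (Dball_triangle psi _ z _ _ b _)).
    apply: (le_trans (leeD le1 (Dball_triangle psi _ z' _ _ b _))).
    apply: (le_trans (leeD (lexx _) (leeD (lexx _) le2))).
    rewrite addeCA leeD2l// -EFinD lee_fin; lra.
  by rewrite leeD2l// ge_min lexx orbT.
rewrite near_withinE.
exists (Num.min 1 (Num.min h1 h2)); first by rewrite /= !lt_min ltr01 h10.
move=> s /=; rewrite !lt_min in_itv/= andbT => /andP[rs1 /andP[rs2 rs3]] s0.
have sr : s <= r + 1.
  by have := ler_norm (s - r); rewrite distrC; lra.
have r1 : r <= r + 1 by rewrite lerDl.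
have := main r s r0 r1 s0 sr (ltW rs2) (ltW rs3).
have := main s r s0 sr r0 r1; rewrite (distrC s) => /(_ (ltW rs2) (ltW rs3)).
by rewrite ler_norml; lra.
Qed.

Let cad z t : cadlag t (properness_map z).
Proof. exact: properness_map_cadlag. Qed.

Lemma M1_gap_ge0 z z' t : 0 <= t -> 0 <= M1_gap z z' t.
Proof. by move=> t0; rewrite le_min ler01/= (M1_ge0 hdM1c t0). Qed.

Lemma M1_gap_le1 z z' t : M1_gap z z' t <= 1.
Proof. by rewrite ge_min lexx. Qed.

Lemma M1_gap_triangle z1 z2 z3 t : 0 <= t ->
  M1_gap z1 z3 t <= M1_gap z1 z2 t + M1_gap z2 z3 t.
Proof.
move=> t0; have := mine1D.
move=> /(_ (dM1c t (properness_map z1) (properness_map z3))%:E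
  (dM1c t (properness_map z1) (properness_map z2))%:E
  (dM1c t (properness_map z2) (properness_map z3))%:E).
rewrite -!EFin_min -!EFinD !lee_fin; apply; rewrite ?(M1_ge0 hdM1c t0)//.
exact: (M1_triangle hdM1c t0).
Qed.

Lemma measurable_M1_gap z z' : measurable_fun (`[0, +oo[ : set R) (M1_gap z z').
Proof.
apply: measurable_minr; first exact: measurable_cst.
by apply: (M1_measurable hdM1c).
Qed.

Lemma Delta_spE z z' : Delta_sp psi dM1c z z' =
  (exp_integral (ball_gap z z') + exp_integral (M1_gap z z'))%E.
Proof.
rewrite /Delta_sp; congr (_ + _)%E; apply: eq_integral => r _.
by rewrite EFinM ball_gapE.
Qed.

Lemma Delta_sp_triangle z1 z2 z3 : (Delta_sp psi dM1c z1 z3 <=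
  Delta_sp psi dM1c z1 z2 + Delta_sp psi dM1c z2 z3)%E.
Proof.
rewrite !Delta_spE [leRHS]addeACA; apply: leeD; apply: exp_integral_triangle;
  try (by move=> t _; exact: ball_gap_ge0);
  try exact: M1_gap_ge0; try exact: measurable_ball_gap;
  try exact: measurable_M1_gap.
  by move=> t _; exact: ball_gap_triangle.
exact: M1_gap_triangle.
Qed.

Lemma Delta_sp_sym z z' : Delta_sp psi dM1c z z' = Delta_sp psi dM1c z' z.
Proof.
rewrite !Delta_spE; congr (_ + _)%E; apply: exp_integral_eq => t t0.
  by rewrite /ball_gap Dball_sym.
by rewrite /M1_gap (M1_sym hdM1c t0).
Qed.

Lemma tree_equiv_properness_map z z' : tree_equiv z z' ->
  properness_map z = properness_map z'.
Proof.
have main w w' r : tree_equiv w w' -> properness_map w r <= properness_map w' r.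
  move=> [f [bf fd fr fM]]; apply: properness_map_le.
    exact: properness_map_ge0.
  by move=> x xr; rewrite -fd fr; apply: properness_map_ub; rewrite -fM in xr.
move=> eqv; apply/funext => r; apply/eqP; rewrite eq_le main//=.
exact/main/tree_equiv_imp.
Qed.

Lemma tree_equiv_Delta_sp z z' : tree_equiv z z' ->
  Delta_sp psi dM1c z z' = 0%E.
Proof.
move=> eqv; rewrite Delta_spE !exp_integral0 ?adde0// => t t0.
  rewrite /M1_gap (tree_equiv_properness_map eqv).
  by rewrite (proj2 (M1_eq0 hdM1c t0 _ _))// ?min_r//; exact: cad.
by rewrite /ball_gap tree_equiv_Dball0// min_r.
Qed.

Local Notation X := (T_sp alpha psi dM1c).
Local Notation pi_sp z := (\pi_X%qT z).

Lemma tree_equiv_repr z : tree_equiv (repr (pi_sp z)) z.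
Proof.
apply/asboolP; have := @pi_eq_quot _ _ X (repr (pi_sp z)) z.
by rewrite reprK eqxx => /esym.
Qed.

(** Equivalent trees are at distance 0, so the triangle inequality frees [sp_ball] from the
    representatives chosen by [repr]. *)
Lemma sp_ballE z z' e : sp_ball (pi_sp z) e (pi_sp z') <->
  (Delta_sp psi dM1c z z' < e%:E)%E.
Proof.
rewrite /sp_ball/=.
have E1 := tree_equiv_Delta_sp (tree_equiv_repr z).
have E2 := tree_equiv_Delta_sp (tree_equiv_repr z').
have H1 := Delta_sp_triangle (repr (pi_sp z)) z (repr (pi_sp z')).
have H2 := Delta_sp_triangle z z' (repr (pi_sp z')).
have H3 := Delta_sp_triangle z (repr (pi_sp z)) z'.
have H4 := Delta_sp_triangle (repr (pi_sp z)) (repr (pi_sp z')) z'.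
rewrite E2 adde0 in H4; rewrite [X in (X + _)%E]Delta_sp_sym E1 add0e in H3.
rewrite E1 add0e in H1; rewrite [X in (_ + X)%E]Delta_sp_sym E2 adde0 in H2.
by split; apply: le_lt_trans; [exact: le_trans H4|exact: le_trans H2].
Qed.

Lemma pi_sp_surj (x : X) : exists z, x = pi_sp z.
Proof. by exists (repr x); rewrite reprK. Qed.

(** The topology is given by its open sets, so balls must be shown to be neighbourhoods: the points
    having a ball inside [U] form an open set, by halving radii. *)
Lemma nbhs_spP z (U : set X) : nbhs (pi_sp z) U <->
  exists2 e, 0 < e & sp_ball (pi_sp z) e `<=` U.
Proof.
rewrite nbhsE; split.
  move=> [V [oV Vz] VU]; have [e e0 eV] := oV _ Vz.
  by exists e => //; exact: subset_trans VU.
move=> [e e0 eU].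
pose V : set X := [set y | exists2 e', 0 < e' & sp_ball y e' `<=` U].
exists V.
  split; last by exists e.
  move=> y [e' e'0 yU]; exists (e' / 2); first by rewrite divr_gt0.
  move=> w; have [y' Ey] := pi_sp_surj y; have [w' Ew] := pi_sp_surj w.
  rewrite Ey Ew => /sp_ballE yw; exists (e' / 2); first by rewrite divr_gt0.
  move=> v; have [v' Ev] := pi_sp_surj v; rewrite Ev => /sp_ballE wv.
  apply: yU; rewrite Ey; apply/sp_ballE.
  apply: (le_lt_trans (Delta_sp_triangle _ w' _)).
  by rewrite [e']splitr EFinD lteD.
move=> y [e' e'0]; apply; have [y' ->] := pi_sp_surj y; apply/sp_ballE.
by rewrite tree_equiv_Delta_sp ?lte_fin//; apply/asboolP; exact: tree_equiv_refl.
Qed.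

End Delta_sp_pseudometric.

(** * Compactness criterion and local uniformity *)

Lemma ultra_finite_cover (T : Type) (F : set_system T) n (P : nat -> set T) :
  UltraFilter F -> F [set x | exists2 i, (i < n)%N & P i x] ->
  exists2 i, (i < n)%N & F (P i).
Proof.
move=> UF; elim: n => [|n IHn] H.
  by have [x [i]] := filter_ex H.
have [Pn|nPn] := in_ultra_setVsetC (P n) UF; first by exists n.
have /IHn[i lti Pi] : F [set x | exists2 i, (i < n)%N & P i x].
  apply: filterS (filterI H nPn) => x [[i]]; rewrite ltnS leq_eqVlt.
  by move=> /predU1P[-> //|lti] Pi _; exists i.
by exists i => //; rewrite ltnS ltnW.
Qed.

Lemma natSinv_lt (R : realType) (e : R) : 0 < e ->
  exists n, forall m, (n <= m)%N -> m.+1%:R^-1 < e.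
Proof.
move=> e0; have [n _ H] := near_infty_natSinv_lt (PosNum e0).
by exists n => m nm; exact: H.
Qed.

Lemma left_value_le (R : realType) (f : R -> R) (t x : R) :
  {homo f : a b / a <= b} -> cadlag t f -> -1 <= x <= t ->
  left_value f x <= f x.
Proof.
move=> nd [_ _ fl] /andP[x1 xt]; rewrite /left_value.
case: (leP x (-1)) => [x1'|x1'].
  exact: nd.
apply: limr_le; first by apply: fl; rewrite x1'.
near=> y; apply: nd; near: y; exact: nbhs_left_le.
Unshelve. all: by end_near. Qed.

Section relative_compactness.
Variables (R : realType) (alpha : R) (psi : R -> R).
Variable dM1c : R -> (R -> R) -> (R -> R) -> R.
Hypothesis halpha : 0 < alpha < 1.
Hypothesis hpsi : dyadic_cutoff psi.
Hypothesis hdM1c : M1_metric_family dM1c.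
Implicit Types (z : spatial_tree alpha) (r e : R).

Local Notation X := (T_sp alpha psi dM1c).
Local Notation pi_sp z := (\pi_X%qT z).
Local Notation Delta := (Delta_sp psi dM1c).

Let triangle := Delta_sp_triangle halpha hpsi hdM1c.
Let sym := Delta_sp_sym psi halpha hdM1c.
Let ballE := sp_ballE halpha hpsi hdM1c.
Let nbhsP := nbhs_spP halpha hpsi hdM1c.

(** Otherwise a greedy choice produces a sequence whose terms are pairwise at distance at least [e],
    and no tree is within [e / 2] of two of them. The list [s_ n] records the first [n] choices. *)
Lemma sp_totally_bounded (I : Type) (zeta : I -> spatial_tree alpha) (i0 : I) :
  (forall u : nat -> I, exists z, forall e, 0 < e -> forall N, exists2 n,
     (N <= n)%N & (Delta (zeta (u n)) z < e%:E)%E) ->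
  forall e, 0 < e -> exists s : seq I, forall a, exists2 i, (i < size s)%N &
    (Delta (zeta a) (zeta (nth i0 s i)) < e%:E)%E.
Proof.
move=> clus e e0; apply: contrapT => /forallNP nb.
have /choice[F FP] : forall s : seq I, exists a, forall i, (i < size s)%N ->
    (e%:E <= Delta (zeta a) (zeta (nth i0 s i)))%E.
  move=> s; have /existsNP[a Ha] := nb s; exists a => i si.
  by rewrite leNgt; apply/negP => H; apply: Ha; exists i.
pose s_ n := iter n (fun s => rcons s (F s)) [::].
have sizes n : size (s_ n) = n by elim: n => //= n IHn; rewrite size_rcons IHn.
pose u n := F (s_ n).
have nths n i : (i < n)%N -> nth i0 (s_ n) i = u i.
  elim: n => //= n IHn; rewrite ltnS leq_eqVlt => /predU1P[->|lti].
    by rewrite nth_rcons sizes ltnn eqxx.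
  by rewrite nth_rcons sizes lti IHn.
have e2 : 0 < e / 2 by rewrite divr_gt0.
have [z Hz] := clus u; have [n _ nz] := Hz _ e2 0%N.
have [m nm mz] := Hz _ e2 n.+1.
have := FP (s_ m) n; rewrite sizes nm nths// => /(_ isT).
rewrite leNgt => /negP; apply.
apply: (le_lt_trans (triangle _ z _)); rewrite [e]splitr EFinD.
by apply: lteD => //; rewrite (sym z).
Qed.

(** By total boundedness an ultrafilter on the closure contains small balls centred at members
    [zeta (u k)] of the family. A cluster tree of this sequence of centres is then a limit of the
    ultrafilter. *)
Lemma compact_closure_sp (I : Type) (zeta : I -> spatial_tree alpha) :
  (forall u : nat -> I, exists z, forall e, 0 < e -> forall N, exists2 n,
     (N <= n)%N & (Delta (zeta (u n)) z < e%:E)%E) ->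
  compact (closure [set pi_sp (zeta a) | a in [set: I]]).
Proof.
move=> clus; set S := [set _ | _ in _].
have [i0|nI] := pselect (inhabited I); last first.
  rewrite (_ : S = set0) ?closure0; first exact: compact0.
  by apply/seteqP; split => // x [a _ _]; apply: nI; split.
case: i0 => i0; rewrite compact_ultra => F UF FS.
have tb := sp_totally_bounded i0 clus.
(* One [k.+1%:R^-1] leads from a point of the closure to a member of the family, a second one from
   there to the finite net. *)
have /choice[u uP] : forall k : nat, exists a,
    F (sp_ball (pi_sp (zeta a)) (2 * k.+1%:R^-1)).
  move=> k; have k0 : 0 < k.+1%:R^-1 :> R by rewrite invr_gt0.
  have [s sP] := tb _ k0.
  have [|i _ Fi] := @ultra_finite_cover _ F (size s)
      (fun i => sp_ball (pi_sp (zeta (nth i0 s i))) (2 * k.+1%:R^-1)).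
  - apply: filterS FS => x; have [z ->] := pi_sp_surj x => clz.
    have /clz[_ [[a _ <-] /ballE za]] :
        nbhs (pi_sp z) (sp_ball (pi_sp z) k.+1%:R^-1).
      by apply/nbhsP; exists k.+1%:R^-1.
    have [i si ai] := sP a; exists i => //; apply/ballE.
    apply: (le_lt_trans (triangle _ (zeta a) _)).
    rewrite mulrDl mul1r EFinD; apply: lteD.
      by rewrite (sym (zeta (nth i0 s i)) (zeta a)).
    by rewrite (sym (zeta a) z).
  - by exists (nth i0 s i).
have [z Hz] := clus u; exists (pi_sp z); split.
  move=> U /nbhsP[e e0 eU]; have [n _ nz] := Hz _ e0 0%N.
  by exists (pi_sp (zeta (u n))); split; [exists (u n)|apply/eU/ballE; rewrite sym].
move=> U /nbhsP[e e0 eU].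
have e4 : 0 < e / 4 by rewrite divr_gt0.
have e2 : 0 < e / 2 by rewrite divr_gt0.
have [N HN] := natSinv_lt e4; have [n Nn nz] := Hz _ e2 N.
apply: filterS (uP n) => x xn; apply: eU; move: xn.
have [w ->] := pi_sp_surj x; move=> /ballE xn; apply/ballE.
apply: (le_lt_trans (triangle _ (zeta (u n)) _)).
rewrite [e]splitr EFinD; apply: lteD; first by rewrite (sym z).
apply: (lt_trans xn); rewrite lte_fin; have := HN n Nn.
by move: (n.+1%:R^-1) => q; lra.
Qed.

(** The common form of the necessary conditions: [k] measures the size of the bound, and
    monotonicity in [k] lets the largest of finitely many local bounds prevail. *)
Lemma compact_closure_level (I : Type) (zeta : I -> spatial_tree alpha)
    (P : nat -> spatial_tree alpha -> Prop) :
  compact (closure [set pi_sp (zeta a) | a in [set: I]]) ->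
  (forall k k' z, (k <= k')%N -> P k z -> P k' z) ->
  (forall z, exists k, exists2 e, 0 < e & forall z',
     (Delta z z' < e%:E)%E -> P k z') ->
  exists k, forall a, P k (zeta a).
Proof.
move=> cS Pmono Ploc.
have /choice[k_ kP] : forall x : X, exists k, exists2 e, 0 < e & forall z',
    (Delta (repr x) z' < e%:E)%E -> P k z' by move=> x; exact: Ploc.
have /choice[e_ eP] : forall x : X, exists e, 0 < e /\ forall z',
    (Delta (repr x) z' < e%:E)%E -> P (k_ x) z'.
  by move=> x; have [e e0 H] := kP x; exists e.
have [|s [_ cov]] := compact_nbhs_cover (V := fun x => sp_ball x (e_ x)) cS.
  move=> x _; rewrite -{1}(reprK x); apply/nbhsP; rewrite reprK.
  by exists (e_ x) => //; case: (eP x).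
exists (\max_(x <- s) k_ x)%N => a.
have [|w ws wa] := cov (pi_sp (zeta a)); first by apply: subset_closure; exists a.
apply: (Pmono (k_ w)); first by apply: leq_bigmax_seq.
apply: (eP w).2; rewrite -[w in sp_ball w]reprK in wa.
exact: (ballE (repr w) (zeta a) (e_ w)).1 wa.
Qed.

(** Only an average over radii is controlled, so the good radius is merely known to lie between [r]
    and [r + 1]. The condition [e <= 1] undoes the truncation of the integrand at 1. *)
Lemma Delta_sp_corr r e : 0 <= r -> 0 < e -> e <= 1 ->
  exists2 eta, 0 < eta & forall z z', (Delta z z' < eta%:E)%E ->
  exists2 r', r <= r' <= r + 1 & exists C : set (tree z * tree z'),
    correspondence (tball z r') (tball z' r') C /\ (DeltaC psi C < e%:E)%E.
Proof.
move=> r0 e0 e1; exists (expR (- (r + 1)) * e * (r + 1 - r)).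
  by rewrite addrAC subrr add0r mulr1 mulr_gt0 ?expR_gt0.
move=> z z'; rewrite Delta_spE => D.
have [|||||t trr te] := @exp_integral_lt _ (ball_gap psi z z') r (r + 1) e r0.
- by rewrite ltrDl.
- exact: ltW.
- by move=> t _; exact: ball_gap_ge0.
- exact: measurable_ball_gap.
- apply: le_lt_trans D; rewrite leeDl// exp_integral_ge0// => t t0.
  exact: M1_gap_ge0.
exists t => //; have /ereal_inf_lt[_ [C [C1 _] <-] Ce] := ball_gap_lt e1 te.
by exists C.
Qed.

Lemma net_number_local z r eps : 0 <= r -> 0 < eps -> exists k : nat,
  exists2 e, 0 < e & forall z', (Delta z z' < e%:E)%E ->
  (net_number (tball z' r) eps <= k%:R%:E)%E.
Proof.
move=> r0 eps0.
have eps8 : 0 < eps / 8 by rewrite divr_gt0.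
have e0 : 0 < Num.min 1 (eps / 8) by rewrite lt_min ltr01.
have e1 : Num.min 1 (eps / 8) <= 1 by rewrite ge_min lexx.
have e8 : Num.min 1 (eps / 8) <= eps / 8 by rewrite ge_min lexx orbT.
have [s [_ cov]] := net_ex z (r + 1) eps8.
have [eta eta0 H] := Delta_sp_corr r0 e0 e1.
exists (size s); exists eta => // z' /H[r' /andP[rr' rr1]].
move=> [C [/correspondenceP[C1 _ C3] CD]].
have dis x y x' y' : C (x, y) -> C (x', y') ->
    `|mdist x x' - mdist y y'| <= eps / 4.
  move=> Cxy Cxy'; have := le_lt_trans (DeltaC_dist psi Cxy Cxy') CD.
  by rewrite lte_fin /=; lra.
(* The net is transported through the correspondence: [g w] corresponds to some point near [w],
   whenever there is such a point. *)
pose Q w y := exists2 x, C (x, y) & mdist x w <= eps / 8.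
pose g w := xget (basept z') (Q w).
have gQ w y : Q w y -> Q w (g w).
  by move=> h; exact: (xgetPex (basept z') (ex_intro _ _ h)).
(* The points [g w] may lie outside the ball of radius [r], hence the doubled mesh of
   [net_number_sub]. *)
have -> : eps = 2 * (eps / 2) by lra.
rewrite -(size_map g); apply: net_number_sub => y yr.
have [x Cxy] := C3 _ (tball_subset rr' yr).
have [xr _] := C1 _ _ Cxy.
have [w ws xw] := cov x (tball_subset rr1 xr).
have [x' Cx' x'w] := gQ w y (ex_intro2 _ _ x Cxy xw).
exists (g w); first exact: map_f.
have := dis _ _ _ _ Cxy Cx'; have := metric_triangle x w x'.
by rewrite (metric_sym w x') ler_norml; lra.
Qed.

Lemma evalM_bound_local z r : 0 <= r -> exists k : nat,
  exists2 e, 0 < e & forall z', (Delta z z' < e%:E)%E -> evalM_bound z' r k%:R.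
Proof.
move=> r0; have [K K0 bd] := evalM_bound_ex halpha z (r + 1).
have [eta eta0 H] := Delta_sp_corr r0 ltr01 (lexx _).
exists (Num.truncn (K + 1)).+1; exists eta => // z' /H[r' /andP[rr' rr1]].
move=> [C [/correspondenceP[C1 _ C3] CD]] y yr.
have [x Cxy] := C3 _ (tball_subset rr' yr).
have [xr _] := C1 _ _ Cxy.
have := le_lt_trans (DeltaC_evalM psi Cxy) CD; rewrite lte_fin /= => xy.
have := bd x (tball_subset rr1 xr).
have := truncnS_gt (K + 1).
have := enormD (evalM z x) (evalM z' y - evalM z x).
rewrite (enorm_distC (evalM z' y)) addrCA subrr addr0; lra.
Qed.

(** At such a scale the cutoff equals 1, so that the scaled increment is the increment itself; the
    smallest [n] reaching 1 does not overshoot 2. *)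
Lemma dyadic_scale (d : R) : 0 < d -> d <= 1 ->
  exists n, 1 <= 2 ^+ n * d <= 2.
Proof.
move=> d0 d1; have ex : exists n, 1 <= 2 ^+ n * d.
  exists (Num.truncn d^-1).+1; rewrite -ler_pdivrMr// mul1r.
  apply: (le_trans (ltW (truncnS_gt _))).
  by rewrite -natrX ler_nat ltnW// ltn_expl.
case: (ex_minnP ex) => n n1 nmin; exists n; rewrite n1/=.
case: n n1 nmin => [|n] n1 nmin; first by rewrite expr0 mul1r; lra.
rewrite leNgt; apply/negP => n2; have : 1 <= 2 ^+ n * d.
  by move: n2; rewrite exprS; lra.
by move=> /nmin; rewrite ltnn.
Qed.

(** At the dyadic scale of [mdist y y'] the Hoelder term of [DeltaC] compares the increment in [z']
    with one in [z], which the modulus of [z] makes small. *)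
Lemma evalM_modulus_local z r eps : 0 <= r -> 0 < eps -> exists k : nat,
  exists2 e, 0 < e & forall z', (Delta z z' < e%:E)%E ->
  evalM_modulus z' r k.+1%:R^-1 eps.
Proof.
move=> r0 eps0.
have eps8 : 0 < eps / 8 by rewrite divr_gt0.
have e0 : 0 < Num.min 1 (eps / 8) by rewrite lt_min ltr01.
have e1 : Num.min 1 (eps / 8) <= 1 by rewrite ge_min lexx.
have e8 : Num.min 1 (eps / 8) <= eps / 8 by rewrite ge_min lexx orbT.
have [d d0 md] := evalM_modulus_ex z (r + 1) eps8.
have [eta eta0 H] := Delta_sp_corr r0 e0 e1.
(* A distance below 1 has a dyadic scale [n]; a distance below [d / 4] forces [4 / 2 ^+ n] into the
   range of the modulus of [z]. *)
have d4 : 0 < Num.min 1 (d / 4) by rewrite lt_min ltr01 divr_gt0.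
have [k kd] := natSinv_lt d4; have {}kd := kd k (leqnn _).
exists k; exists eta => // z' /H[r' /andP[rr' rr1]].
move=> [C [/correspondenceP[C1 _ C3] CD]] y y' yr yr' yy'.
have [yy0|yy0] := eqVneq (mdist y y') 0.
  by rewrite (mdist_positivity _ _ yy0) subrr enorm0 mulr_ge0 ?powR_ge0// ltW.
have {}yy0 : 0 < mdist y y' by rewrite lt_def yy0 mdist_ge0.
have := le_lt_trans yy' kd; rewrite lt_min => /andP[yy1 yyd].
have [n /andP[n1 n2]] := dyadic_scale yy0 (ltW yy1).
have [x Cxy] := C3 _ (tball_subset rr' yr).
have [x' Cxy'] := C3 _ (tball_subset rr' yr').
have [xr _] := C1 _ _ Cxy; have [xr' _] := C1 _ _ Cxy'.
have nd : 4 / 2 ^+ n <= d.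
  by rewrite ler_pdivrMr ?exprn_gt0// mulrC; nra.
have := scaled_incr_small halpha hpsi (ltW eps8) md (tball_subset rr1 xr)
  (tball_subset rr1 xr') nd.
have := le_lt_trans (DeltaC_holder psi n Cxy Cxy') CD; rewrite lte_fin /=.
set a := scaled_incr _ (evalM z) _ _ _; set b := scaled_incr _ _ _ _ _ => h1 h2.
have bE : b = evalM z' y - evalM z' y'.
  rewrite /b /scaled_incr; case: hpsi => _ _ psi1 _.
  by rewrite psi1 ?scale1r// in_itv/= n1.
have h3 : 2 `^ (n%:R * alpha) * enorm b <= eps.
  have : enorm b <= enorm (a - b) + enorm a.
    have := enormB_le a (a - b); rewrite opprB addrCA subrr addr0; lra.
  have := powR_ge0 2 (n%:R * alpha); nra.
(* This converts the bound on the weighted increment into a Hoelder bound. *)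
have Sd : 1 <= 2 `^ (n%:R * alpha) * mdist y y' `^ alpha.
  rewrite powR_exprn// -powRM ?exprn_ge0 ?mdist_ge0//.
  apply: (@le_trans _ _ (1 `^ alpha)); first by rewrite powR1.
  apply: ge0_ler_powR => //; first by case/andP: halpha => /ltW.
    by rewrite nnegrE.
  by rewrite nnegrE (le_trans _ n1).
rewrite -bE; apply: (le_trans (ler_peMr (enorm_ge0 b) Sd)).
by rewrite mulrA ler_wpM2r ?powR_ge0// mulrC.
Qed.

(** Times need not be compared: whichever point of the completed graph of [f] is matched with
    [(g r, r)], monotonicity bounds its space coordinate by [f t]. *)
Lemma M1_dist_lt1 t r (f g : R -> R) :
  {homo f : a b / a <= b} -> cadlag t f -> -1 <= r <= t ->
  (M1_dist t f g < 1%:E)%E -> g r <= f t + 1.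
Proof.
move=> nd cf rt /ereal_inf_lt[_ [uf [rf [ug [rg [[_ _ gf _] [_ _ gg _] ->]]]]]].
rewrite gt_max => /andP[+ _].
have : completed_graph t g (g r, r).
  by split => //=; rewrite ge_min le_max lexx !orbT.
rewrite -gg => -[s s01 [ugs _]] H.
have : completed_graph t f (uf s, rf s) by rewrite -gf; exists s.
move=> [/= rft /andP[_ ufs]].
have : uf s <= f t.
  apply: (le_trans ufs); rewrite ge_max (le_trans (left_value_le nd cf rft)).
    by apply: nd; case/andP: rft.
  by apply: nd; case/andP: rft.
have : (`|uf s - ug s|%:E < 1%:E)%E.
  by apply: le_lt_trans H; apply: nnsup_ubound; exists s.
rewrite lte_fin ugs ltr_norml; lra.
Qed.

(** By contradiction, because [t] must be fixed before a tree near [z] is selected: the threshold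
    given by [M1_topology] depends on [t], while a single small integral would give a [t] depending
    on the tree. *)
Lemma properness_map_local z r : 0 <= r -> exists k : nat,
  exists2 e, 0 < e & forall z', (Delta z z' < e%:E)%E ->
  properness_map z' r <= k%:R.
Proof.
move=> r0; pose k := (Num.truncn (properness_map z (r + 1) + 1)).+1.
have kP : properness_map z (r + 1) + 1 < k%:R by exact: truncnS_gt.
exists k; apply: contrapT => nloc.
have /choice[w wP] : forall n, exists z',
    (Delta z z' < n.+1%:R^-1%:E)%E /\ k%:R < properness_map z' r.
  move=> n; apply: contrapT => nw; apply: nloc; exists n.+1%:R^-1.
    by rewrite invr_gt0.
  move=> z' zz'; rewrite leNgt; apply/negP => kz'; apply: nw; by exists z'.
have [||||t trr ht] := @exp_integral_inf _ (fun n => M1_gap dM1c z (w n))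
  r (r + 1) r0.
- by rewrite ltrDl.
- by move=> n t; exact: M1_gap_ge0.
- by move=> n; exact: measurable_M1_gap.
- move=> e e0; have [n nP] := natSinv_lt e0; exists n.
  have [wn _] := wP n; rewrite Delta_spE in wn.
  apply: (@le_lt_trans _ _ n.+1%:R^-1%:E); last by rewrite lte_fin nP.
  apply: le_trans (ltW wn); rewrite leeDr// exp_integral_ge0// => t _.
  exact: ball_gap_ge0.
have t0 : 0 <= t by case/andP: trr => /(le_trans r0).
have cad z1 : cadlag t (properness_map z1) by exact: properness_map_cadlag.
have [_ [eta eta0 H]] := M1_topology hdM1c t0 (cad z) ltr01.
have e0 : 0 < Num.min 1 eta by rewrite lt_min ltr01.
have [n] := ht _ e0; rewrite /M1_gap lt_min !gt_min ltxx/= => /andP[d1 d2'].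
have {d2'}d2 : dM1c t (properness_map z) (properness_map (w n)) < eta.
  by case/orP: d2' => // /(lt_trans d1).
have rt : -1 <= r <= t by case/andP: trr => -> _; rewrite (le_trans _ r0)//; lra.
have := M1_dist_lt1 (@properness_map_nd _ _ z) (cad z) rt (H _ (cad _) d2).
have := (wP n).2.
have := properness_map_nd z (andP trr).2.
by move: kP; lra.
Qed.

End relative_compactness.

(** * M1 distance of monotone functions *)

Section monotone_parametrization.
Variables (R : realType) (t : R).
Hypothesis t_ge0 : 0 <= t.
Implicit Types f g : R -> R.

Let m1t : -1 <= t.
Proof. by apply: le_trans t_ge0; rewrite lerN10. Qed.

(* Inverse of the strictly increasing function x + f x: a point of the
   completed graph is determined by the sum of its coordinates. *)
Definition graph_time f y := sup [set x | -1 <= x <= t /\ x + f x <= y].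

Let has_sup_time f y : f (-1) = 0 -> -1 <= y ->
  has_sup [set x | -1 <= x <= t /\ x + f x <= y].
Proof.
move=> f0 y1; split; last by exists t => x [/andP[]].
by exists (-1); rewrite /= lexx m1t f0 addr0.
Qed.

Lemma graph_time_ub f y x : f (-1) = 0 -> -1 <= y -> -1 <= x <= t ->
  x + f x <= y -> x <= graph_time f y.
Proof. by move=> f0 y1 xt xy; apply: sup_upper_bound; [exact: has_sup_time|]. Qed.

Lemma graph_time_le f y c : f (-1) = 0 -> -1 <= y ->
  (forall x, -1 <= x <= t -> x + f x <= y -> x <= c) -> graph_time f y <= c.
Proof.
move=> f0 y1 H; apply: ge_sup; first exact: (has_sup_time f0 y1).1.
by move=> x [? ?]; exact: H.
Qed.

Lemma graph_time_itv f y : f (-1) = 0 -> -1 <= y -> -1 <= graph_time f y <= t.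
Proof.
move=> f0 y1; rewrite graph_time_ub//= ?lexx ?m1t ?f0 ?addr0//.
by apply: graph_time_le => // x /andP[].
Qed.

Lemma graph_time_nd f y y' : f (-1) = 0 -> -1 <= y -> y <= y' ->
  graph_time f y <= graph_time f y'.
Proof.
move=> f0 y1 yy; apply: graph_time_le => // x xt xy.
by apply: graph_time_ub => //; [exact: le_trans yy|exact: le_trans yy].
Qed.

(** A step back in time offsets the vertical error of the Levy bound, so the sum of the coordinates
    stays below [y] when passing from [f] to [g]. *)
Lemma graph_time_shift f g y e : {homo f : a b / a <= b} -> f (-1) = 0 ->
  g (-1) = 0 -> 0 <= e -> -1 <= y ->
  (forall x, -1 <= x - e -> x <= t -> g (x - e) <= f x + e) ->
  graph_time f y <= graph_time g y + 2 * e.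
Proof.
move=> nd f0 g0 e0 y1 H; apply: graph_time_le => // x /andP[x1 xt] xy.
have /andP[g1 _] := graph_time_itv g0 y1.
have [x2|x2] := ltP (x - 2 * e) (-1); first lra.
rewrite -lerBlDr; apply: graph_time_ub => //; first by rewrite x2/=; lra.
have := H (x - e); rewrite (_ : x - e - e = x - 2 * e); last by ring.
move=> /(_ x2); have xe : x - e <= x by rewrite gerBl.
move=> /(_ (le_trans xe xt)); have := nd _ _ xe; lra.
Qed.

(** For nondecreasing [f] the function [x + f x] grows at least as fast as [x], hence its inverse is
    1-Lipschitz. *)
Lemma graph_time_lip f y y' : {homo f : a b / a <= b} -> f (-1) = 0 ->
  -1 <= y -> y <= y' -> graph_time f y' <= graph_time f y + (y' - y).
Proof.
move=> nd f0 y1 yy; apply: graph_time_le => //; first exact: le_trans yy.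
move=> x /andP[x1 xt] xy; have /andP[g1 _] := graph_time_itv f0 y1.
have [x2|x2] := ltP (x - (y' - y)) (-1); first lra.
rewrite -lerBlDr; apply: graph_time_ub => //; first by rewrite x2/=; lra.
have xe : x - (y' - y) <= x by lra.
by have := nd _ _ xe; lra.
Qed.

Lemma graph_time_lip2 f y y' : {homo f : a b / a <= b} -> f (-1) = 0 ->
  -1 <= y -> -1 <= y' -> `|graph_time f y - graph_time f y'| <= `|y - y'|.
Proof.
move=> nd f0; wlog yy : y y' / y <= y' => [wl y1 y1'|y1 y1'].
  have [yy|/ltW yy] := leP y y'; first exact: wl.
  by rewrite distrC (distrC y); exact: wl.
rewrite distrC (distrC y) !ger0_norm ?subr_ge0 ?graph_time_nd//.
by rewrite lerBlDl graph_time_lip.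
Qed.

(** Together with [graph_time_right] this puts the point of time [graph_time f y] and space
    [y - graph_time f y] on the completed graph. Before that time the coordinate sums are at most
    [y], after it they exceed [y], and one-sided limits conclude. *)
Lemma graph_time_left f y : {homo f : a b / a <= b} -> cadlag t f ->
  f (-1) = 0 -> -1 <= y -> left_value f (graph_time f y) <= y - graph_time f y.
Proof.
move=> nd [_ _ fl] f0 y1; have /andP[r1 rt] := graph_time_itv f0 y1.
rewrite /left_value; case: (leP (graph_time f y) (-1)) => r1'.
  rewrite f0; lra.
have fy x : -1 <= x -> x < graph_time f y -> f x <= y - x.
  move=> x1 xr; have [x' [/andP[x1' xt'] xy'] xx'] :=
    sup_gt (has_sup_time f0 y1).1 xr.
  by have := nd _ _ (ltW xx'); lra.
apply/ler_addgt0Pr => e e0; apply: limr_le; first by apply: fl; rewrite r1'.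
near=> x; have : graph_time f y - e <= x.
  by near: x; apply: nbhs_left_ge; rewrite gtrBl.
have : f x <= y - x.
  apply: fy; near: x; first by apply: nbhs_left_ge.
  exact: nbhs_left_lt.
lra.
Unshelve. all: by end_near. Qed.

Lemma graph_time_right f y : {homo f : a b / a <= b} -> cadlag t f ->
  f (-1) = 0 -> -1 <= y -> y <= t + f t ->
  y - graph_time f y <= f (graph_time f y).
Proof.
move=> nd [_ fr _] f0 y1 yt; have /andP[r1 rt] := graph_time_itv f0 y1.
have [->|rt'] := eqVneq (graph_time f y) t; first lra.
have {}rt' : graph_time f y < t by rewrite lt_neqAle rt'.
apply/ler_addgt0Pr => e e0; have e2 : 0 < e / 2 by rewrite divr_gt0.
have := fr (graph_time f y); rewrite r1 => /(_ rt').
move=> /cvgrPdist_le/(_ _ e2) H.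
have [x [rx xt xe xf]] : exists x, [/\ graph_time f y < x, x <= t,
    x <= graph_time f y + e / 2 & `|f (graph_time f y) - f x| <= e / 2].
  near (graph_time f y)^'+ => x; exists x; split; near: x => //.
  - exact: nbhs_right_gt.
  - exact: nbhs_right_le.
  - by apply: nbhs_right_le; rewrite ltrDl.
have : y < x + f x.
  rewrite ltNge; apply/negP => /(graph_time_ub f0 y1).
  by rewrite xt (le_trans r1 (ltW rx)) => /(_ isT); rewrite leNgt rx.
move: xf; rewrite ler_norml => /andP[]; lra.
Unshelve. all: by end_near. Qed.

Lemma graph_timeE f v x : {homo f : a b / a <= b} -> cadlag t f ->
  f (-1) = 0 -> completed_graph t f (v, x) ->
  [/\ -1 <= v + x, v + x <= t + f t & graph_time f (v + x) = x].
Proof.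
move=> nd cf f0 [/= xt /andP[v1 v2]].
have lv := left_value_le nd cf xt.
rewrite min_l// in v1; rewrite max_r// in v2.
case/andP: (xt) => x1 xt'.
have lv0 : 0 <= left_value f x.
  rewrite /left_value; case: (leP x (-1)) => x1'; first by rewrite f0.
  case: cf => fp _ fl; apply: limr_ge; first by apply: fl; rewrite x1'.
  near=> y; apply: fp; apply/andP; split.
    by near: y; exact: nbhs_left_ge.
  by apply: le_trans xt'; near: y; exact: nbhs_left_le.
have y1 : -1 <= v + x by lra.
split => //; first by have := nd _ _ xt'; lra.
apply/eqP; rewrite eq_le; apply/andP; split.
  apply: graph_time_le => // x' _; rewrite leNgt => xv; rewrite leNgt.
  apply/negP => xx'; move: xv; rewrite -leNgt => xv.
  by have := nd _ _ (ltW xx'); lra.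
have [x1'|x1'] := leP x (-1).
  by have /andP[+ _] := graph_time_itv f0 y1; exact: le_trans.
rewrite leNgt; apply/negP => gx.
have := @midf_lt _ (graph_time f (v + x)) x gx.
set m := _ / 2 => -[gm mx].
have /andP[g1 _] := graph_time_itv f0 y1.
have : m <= graph_time f (v + x).
  apply: graph_time_ub => //.
    by rewrite (le_trans g1 (ltW gm)) (le_trans (ltW mx)).
  suff : f m <= left_value f x by lra.
  rewrite /left_value (leNgt x) x1' /=; case: cf => _ _ fl.
  apply: limr_ge; first by apply: fl; rewrite x1'.
  by near=> y; apply: nd; near: y; exact: nbhs_left_ge.
by rewrite leNgt gm.
Unshelve. all: by end_near. Qed.

Lemma lipschitz_within (h : R -> R) (a b K : R) : 0 < K ->
  (forall s s', a <= s <= b -> a <= s' <= b -> `|h s - h s'| <= K * `|s - s'|) ->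
  {within `[a, b], continuous h}.
Proof.
move=> K0 lip; apply/subspace_continuousP => s; rewrite /= in_itv/= => sab.
apply/cvgrPdist_le => e e0; rewrite near_withinE.
exists (e / K); first by rewrite /= divr_gt0.
move=> s' /= ss'; rewrite in_itv/= => sab'; apply: (le_trans (lip _ _ sab sab')).
by rewrite mulrC -ler_pdivlMr// ltW.
Qed.

(** Affine parametrization of the coordinate sums on the graph, from [-1], since [f (-1) = 0], to
    [t + f t]. *)
Definition graph_sum f s := -1 + s * (t + 1 + f t).

(** With the coordinate sum as parameter both coordinates become Lipschitz, even across jumps: there
    time stands still and space grows away from the left value, as the order of the graph
    demands. *)
Lemma monotone_param_repr f : {homo f : a b / a <= b} -> cadlag t f ->
  f (-1) = 0 -> param_repr t f
    (fun s => graph_sum f s - graph_time f (graph_sum f s))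
    (fun s => graph_time f (graph_sum f s)).
Proof.
move=> nd cf f0.
have ft0 : 0 <= f t by case: cf => fp _ _; apply: fp; rewrite m1t lexx.
have L0 : 0 < t + 1 + f t by rewrite ltr_wpDr// ltr_wpDl.
have y1 s : 0 <= s -> -1 <= graph_sum f s.
  by move=> s0; rewrite /graph_sum lerDl mulr_ge0// ltW.
have y2 s : s <= 1 -> graph_sum f s <= t + f t.
  move=> s1; rewrite /graph_sum.
  have : s * (t + 1 + f t) <= t + 1 + f t by rewrite ler_piMl// ltW.
  lra.
have ylip s s' : `|graph_sum f s - graph_sum f s'| = (t + 1 + f t) * `|s - s'|.
  rewrite /graph_sum opprD addrACA subrr add0r -mulrBl normrM mulrC.
  by rewrite (gtr0_norm L0).
have rlip s s' : 0 <= s <= 1 -> 0 <= s' <= 1 ->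
    `|graph_time f (graph_sum f s) - graph_time f (graph_sum f s')|
    <= (t + 1 + f t) * `|s - s'|.
  move=> /andP[s0 _] /andP[s0' _]; rewrite -ylip.
  by apply: graph_time_lip2; rewrite ?y1.
have ynd s s' : s <= s' -> graph_sum f s <= graph_sum f s'.
  by move=> ss; rewrite /graph_sum lerD2l ler_wpM2r// ltW.
split.
- apply: (@lipschitz_within _ _ _ (2 * (t + 1 + f t))); first by rewrite mulr_gt0.
  move=> s s' s01 s01'.
  rewrite opprD addrACA -opprD; apply: (le_trans (ler_normB _ _)).
  rewrite -mulrA mulr2n mulrDl mul1r lerD//; last exact: rlip.
  by rewrite ylip.
- exact: (@lipschitz_within _ _ _ _ L0).
- apply/seteqP; split => [_ [s /= + <-]|[v x] vx].
    rewrite in_itv/= => /andP[s0 s1].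
    have itv := graph_time_itv f0 (y1 _ s0); split => //=.
    have lv := left_value_le nd cf itv.
    rewrite min_l// max_r// graph_time_left ?y1//=.
    by rewrite graph_time_right ?y1 ?y2.
  have [vx1 vx2 vx3] := graph_timeE nd cf f0 vx.
  have ys : graph_sum f ((v + x + 1) / (t + 1 + f t)) = v + x.
    by rewrite /graph_sum divfK ?gt_eqF//; ring.
  exists ((v + x + 1) / (t + 1 + f t)); last by rewrite ys vx3 addrK.
  rewrite /= in_itv/= divr_ge0 ?(ltW L0)//=; last by lra.
  by rewrite ler_pdivrMr// mul1r; lra.
- move=> s s' s0 ss s1.
  have := graph_time_nd f0 (y1 _ s0) (ynd _ _ ss).
  rewrite le_eqVlt => /predU1P[e|]; [right|by left]; split => //.
  have := graph_time_left nd cf f0 (y1 _ s0).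
  have := ynd _ _ ss; rewrite -e => h1 h2.
  by rewrite !ler0_norm; lra.
Qed.

(** Both graphs are run through with the same [s]. The sums then differ by at most [e] thanks to the
    final values, the times by [3 * e] and the spaces by [4 * e]. Closeness at [t] is a separate
    assumption because the Levy bounds do not see a jump at the end of the interval. *)
Lemma M1_dist_levy f g e : {homo f : a b / a <= b} -> {homo g : a b / a <= b} ->
  cadlag t f -> cadlag t g -> f (-1) = 0 -> g (-1) = 0 -> 0 <= e ->
  (forall x, -1 <= x - e -> x <= t -> g (x - e) <= f x + e) ->
  (forall x, -1 <= x - e -> x <= t -> f (x - e) <= g x + e) ->
  `|f t - g t| <= e -> (M1_dist t f g <= (4 * e)%:E)%E.
Proof.
move=> ndf ndg cf cg f0 g0 e0 H1 H2 fgt.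
have ft0 : 0 <= f t by case: cf => fp _ _; apply: fp; rewrite m1t lexx.
have gt0 : 0 <= g t by case: cg => gp _ _; apply: gp; rewrite m1t lexx.
have yd s : 0 <= s -> s <= 1 -> `|graph_sum f s - graph_sum g s| <= e.
  move=> s0 s1; rewrite /graph_sum opprD addrACA subrr add0r -mulrBr normrM.
  rewrite ger0_norm// opprD addrACA subrr add0r.
  by apply: le_trans fgt; rewrite ler_piMl.
have rd s : 0 <= s -> s <= 1 -> `|graph_time f (graph_sum f s)
    - graph_time g (graph_sum g s)| <= 3 * e.
  move=> s0 s1; set a := graph_sum f s; set b := graph_sum g s.
  have a1 : -1 <= a by rewrite /a /graph_sum lerDl mulr_ge0// !addr_ge0.
  have b1 : -1 <= b by rewrite /b /graph_sum lerDl mulr_ge0// !addr_ge0.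
  have h1 := graph_time_shift ndf f0 g0 e0 b1 H1.
  have h2 := graph_time_shift ndg g0 f0 e0 b1 H2.
  have := le_trans (graph_time_lip2 ndf f0 a1 b1) (yd s s0 s1).
  by rewrite !ler_norml => /andP[h3 h4]; lra.
apply: (@le_trans _ _ (maxe
  (nnsup [set `|(graph_sum f s - graph_time f (graph_sum f s)) -
     (graph_sum g s - graph_time g (graph_sum g s))|%:E | s in `[0, 1]])
  (nnsup [set `|graph_time f (graph_sum f s) -
     graph_time g (graph_sum g s)|%:E | s in `[0, 1]]))).
  apply: ereal_inf_lbound.
  exists (fun s => graph_sum f s - graph_time f (graph_sum f s)).
  exists (fun s => graph_time f (graph_sum f s)).
  exists (fun s => graph_sum g s - graph_time g (graph_sum g s)).
  exists (fun s => graph_time g (graph_sum g s)).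
  by split; [exact: monotone_param_repr|exact: monotone_param_repr|].
rewrite ge_max; apply/andP; split; apply: ge_nnsup; rewrite ?lee_fin ?mulr_ge0//.
  move=> _ [s /= + <-]; rewrite in_itv/= lee_fin => /andP[s0 s1].
  have := yd s s0 s1; have := rd s s0 s1.
  by rewrite !ler_norml => /andP[h1 h2] /andP[h3 h4]; lra.
move=> _ [s /= + <-]; rewrite in_itv/= lee_fin => /andP[s0 s1].
by have := rd s s0 s1; lra.
Qed.

End monotone_parametrization.

(** * Ultralimits of trees *)

Section ultralimits_of_reals.
Variables (R : realType) (U : set_system nat).
Hypothesis UU : UltraFilter U.
Implicit Types u v : nat -> R.

Definition is_ulim u l := forall e, 0 < e -> U [set n | `|u n - l| <= e].

Lemma ulim_exists u B : (forall n, `|u n| <= B) -> exists l, is_ulim u l.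
Proof.
move=> uB; have := @segment_compact R (- B) B.
have PF : ProperFilter (u @ U) by exact: fmap_proper_filter.
move=> /(_ (u @ U) PF)[].
  apply: (@filterS _ U _ setT) => [n _|]; last exact: filterT.
  by rewrite /= in_itv/= -ler_norml.
move=> l [_ lclus]; exists l => e e0.
have [//|nUe] := in_ultra_setVsetC [set n | `|u n - l| <= e] UU.
have [||x []/=] := lclus [set x | e < `|x - l|] (ball l e).
- apply: (@filterS _ U _ _ _ _ nUe) => n /=.
  by rewrite real_ltNge ?num_real// => /negP.
- exact: nbhsx_ballx.
by rewrite -ball_normE/= distrC => /lt_trans/[apply]; rewrite ltxx.
Qed.

Lemma ulim_ler u v l m : is_ulim u l -> is_ulim v m ->
  U [set n | u n <= v n] -> l <= m.
Proof.
move=> ul vm uv; apply/ler_addgt0Pr => e e0.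
have e2 : 0 < e / 2 by rewrite divr_gt0.
have [n /= [[nuv]]] := filter_ex (filterI (filterI uv (ul _ e2)) (vm _ e2)).
by rewrite !ler_norml => /andP[? ?] /andP[? ?]; lra.
Qed.

Lemma ulim_cst c : is_ulim (fun=> c) c.
Proof.
move=> e e0; apply: filterS filterT => n _ /=.
by rewrite subrr normr0 ltW.
Qed.

Lemma ulim_le u l c : is_ulim u l -> U [set n | u n <= c] -> l <= c.
Proof. by move=> ul; apply: ulim_ler ul (ulim_cst c). Qed.

Lemma ulim_ge u l c : is_ulim u l -> U [set n | c <= u n] -> c <= l.
Proof. by move=> ul; apply: ulim_ler (ulim_cst c) ul. Qed.

Lemma ulim_unique u l m : is_ulim u l -> is_ulim u m -> l = m.
Proof.
move=> ul um; apply/eqP; rewrite eq_le.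
by rewrite (ulim_ler ul um) ?(ulim_ler um ul)//; apply: filterS filterT => n /=.
Qed.

Lemma ulimD u v l m : is_ulim u l -> is_ulim v m ->
  is_ulim (fun n => u n + v n) (l + m).
Proof.
move=> ul vm e e0; have e2 : 0 < e / 2 by rewrite divr_gt0.
apply: filterS (filterI (ul _ e2) (vm _ e2)) => n /= [].
by rewrite !ler_norml => /andP[? ?] /andP[? ?]; lra.
Qed.

Lemma ultra_ord_all k (P : nat -> set nat) :
  (forall i, (i < k)%N -> U (P i)) -> U [set n | forall i, (i < k)%N -> P i n].
Proof.
elim: k => [|k IHk] H; first by apply: filterS filterT => n _ i.
apply: filterS (filterI (IHk (fun i ik => H i (ltnW ik))) (H k (ltnSn k))).
move=> n /= [H1 H2] i; rewrite ltnS leq_eqVlt => /predU1P[->//|]; exact: H1.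
Qed.

End ultralimits_of_reals.

Lemma dependent_choice_fun (I : Type) (T : I -> Type) (P : forall i, T i -> Prop) :
  (forall i, exists y, P i y) -> exists f, forall i, P i (f i).
Proof.
by move=> H; exists (fun i => sval (cid (H i))) => i; exact: svalP (cid (H i)).
Qed.

Lemma pseudometric_quotient (R : realType) (P : Type) (D : P -> P -> R) :
  (forall x, D x x = 0) -> (forall x y, D x y = D y x) ->
  (forall y x z, D x z <= D x y + D y z) ->
  exists (Q : metric_space R) (p : P -> Q), (forall q, exists x, p x = q) /\
    (forall x y, mdist (p x) (p y) = D x y).
Proof.
move=> Dxx Dsym Dtri.
have D0 x y : 0 <= D x y by have := Dtri y x x; rewrite Dxx (Dsym y x); lra.
have Deq x y z : D x y = 0 -> D x z = D y z.
  move=> xy; have := Dtri y x z; have := Dtri x y z.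
  by rewrite (Dsym y x) xy !add0r => h1 h2; apply/eqP; rewrite eq_le h1 h2.
pose cls x : P -> Prop := fun y => D x y = 0.
pose Q := {A : P -> Prop | exists x, A = cls x}.
have svalI (A B : Q) : sval A = sval B -> A = B.
  case: A B => A HA [B HB] /= AB; move: HA HB; rewrite AB => HA HB.
  by congr exist; exact: Prop_irrelevance.
have /choice[rep repP] : forall A : Q, exists x, sval A = cls x.
  by move=> A; case: A => A HA; exact: HA.
pose p x : Q := exist _ (cls x) (ex_intro _ x erefl).
have repp x : D x (rep (p x)) = 0.
  have := repP (p x); rewrite /= => /(congr1 (fun A => A (rep (p x)))).
  by rewrite /cls/= Dxx => ->.
pose dQ (A B : Q) := D (rep A) (rep B).
have dQ0 A B : dQ A B = 0 -> A = B.
  move=> AB; apply: svalI; rewrite (repP A) (repP B).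
  by apply/funext => y; rewrite /cls/= (Deq _ _ _ AB).
exists (@MetricSpace R Q dQ (fun A => Dxx _) dQ0 (fun A B => Dsym _ _)
         (fun B A C => Dtri _ _ _)).
exists p; split.
  by move=> A; exists (rep A); apply: svalI; rewrite (repP A).
move=> x y; rewrite /mdist/= /dQ -(Deq _ _ _ (repp x)) Dsym.
by rewrite -(Deq _ _ _ (repp y)) Dsym.
Qed.

Lemma locally_little_holder_intro (R : realType) (alpha : R) (T : metricType R)
    (x0 : T) (M : T -> R * R) :
  (forall r e, 0 <= r -> 0 < e -> exists2 d, 0 < d & forall x y,
     mdist x0 x <= r -> mdist x0 y <= r -> mdist x y <= d ->
     enorm (M x - M y) <= e * mdist x y `^ alpha) ->
  locally_little_holder alpha M.
Proof.
move=> H K cK.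
have : compact (mdist x0 @` K).
  apply: continuous_compact => //; apply: continuous_subspaceT.
  exact: mdist_continuous.
move=> /compact_bounded[B [_ /(_ (`|B| + 1))]].
rewrite (le_lt_trans (ler_norm _)) ?ltrDl// => /(_ isT) HB.
have KB x : K x -> mdist x0 x <= `|B| + 1.
  by move=> Kx; rewrite (le_trans (ler_norm _))//; apply: HB; exists x.
move=> A A0; have [e /= e0 eA] : nbhs (0 : R) (EFin @^-1` A) by exact: A0.
(* The point [z'] need not belong to [K], only to its 1-neighbourhood, whence one more unit in the
   radius. *)
have r0 : 0 <= `|B| + 2 by rewrite addr_ge0.
have e2 : 0 < e / 2 by rewrite divr_gt0.
have [d d0 Hd] := H _ _ r0 e2.
exists (Num.min 1 d); first by rewrite /= lt_min ltr01.
move=> s /=; rewrite sub0r normrN lt_min => /andP[s1 sd] s0.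
rewrite gtr0_norm// in s1 sd.
set N := nnsup _.
have N0 : (0 <= N)%E := nnsup_ge0 _.
have Ne : (N <= (e / 2)%:E)%E.
  apply: ge_nnsup; first by rewrite lee_fin ltW.
  move=> _ [z [z' [Kz /andP[zz0 zzs] ->]]].
  rewrite lee_fin ler_pdivrMr ?powR_gt0//; apply: Hd.
  - by rewrite (le_trans (KB _ Kz))// lerD2l ler1n.
  - by have := metric_triangle x0 z z'; have := KB _ Kz; lra.
  - by rewrite (le_trans zzs)// ltW.
have Nfin : N \is a fin_num by rewrite ge0_fin_numE// (le_lt_trans Ne)// ltry.
rewrite -(fineK Nfin); apply: eA => /=.
rewrite sub0r normrN ger0_norm ?fine_ge0// -lte_fin fineK//.
by rewrite (le_lt_trans Ne)// lte_fin; lra.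
Qed.

Section ultralimit_tree.
Variables (R : realType) (alpha : R).
Hypothesis halpha : 0 < alpha < 1.
Variables (U : set_system nat).
Hypothesis UU : UltraFilter U.
Hypothesis U_cofinite : forall N, U [set n | (N <= n)%N].
Variable zeta : nat -> spatial_tree alpha.

Hypothesis nets : forall r e, 0 < r -> 0 < e -> exists N, forall n,
  exists s : seq (tree (zeta n)), [/\ (size s <= N)%N,
    [set` s] `<=` tball (zeta n) r &
    forall x, tball (zeta n) r x -> exists2 w, w \in s & mdist x w <= e].
Hypothesis bounds : forall r, 0 < r ->
  exists2 K, 0 <= K & forall n, evalM_bound (zeta n) r K.
Hypothesis moduli : forall r e, 0 < r -> 0 < e ->
  exists2 d, 0 < d & forall n, evalM_modulus (zeta n) r d e.
Hypothesis proper : forall r, 0 < r ->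
  exists2 K, 0 <= K & forall n, properness_map (zeta n) r <= K.

Local Notation o n := (basept (zeta n)).

Definition bounded_family := {x : forall n, tree (zeta n) |
  exists B, forall n, mdist (o n) (x n) <= B}.

Definition family_at (x : bounded_family) n : tree (zeta n) := sval x n.
Coercion family_at : bounded_family >-> Funclass.

Let mk (x : forall n, tree (zeta n)) B (xB : forall n, mdist (o n) (x n) <= B) :
  bounded_family := exist _ x (ex_intro _ B xB).

Lemma base_family_bound n : mdist (o n) (o n) <= 0.
Proof. by rewrite mdistxx. Qed.

Definition base_family : bounded_family := mk base_family_bound.

Lemma family_dist_ulim (x y : bounded_family) :
  exists l, is_ulim U (fun n => mdist (x n) (y n)) l.
Proof.
case: x => x [B xB]; case: y => y [B' yB].
apply: (@ulim_exists _ _ UU _ (B + B')) => n /=.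
rewrite ger0_norm ?mdist_ge0//; have := metric_triangle (x n) (o n) (y n).
rewrite (metric_sym (x n) (o n)).
by have := xB n; have := yB n; rewrite /family_at/=; lra.
Qed.

Lemma ultralimit_space : exists (Q : metric_space R) (p : bounded_family -> Q),
  (forall q, exists x, p x = q) /\ (forall x y : bounded_family,
    is_ulim U (fun n => mdist (x n) (y n)) (mdist (p x) (p y))).
Proof.
have /choice[D' D'P] : forall xy : bounded_family * bounded_family, exists l,
    is_ulim U (fun n => mdist (xy.1 n) (xy.2 n)) l.
  by move=> xy; exact: family_dist_ulim.
pose D x y := D' (x, y).
have DP (x y : bounded_family) :
    is_ulim U (fun n => mdist (x n) (y n)) (D x y) by exact: (D'P (x, y)).
have [|||Q [p [p1 p2]]] := @pseudometric_quotient R _ D.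
- move=> x; apply: (ulim_unique UU (DP x x)) => e e0.
  by apply: filterS filterT => n _ /=; rewrite mdistxx subr0 normr0 ltW.
- move=> x y; apply: (ulim_unique UU (DP x y)) => e e0.
  by apply: filterS (DP y x e e0) => n /=; rewrite metric_sym.
- move=> y x z; apply: (ulim_ler UU (DP x z) (ulimD UU (DP x y) (DP y z))).
  by apply: filterS filterT => n _ /=; exact: metric_triangle.
by exists Q, p; split => // x y; rewrite p2.
Qed.

Variables (Q : metric_space R) (p : bounded_family -> Q).
Hypothesis p_surj : forall q, exists x, p x = q.
Hypothesis p_dist : forall x y : bounded_family,
  is_ulim U (fun n => mdist (x n) (y n)) (mdist (p x) (p y)).

Local Notation oo := (p base_family).

Lemma ultralimit_eq (x y : bounded_family) :
  (forall e, 0 < e -> U [set n | mdist (x n) (y n) <= e]) -> p x = p y.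
Proof.
move=> H; apply: mdist_positivity; apply: (ulim_unique UU (p_dist x y)) => e e0.
by apply: filterS (H e e0) => n /=; rewrite subr0 ger0_norm ?mdist_ge0.
Qed.

Lemma ultralimit_dist_lt (x y : bounded_family) c : mdist (p x) (p y) < c ->
  U [set n | mdist (x n) (y n) < c].
Proof.
move=> xyc; have e0 : 0 < (c - mdist (p x) (p y)) / 2.
  by rewrite divr_gt0// subr_gt0.
apply: filterS (p_dist x y e0) => n /=; rewrite ler_norml; lra.
Qed.

(* Representatives that leave the ball are pulled back towards the root, which
   moves them by a distance tending to 0. *)
Lemma ultralimit_lift q r : 0 <= r -> mdist oo q <= r ->
  exists2 x : bounded_family, p x = q & forall n, tball (zeta n) r (x n).
Proof.
move=> r0; have [x <-] := p_surj q => xr.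
have /dependent_choice_fun[y yP] : forall n, exists y : tree (zeta n),
    tball (zeta n) r y /\ mdist (x n) y <= Num.max 0 (mdist (o n) (x n) - r).
  move=> n; have [zr|/ltW zr] := leP (mdist (o n) (x n)) r.
    by exists (x n); split => //; rewrite mdistxx le_max lexx.
  have [y yr zy] := rtree_toward_root r0 zr (lexx (mdist (o n) (x n))).
  by exists y; split => //; rewrite le_max zy orbT.
pose y' := mk (fun n => (yP n).1).
exists y'; last by move=> n; exact: (yP n).1.
apply/esym/ultralimit_eq => e e0.
have /ultralimit_dist_lt : mdist oo (p x) < r + e by lra.
apply: filterS => n /= xn; apply: (le_trans (yP n).2) => /=.
by rewrite ge_max (ltW e0)/= lerBlDl ltW.
Qed.

Lemma ultralimit_ball (x : bounded_family) r :
  U [set n | tball (zeta n) r (x n)] -> mdist oo (p x) <= r.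
Proof. by move=> H; exact: (ulim_le UU (p_dist base_family x) H). Qed.

(** Which alternative holds may vary with the index; the ultrafilter selects one of them. *)
Lemma ultralimit_four_point : four_point Q.
Proof.
move=> qx qy qz qw.
have [x <-] := p_surj qx; have [y <-] := p_surj qy.
have [z <-] := p_surj qz; have [w <-] := p_surj qw.
have fp n := rtree_four_point (@tree_Rtree _ _ (zeta n)) (x n) (y n) (z n) (w n).
pose A := [set n | mdist (x n) (y n) + mdist (z n) (w n) <=
                   mdist (x n) (z n) + mdist (y n) (w n)].
have [UA|UA] := in_ultra_setVsetC A UU; [left|right].
  exact: (ulim_ler UU (ulimD UU (p_dist x y) (p_dist z w))
                      (ulimD UU (p_dist x z) (p_dist y w))).
apply: (ulim_ler UU (ulimD UU (p_dist x y) (p_dist z w))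
                      (ulimD UU (p_dist x w) (p_dist y z))).
by apply: filterS UA => n /= nA; case: (fp n).
Qed.

Lemma ultralimit_geodesic q q' : exists f : R -> Q,
  [/\ isometric_on (mdist q q') f, f 0 = q & f (mdist q q') = q'].
Proof.
have [x <-] := p_surj q; have [y <-] := p_surj q'.
set L := mdist (p x) (p y).
have /dependent_choice_fun[f fP] : forall n, exists f : R -> tree (zeta n),
    [/\ isometric_on (mdist (x n) (y n)) f, f 0 = x n &
        f (mdist (x n) (y n)) = y n].
  by move=> n; have [f [f1 f2 f3 _ _]] := tree_Rtree (x n) (y n); exists f.
pose l n := mdist (x n) (y n).
(* The geodesic at index [n] has length [l n] and not [L]; clamping the parameter to its domain
   costs an error that vanishes along [U]. *)
pose c n s := Num.min (Num.max 0 s) (l n).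
have cl n s : 0 <= c n s <= l n.
  by rewrite /c le_min le_max lexx mdist_ge0/= ge_min lexx orbT.
have [B xB] : exists B, forall n, mdist (o n) (x n) <= B by case: (x).
have [B' yB] : exists B', forall n, mdist (o n) (y n) <= B' by case: (y).
have fB s n : mdist (o n) (f n (c n s)) <= B + (B + B').
  have [fi f0 fl] := fP n; have := isometric_on_start fi (cl n s).
  rewrite f0; have := metric_triangle (o n) (x n) (f n (c n s)).
  have := metric_triangle (x n) (o n) (y n); rewrite (metric_sym (x n) (o n)).
  have := xB n; have := yB n; have /andP[_] := cl n s; rewrite /l; lra.
pose F s := p (mk (fB s)).
have cE n s e : 0 <= s -> s <= L -> `|l n - L| <= e -> 0 <= s - c n s <= e.
  move=> s0 sL; rewrite ler_norml => lL.
  rewrite /c max_r// ; case: (leP s (l n)) => sl; first lra.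
  by lra.
exists F; split.
- move=> s t; rewrite !in_itv/= => /andP[s0 sL] /andP[t0 tL].
  apply: (ulim_unique UU (p_dist _ _)) => e e0.
  apply: filterS (@p_dist x y e e0) => n /= xye.
  have [fi _ _] := fP n; rewrite /family_at/= fi ?in_itv/= ?cl//.
  have /andP[s1 s2] := cE n s e s0 sL xye.
  have /andP[t1 t2] := cE n t e t0 tL xye.
  apply: (le_trans (ler_dist_dist _ _)).
  by rewrite ler_norml; lra.
- apply: ultralimit_eq => e e0; apply: filterS filterT => n _ /=.
  rewrite /family_at/= /c max_l// min_l ?mdist_ge0//.
  by have [_ -> _] := fP n; rewrite mdistxx ltW.
- apply: ultralimit_eq => e e0; apply: filterS (@p_dist x y e e0) => n /= xye.
  have /andP[s1 s2] := cE n L e (mdist_ge0 _ _) (lexx L) xye.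
  have [fi _ fl] := fP n; have := isometric_on_end fi (cl n L).
  rewrite /family_at/= fl => ->.
  rewrite /c max_r ?mdist_ge0//; move: xye; rewrite -/(l n) -/L ler_norml.
  by move=> /andP[h1 h2]; case: (leP L (l n)) => h3; lra.
Qed.

Lemma ultralimit_Rtree : is_Rtree Q.
Proof.
exact: four_point_rtree ultralimit_four_point ultralimit_geodesic.
Qed.

(** The nets at all indices are enumerated by the same [N] families, padded with the root, so that
    they become a finite net of the limit. The root comes first in order that correspondences built
    on the net contain the pair of roots. Radius 0 is apart since [nets] is about positive radii. *)
Lemma family_nets r e : 0 <= r -> 0 < e ->
  exists N, exists X : nat -> bounded_family,
  [/\ (0 < N)%N, X 0%N = base_family, forall i n, tball (zeta n) r (X i n) &
    forall n x, tball (zeta n) r x -> exists2 i, (i < N)%N & mdist x (X i n) <= e].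
Proof.
rewrite le_eqVlt => /predU1P[<- e0|r0 e0].
  exists 1%N, (fun=> base_family); split => // [_ n|n x].
    by rewrite /tball /cball /= mdistxx.
  move=> x0; exists 0%N => //; rewrite metric_sym (le_trans x0)//; exact: ltW.
have [N HN] := nets r0 e0.
have /dependent_choice_fun[t tP] := HN.
have tr i n : tball (zeta n) r (nth (o n) (o n :: t n) i).
  case: i => [|i] /=; first by rewrite /tball /cball/= mdistxx ltW.
  have [it|it] := ltnP i (size (t n)).
    by have [_ sub _] := tP n; apply: sub; exact: mem_nth.
  by rewrite nth_default// /tball /cball/= mdistxx ltW.
exists N.+1, (fun i => if i is 0 then base_family else mk (tr i)); split => //.
  move=> [|i] n; last exact: (tr i.+1).
  by rewrite /tball /cball /= mdistxx ltW.
move=> n x xr; have [tN _ cov] := tP n; have [w wt xw] := cov x xr.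
exists (index w (t n)).+1; first by rewrite ltnS (leq_trans _ tN)// index_mem.
by rewrite /family_at/= nth_index.
Qed.

Lemma ultralimit_net r e N (X : nat -> bounded_family) : 0 <= r -> 0 < e ->
  (forall n x, tball (zeta n) r x -> exists2 i, (i < N)%N & mdist x (X i n) <= e) ->
  forall q, mdist oo q <= r -> exists2 i, (i < N)%N & mdist q (p (X i)) <= e.
Proof.
move=> r0 e0 cov q /(ultralimit_lift r0)[x <- xr].
have [|i iN Ui] := @ultra_finite_cover _ U N
    (fun i => [set n | mdist (x n) (X i n) <= e]) UU.
  by apply: filterS filterT => n _; exact: cov.
by exists i => //; apply: ulim_le (p_dist _ _) Ui.
Qed.

(* At index n the limit follows X 0, X 1, ... for as long as the steps taken at
   index n are short, but for at most n steps. *)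
Lemma ultralimit_cauchy (X : nat -> bounded_family) :
  (forall k, mdist (p (X k)) (p (X k.+1)) < 2^-1 ^+ k) ->
  exists y : bounded_family, forall k, mdist (p (X k)) (p y) <= 2 * 2^-1 ^+ k.
Proof.
move=> HX.
pose good n k := `[< forall j, (j < k)%N ->
  mdist (X j n) (X j.+1 n) < 2^-1 ^+ j >].
have chain n m k : good n m -> (k <= m)%N ->
    mdist (X k n) (X m n) <= 2 * 2^-1 ^+ k - 2 * 2^-1 ^+ m.
  move=> /asboolP gm; elim: m gm => [|m IHm] gm.
    by rewrite leqn0 => /eqP ->; rewrite mdistxx subrr.
  rewrite leq_eqVlt => /predU1P[->|]; first by rewrite mdistxx subrr.
  rewrite ltnS => km; have := IHm (fun j jm => gm j (ltnW jm)) km.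
  have := gm m (ltnSn m); have := metric_triangle (X k n) (X m n) (X m.+1 n).
  by rewrite exprS; move: (2^-1 ^+ m) (2^-1 ^+ k) => a b; lra.
(* The requirement [k <= n] ensures that there is a largest good [k]. *)
have goodex n : exists k, good n k && (k <= n)%N.
  by exists 0%N; rewrite andbT; apply/asboolP.
have bd n k : good n k && (k <= n)%N -> (k <= n)%N by case/andP.
have /choice[m mP] : forall n, exists m, [/\ good n m, (m <= n)%N &
    forall k, good n k -> (k <= n)%N -> (k <= m)%N].
  move=> n; case: (ex_maxnP (goodex n) (bd n)) => m /andP[m1 m2] mmax.
  by exists m; split => // k k1 k2; apply: mmax; rewrite k1.
have [B X0B] : exists B, forall n, mdist (o n) (X 0%N n) <= B by case: (X 0%N).
have yB n : mdist (o n) (X (m n) n) <= B + 2.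
  have [gm _ _] := mP n; have := chain n (m n) 0%N gm (leq0n _).
  have := metric_triangle (o n) (X 0%N n) (X (m n) n).
  have : 0 <= 2^-1 ^+ m n :> R by rewrite exprn_ge0.
  have := X0B n; rewrite expr0; lra.
exists (mk yB) => k; apply: ulim_le (p_dist _ _) _.
have : U [set n | forall j, (j < k)%N -> mdist (X j n) (X j.+1 n) < 2^-1 ^+ j].
  by apply: ultra_ord_all => j _; exact: ultralimit_dist_lt.
move=> Uk; apply: filterS (filterI Uk (U_cofinite k)) => n /= [gk kn].
have [gm _ mmax] := mP n; rewrite /family_at/=.
apply: (le_trans (chain n (m n) k gm _)); first by apply: mmax => //; exact/asboolP.
by rewrite gerBl mulr_ge0// exprn_ge0.
Qed.

(** An ultrafilter on a bounded set contains, for each [k], a ball of radius [2^-1 ^+ k / 4] around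
    a point of a finite net. Consecutive balls meet, so their centres satisfy the hypothesis of
    [ultralimit_cauchy], and the limit of the centres is the limit of the ultrafilter. *)
Lemma ultralimit_compact (K : set Q) : closed K ->
  (exists (x : Q) (r : R), K `<=` cball x r) -> compact K.
Proof.
move=> cK [c [r0 Kr0]]; pose r := Num.max 0 (mdist oo c + r0).
have r_ge0 : 0 <= r by rewrite le_max lexx.
have Kr q : K q -> mdist oo q <= r.
  move=> /Kr0; rewrite /cball/= => cq; rewrite le_max.
  by apply/orP; right; apply: (le_trans (metric_triangle _ c _)); rewrite lerD2l.
rewrite compact_ultra => F UF FK.
have /choice[X XP] : forall k, exists x : bounded_family,
    F [set q | mdist q (p x) <= 2^-1 ^+ k / 4].
  move=> k; have e0 : 0 < 2^-1 ^+ k / 4 :> R by rewrite divr_gt0// exprn_gt0.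
  have [N [X [_ _ _ cov]]] := family_nets r_ge0 e0.
  have [|i iN Fi] := @ultra_finite_cover _ F N
      (fun i => [set q | mdist q (p (X i)) <= 2^-1 ^+ k / 4]) UF.
    by apply: filterS FK => q /Kr; exact: ultralimit_net.
  by exists (X i).
have [k|y yP] := @ultralimit_cauchy X.
  have [q [/= q1 q2]] := filter_ex (filterI (XP k) (XP k.+1)).
  have := metric_triangle (p (X k)) q (p (X k.+1)).
  rewrite (metric_sym (p (X k)) q); rewrite exprS in q2.
  have : 0 < 2^-1 ^+ k :> R by rewrite exprn_gt0.
  move: (2^-1 ^+ k) q1 q2 => a; lra.
have Fy : F --> p y.
  apply/metricType_numDomainType.fcvgrPdist_lt => e e0.
  have [k ke] : exists k, 2^-1 ^+ k < e / 3 :> R.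
    have e3 : 0 < e / 3 by rewrite divr_gt0.
    have [N HN] := natSinv_lt e3; exists N.+1.
    apply: lt_trans (HN N (leqnn _)); rewrite exprVn ltf_pV2 ?posrE ?exprn_gt0//.
    by rewrite -natrX ltr_nat ltn_expl.
  apply: filterS (XP k) => q /= qX; have := yP k.
  have := metric_triangle (p y) (p (X k)) q.
  rewrite (metric_sym (p y) (p (X k))) (metric_sym (p (X k)) q).
  have : 0 < 2^-1 ^+ k :> R by rewrite exprn_gt0.
  move: (2^-1 ^+ k) qX ke => a; lra.
exists (p y); split => //; apply: cK => B By.
exact: filter_ex (filterI FK (Fy _ By)).
Qed.

Lemma ultralimit_complete (F : set_system Q) : ProperFilter F -> cauchy F ->
  exists z : Q, F --> z.
Proof.
move=> PF /cauchyP cF; have [c Fc] := cF 1 ltr01.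
have cK : compact (cball c 1).
  by apply: ultralimit_compact; [exact: closed_cball|exists c, 1].
have FK : F (cball c 1).
  by apply: filterS Fc => q; rewrite ballEmdist /cball/= => /ltW.
have [y [_ yclus]] := cK F PF FK; exists y.
apply/metricType_numDomainType.fcvgrPdist_lt => e e0.
have e3 : 0 < e / 3 by rewrite divr_gt0.
have [x Fx] := cF _ e3.
have [q] := yclus _ _ Fx (nbhsx_ballx y _ e3).
rewrite !ballEmdist /= => -[xq yq]; apply: filterS Fx => w.
rewrite ballEmdist/= => xw; have := metric_triangle y q w.
have := metric_triangle q x w; rewrite (metric_sym q x); lra.
Qed.

Lemma ultralimit_separable : exists2 D : set Q, countable D & dense D.
Proof.
have /choice[X XP] : forall k : nat, exists X : nat -> bounded_family,
    forall q, mdist oo q <= k%:R -> exists i, mdist q (p (X i)) <= k.+1%:R^-1.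
  move=> k; have e0 : 0 < k.+1%:R^-1 :> R by rewrite invr_gt0.
  have [N [X [_ _ _ cov]]] := family_nets (ler0n R k) e0.
  exists X => q qk; have [i _ Hi] := ultralimit_net (ler0n R k) e0 cov qk.
  by exists i.
exists (range (fun ki : nat * nat => p (X ki.1 ki.2))).
  by apply: card_le_trans (card_image_le _ _) _; exact: countableP.
move=> O [q Oq] oO; have : nbhs q O by exact: open_nbhs_nbhs.
move=> /metricType_numDomainType.nbhs_mdistP[e /= e0 eO].
have [N HN] := natSinv_lt e0.
pose k := maxn N (Num.truncn (mdist oo q)).+1.
have [|i Hi] := XP k q.
  apply: (le_trans (ltW (truncnS_gt _))); rewrite ler_nat; exact: leq_maxr.
exists (p (X k i)); split; last by exists (k, i).
by apply: eO => /=; apply: le_lt_trans Hi (HN k (leq_maxl _ _)).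
Qed.

Let alpha_gt0 : 0 < alpha. Proof. by case/andP: halpha. Qed.

(** Bounded values have a limit along [U] for each family. That this limit depends only on the point
    [p x] is due to the uniform moduli, which compare [x] with the chosen representative of its
    class. *)
Lemma ultralimit_evalM : exists M : Q -> R * R, forall (x : bounded_family) e,
  0 < e -> U [set n | enorm (evalM (zeta n) (x n) - M (p x)) <= e].
Proof.
have /choice[M0 M0P] : forall x : bounded_family, exists m : R * R, forall e,
    0 < e -> U [set n | enorm (evalM (zeta n) (x n) - m) <= e].
  move=> x; have [B xB] : exists B, forall n, mdist (o n) (x n) <= B by case: (x).
  have r0 : 0 < Num.max 1 B by rewrite lt_max ltr01.
  have [K K0 bd] := bounds r0.
  have xK n : enorm (evalM (zeta n) (x n)) <= K.
    by apply: bd; rewrite /tball /cball/= le_max xB orbT.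
  have [m1 Hm1] := ulim_exists UU
    (fun n => le_trans (norm1_le_enorm (evalM (zeta n) (x n))) (xK n)).
  have [m2 Hm2] := ulim_exists UU
    (fun n => le_trans (norm2_le_enorm (evalM (zeta n) (x n))) (xK n)).
  exists (m1, m2) => e e0; have e2 : 0 < e / 2 by rewrite divr_gt0.
  apply: filterS (filterI (Hm1 _ e2) (Hm2 _ e2)) => n /= [h1 h2].
  by apply: (le_trans (enorm_le_sum _)) => /=; lra.
have /choice[rep repP] := p_surj.
exists (M0 \o rep) => x e e0 /=; have e2 : 0 < e / 2 by rewrite divr_gt0.
set x' := rep (p x).
have [B xB] : exists B, forall n, mdist (o n) (x n) <= B by case: (x).
have [B' xB'] : exists B, forall n, mdist (o n) (x' n) <= B by case: (x').
pose r := Num.max 1 (Num.max B B').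
have r0 : 0 < r by rewrite lt_max ltr01.
have [d d0 md] := moduli r0 ltr01.
have [h h0 hP] := powR_small alpha_gt0 e2.
have xx' : mdist (p x) (p x') < Num.min d h.
  by rewrite /x' repP mdistxx lt_min d0.
apply: filterS (filterI (ultralimit_dist_lt xx') (M0P x' _ e2)) => n /= [].
rewrite lt_min => /andP[nd nh] ne.
apply: (le_trans (enorm_dist3 _ (evalM (zeta n) (x' n)) _)).
have := md n (x n) (x' n); rewrite mul1r /tball /cball/= !le_max xB xB' !orbT.
move=> /(_ isT isT (ltW nd)); have := hP _ (mdist_ge0 _ _) (ltW nh).
by rewrite -/x' in ne *; lra.
Qed.

Variable M : Q -> R * R.
Hypothesis p_M : forall (x : bounded_family) e,
  0 < e -> U [set n | enorm (evalM (zeta n) (x n) - M (p x)) <= e].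

Lemma ultralimit_modulus r e d : 0 <= r -> 0 < e -> 0 < d ->
  (forall n, evalM_modulus (zeta n) r d e) ->
  forall q q', mdist oo q <= r -> mdist oo q' <= r -> mdist q q' <= d / 2 ->
  enorm (M q - M q') <= (2 * e) * mdist q q' `^ alpha.
Proof.
move=> r0 e0 d0 md q q' /(ultralimit_lift r0)[x <- xr].
move=> /(ultralimit_lift r0)[y <- yr] xyd.
have [xy0|xy0] := eqVneq (mdist (p x) (p y)) 0.
  rewrite (mdist_positivity _ _ xy0) subrr enorm0 !mulr_ge0 ?powR_ge0//.
  exact: ltW.
have {}xy0 : 0 < mdist (p x) (p y) by rewrite lt_def xy0 mdist_ge0.
apply/ler_addgt0Pr => u u0; have u2 : 0 < u / 2 by rewrite divr_gt0.
have xy2 : mdist (p x) (p y) < 2 * mdist (p x) (p y) by lra.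
have [n [/= nxy [nx ny]]] := filter_ex (filterI (ultralimit_dist_lt xy2)
  (filterI (p_M x u2) (p_M y u2))).
have nd : mdist (x n) (y n) <= d by lra.
have h1 := md n _ _ (xr n) (yr n) nd.
have h2 : mdist (x n) (y n) `^ alpha <= 2 * mdist (p x) (p y) `^ alpha.
  apply: (@le_trans _ _ ((2 * mdist (p x) (p y)) `^ alpha)).
    rewrite ge0_ler_powR ?nnegrE ?mdist_ge0 ?mulr_ge0 ?mdist_ge0//.
      exact: ltW.
    exact: ltW.
  rewrite powRM ?mdist_ge0// ler_wpM2r ?powR_ge0// -[leRHS]powRr1//.
  by rewrite ler_powR ?ler1n//; case/andP: halpha => _ /ltW.
have h3 : enorm (M (p x) - M (p y)) <= enorm (evalM (zeta n) (x n) - M (p x))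
    + (enorm (evalM (zeta n) (x n) - evalM (zeta n) (y n))
    + enorm (evalM (zeta n) (y n) - M (p y))).
  apply: (le_trans (enorm_dist3 _ (evalM (zeta n) (x n)) _)).
  by rewrite enorm_distC lerD2l enorm_dist3.
have h4 : e * mdist (x n) (y n) `^ alpha <= (2 * e) * mdist (p x) (p y) `^ alpha.
  by rewrite -mulrA mulrCA ler_wpM2l// ltW.
lra.
Qed.

Lemma ultralimit_moduli r e : 0 <= r -> 0 < e -> exists2 d, 0 < d &
  forall q q', mdist oo q <= r -> mdist oo q' <= r -> mdist q q' <= d ->
  enorm (M q - M q') <= e * mdist q q' `^ alpha.
Proof.
move=> r0 e0; have e2 : 0 < e / 2 by rewrite divr_gt0.
have r1 : 0 < r + 1 by rewrite ltr_pwDr.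
have [d d0 md] := moduli r1 e2.
exists (d / 2); first by rewrite divr_gt0.
move=> q q' qr qr' qq'.
rewrite -[e](@mulfVK _ 2)// (mulrC (e / 2)).
apply: (ultralimit_modulus (ltW r1) e2 d0 md) => //.
  by rewrite (le_trans qr)// lerDl.
by rewrite (le_trans qr')// lerDl.
Qed.

Lemma ultralimit_continuous : continuous M.
Proof.
apply: (holder_continuous alpha_gt0) => q.
have r0 : 0 <= mdist oo q + 1 by rewrite addr_ge0 ?mdist_ge0.
have [d d0 Hd] := ultralimit_moduli r0 ltr01.
exists (Num.min d 1); first by rewrite lt_min d0 ltr01.
exists 1 => // q'; rewrite le_min => /andP[qd q1].
apply: Hd => //; first by rewrite lerDl.
by apply: (le_trans (metric_triangle _ q _)); rewrite lerD2l.
Qed.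

Lemma ultralimit_proper (K : set (R * R)) : compact K -> compact (M @^-1` K).
Proof.
move=> cK; apply: ultralimit_compact.
  apply: (@preimage_closed _ _ M K) => [q _|]; first exact: ultralimit_continuous.
  by apply: compact_closed cK; exact: norm_hausdorff.
have [B [_ /(_ (`|B| + 1))]] := compact_bounded cK.
rewrite (le_lt_trans (ler_norm _)) ?ltrDl// => /(_ isT) HB.
(* Values of the limit map in [K] have norm at most [|B| + 1]; the additional unit absorbs the error
   at index [n], so that [proper] bounds the distance to the root. *)
have r0 : 0 < `|B| + 2 by rewrite ltr_pwDr.
have [C C0 HC] := proper r0.
exists oo, C => q; have [x <-] := p_surj q => /HB xB.
apply: ulim_le (p_dist _ _) _ => //; apply: filterS (p_M x ltr01) => n /= nx.
apply: le_trans (HC n); apply: properness_map_ub.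
have := ler_normD (evalM (zeta n) (x n) - M (p x)) (M (p x)); rewrite subrK.
have xB' : `|M (p x)| <= `|B| + 1 by exact: xB.
have := norm_le_enorm (evalM (zeta n) (x n) - M (p x)).
move: (`|B|) nx xB' => B'; rewrite /family_at/=; lra.
Qed.

Definition ultralimit : spatial_tree alpha :=
  @SpatialTree R alpha Q oo M ultralimit_Rtree
  ultralimit_complete ultralimit_separable ultralimit_compact
  ultralimit_proper (locally_little_holder_intro ultralimit_moduli).

Lemma ultralimit_evalM_modulus r e d : 0 <= r -> 0 < e -> 0 < d ->
  (forall n, evalM_modulus (zeta n) r d e) ->
  evalM_modulus ultralimit r (d / 2) (2 * e).
Proof. by move=> r0 e0 d0 md q q'; exact: ultralimit_modulus. Qed.

(** Points near the same member of a common finite net are paired. Only finitely many distances and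
    values then have to be close to their limits, and [U] grants this simultaneously. *)
Lemma ultralimit_correspondence r e : 0 <= r -> 0 < e ->
  U [set n | exists C : set (tree (zeta n) * tree ultralimit),
    [/\ correspondence (tball (zeta n) r) (tball ultralimit r) C,
        C (o n, basept ultralimit),
        (forall x y x' y', C (x, y) -> C (x', y') ->
           `|mdist x x' - mdist y y'| <= e) &
        (forall x y, C (x, y) ->
           enorm (evalM (zeta n) x - evalM ultralimit y) <= e)]].
Proof.
move=> r0 e0; have r1 : 0 < r + 1 by rewrite ltr_pwDr.
have e8 : 0 < e / 8 by rewrite divr_gt0.
have [d d0 md] := moduli r1 ltr01.
have {}md n : evalM_modulus (zeta n) r d 1.
  by apply: evalM_modulus_le (md n); rewrite // lerDl.
have [h h0 hP] := powR_small alpha_gt0 e8.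
(* The distortion is at most [5 * eta]; [d / 2] is the range of the modulus of the limit, and [h]
   makes the powers of the distances to the net at most [e / 8]. *)
pose eta := Num.min (e / 8) (Num.min (d / 2) h).
have eta0 : 0 < eta by rewrite !lt_min e8 h0 divr_gt0.
have [eta1 eta2 eta3] : [/\ eta <= e / 8, eta <= d / 2 & eta <= h].
  by rewrite /eta !ge_min !lexx !orbT.
have [N [X [N0 X0 Xr cov]]] := family_nets r0 eta0.
have Ud : U [set n | forall i, (i < N)%N -> forall j, (j < N)%N ->
    `|mdist (X i n) (X j n) - mdist (p (X i)) (p (X j))| <= eta].
  apply: (ultra_ord_all UU (P := fun i => [set n | forall j, (j < N)%N ->
    `|mdist (X i n) (X j n) - mdist (p (X i)) (p (X j))| <= eta])) => i _.
  apply: (ultra_ord_all UU (P := fun j => [set n |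
    `|mdist (X i n) (X j n) - mdist (p (X i)) (p (X j))| <= eta])) => j _.
  exact: (p_dist (X i) (X j) eta0).
have UM : U [set n | forall i, (i < N)%N ->
    enorm (evalM (zeta n) (X i n) - M (p (X i))) <= e / 8].
  apply: (ultra_ord_all UU (P := fun i => [set n |
    enorm (evalM (zeta n) (X i n) - M (p (X i))) <= e / 8])) => i _.
  exact: (p_M (X i) e8).
apply: filterS (filterI Ud UM) => n /= [nd nM].
exists [set xy : tree (zeta n) * tree ultralimit |
  [/\ tball (zeta n) r xy.1, tball ultralimit r xy.2 & exists2 i, (i < N)%N &
    mdist xy.1 (X i n) <= eta /\ mdist xy.2 (p (X i)) <= eta]].
have pXr i : tball ultralimit r (p (X i)).
  apply: ultralimit_ball; apply: filterS filterT => k _; exact: Xr.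
split.
- apply/correspondenceP; split => [x y []//|x xr|q qr].
    have [i iN xi] := cov n x xr; exists (p (X i)).
    by split=> /=; [exact: xr|exact: pXr|exists i; rewrite ?mdistxx ?(ltW eta0)].
  have [i iN qi] := ultralimit_net r0 eta0 cov qr.
  exists (X i n).
  by split=> /=; [exact: Xr|exact: qr|exists i; rewrite ?mdistxx ?(ltW eta0)].
- split; [exact: ge0_tball_basept|exact: ge0_tball_basept|].
  exists 0%N => //=; rewrite X0 /family_at/= !mdistxx.
  by rewrite (ltW eta0).
- move=> x y x' y' [/= _ _ [i iN [xi yi]]] [/= _ _ [j jN [xj yj]]].
  have := nd i iN j jN.
  have t1 := metric_triangle x (X i n) x'.
  have t2 := metric_triangle (X i n) (X j n) x'.
  have t3 := metric_triangle (X i n) x (X j n).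
  have t4 := metric_triangle x x' (X j n).
  have s1 := metric_triangle y (p (X i)) y'.
  have s2 := metric_triangle (p (X i)) (p (X j)) y'.
  have s3 := metric_triangle (p (X i)) y (p (X j)).
  have s4 := metric_triangle y y' (p (X j)).
  rewrite (metric_sym (X j n) x') in t2; rewrite (metric_sym (X i n) x) in t3.
  rewrite (metric_sym (p (X j)) y') in s2; rewrite (metric_sym (p (X i)) y) in s3.
  by rewrite !ler_norml => /andP[h1 h2]; lra.
- move=> x y [/= xr yr [i iN [xi yi]]].
  apply: (le_trans (enorm_dist3 _ (evalM (zeta n) (X i n)) _)).
  have h1 : enorm (evalM (zeta n) x - evalM (zeta n) (X i n)) <= e / 8.
    have xd : mdist x (X i n) <= d by lra.
    apply: (le_trans (md n _ _ xr (Xr i n) xd)); rewrite mul1r.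
    by apply: hP; rewrite ?mdist_ge0// (le_trans xi).
  have h2 : enorm (M (p (X i)) - M y) <= 2 * (e / 8).
    have xd : mdist y (p (X i)) <= d / 2 by lra.
    have := ultralimit_modulus r0 ltr01 d0 md yr (pXr i) xd.
    rewrite enorm_distC mulr1 => /le_trans; apply; rewrite ler_wpM2l//.
    by apply: hP; rewrite ?mdist_ge0// (le_trans yi).
  have h3 := nM i iN.
  have h4 := enorm_dist3 (evalM (zeta n) (X i n)) (M (p (X i))) (M y).
  by rewrite /=; lra.
Qed.

Local Notation b n := (properness_map (zeta n)).
Local Notation bb := (properness_map ultralimit).

(** Otherwise points with [M] in the square of half-side [t] would be farther than [bb t + e] from
    the root along [U]. The uniform bound on the properness maps keeps them from escaping, and their
    limit point contradicts the definition of [bb t]. *)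
Lemma ultralimit_properness_ge t e : 0 < e -> U [set n | b n t <= bb t + e].
Proof.
move=> e0; have [//|Uc] := in_ultra_setVsetC [set n | b n t <= bb t + e] UU.
exfalso; have bb0 := properness_map_ge0 ultralimit t.
have /dependent_choice_fun[x xP] : forall n, exists x : tree (zeta n),
    mdist (o n) x <= b n t /\ (bb t + e < b n t ->
      `|evalM (zeta n) x| <= t /\ bb t + e < mdist (o n) x).
  move=> n; have [bn|bn] := leP (b n t) (bb t + e).
    by exists (o n); rewrite mdistxx properness_map_ge0.
  have c0 : 0 <= bb t + e by rewrite addr_ge0// ltW.
  have [x xt cx] := properness_map_gt c0 bn.
  by exists x; split => //; exact: properness_map_ub.
have t1 : 0 < Num.max 1 t by rewrite lt_max ltr01.
have [K K0 HK] := proper t1.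
have xK n : mdist (o n) (x n) <= K.
  apply: (le_trans (xP n).1); apply: le_trans (HK n).
  by apply: properness_map_nd; rewrite le_max lexx orbT.
have Mt : `|M (p (mk xK))| <= t.
  apply/ler_addgt0Pr => u u0.
  have [n [/= /negP]] := filter_ex (filterI Uc (p_M (mk xK) u0)).
  rewrite -ltNge /family_at/= => /(xP n).2[nt _] nu.
  have := ler_normD (M (p (mk xK)) - evalM (zeta n) (x n)) (evalM (zeta n) (x n)).
  rewrite subrK; have := norm_le_enorm (M (p (mk xK)) - evalM (zeta n) (x n)).
  by rewrite enorm_distC; lra.
have := @properness_map_ub _ _ ultralimit t (p (mk xK)) Mt.
have : bb t + e <= mdist oo (p (mk xK)).
  apply: (ulim_ge UU (p_dist base_family (mk xK))).
  apply: filterS Uc => n /= /negP; rewrite -ltNge => /(xP n).2[_].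
  exact: ltW.
by rewrite /=; lra.
Qed.

(** The levels are distinct because the approximants of a point with [M] in the square of half-side
    [s] may leave this square, though not the one of half-side [t]. *)
Lemma ultralimit_properness_le s t e : s < t -> 0 < e ->
  U [set n | bb s <= b n t + e].
Proof.
move=> st e0; have [be|be] := ltP (bb s - e) 0.
  apply: filterS filterT => n _ /=.
  by have := properness_map_ge0 (zeta n) t; lra.
have bs : bb s - e < bb s by rewrite gtrBl.
have [q qs qe] := properness_map_gt be bs.
have [x xq] := p_surj q; rewrite -xq in qs qe.
have u0 : 0 < mdist oo (p x) - (bb s - e) by rewrite subr_gt0.
have ts : 0 < t - s by rewrite subr_gt0.
apply: filterS (filterI (p_dist base_family x u0) (p_M x ts)) => n /= [h1 h2].
have : mdist (o n) (x n) <= b n t.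
  apply: properness_map_ub.
  have := ler_normD (evalM (zeta n) (x n) - M (p x)) (M (p x)); rewrite subrK.
  have := norm_le_enorm (evalM (zeta n) (x n) - M (p x)).
  by rewrite /= in qs; lra.
by move: h1; rewrite /family_at/= ler_norml => /andP[h1 _]; lra.
Qed.

(** A grid of mesh [e / 2] reduces the levels up to [T] to finitely many; monotonicity covers the
    levels between grid points, and negative levels are immediate. *)
Lemma ultralimit_properness_levy T e : 0 < e -> U [set n | forall x, x <= T ->
  b n (x - e) <= bb x + e /\ bb (x - e) <= b n x + e].
Proof.
move=> e0; have e2 : 0 < e / 2 by rewrite divr_gt0.
pose g (i : nat) := i%:R * (e / 2).
pose I := (Num.truncn (T / (e / 2))).+1.
have U1 : U [set n | forall i, (i < I)%N -> b n (g i) <= bb (g i) + e].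
  apply: (ultra_ord_all UU (P := fun i => [set n | b n (g i) <= bb (g i) + e])).
  by move=> i _; exact: ultralimit_properness_ge.
have U2 : U [set n | forall i, (i < I)%N -> bb (g i - e / 2) <= b n (g i) + e].
  apply: (ultra_ord_all UU
    (P := fun i => [set n | bb (g i - e / 2) <= b n (g i) + e])).
  by move=> i _; apply: ultralimit_properness_le; rewrite // gtrBl.
apply: filterS (filterI U1 U2) => n /= [H1 H2] x xT.
have [x0|x0] := ltP x 0.
  have xe : x - e < 0 by lra.
  by rewrite !(properness_map_lt0 _ xe) !addr_ge0 ?properness_map_ge0// ltW.
have xd : 0 <= x / (e / 2) by rewrite divr_ge0// ltW.
pose i := Num.truncn (x / (e / 2)).
have iI : (i < I)%N.
  by rewrite ltnS; apply: le_truncn; rewrite ler_wpM2r// invr_ge0 ltW.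
have gx : g i <= x by rewrite /g -ler_pdivlMr// truncn_le.
have xg : x < g i + e / 2.
  have := truncnS_gt (x / (e / 2)); rewrite ltr_pdivrMr//.
  by rewrite -natr1 mulrDl mul1r.
have h1 : x - e <= g i by lra.
have h2 : x - e <= g i - e / 2 by lra.
have := properness_map_nd (zeta n) h1; have := properness_map_nd ultralimit h2.
have := properness_map_nd (zeta n) gx; have := properness_map_nd ultralimit gx.
have := H1 i iI; have := H2 i iI; lra.
Qed.

End ultralimit_tree.

(** * Convergence along the ultrafilter *)

(** The discontinuities of a monotone function are countable on each bounded interval, hence form a
    null set. *)
Lemma monotone_continuity_ae (R : realType) (f : R -> R) :
  {homo f : a b / a <= b} ->
  (forall x e, 0 < e -> exists2 h, 0 < h & f (x + h) <= f x + e) ->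
  {ae (@lebesgue_measure R), forall x, forall e, 0 < e -> exists2 h, 0 < h &
     f (x + h) <= f x + e /\ f x <= f (x - h) + e}.
Proof.
move=> nd fr.
pose N := \bigcup_(n in [set: nat])
  [set x | x \in (`](- n%:R), n%:R[) /\ discontinuity f x].
have cN : countable N.
  apply: bigcup_countable => [|n _]; first exact: countableP.
  by apply: discontinuity_countable => x y _ _; exact: nd.
exists N; split; [|exact: countable_lebesgue_measure0|].
  by apply: countable_measurable => //; move=> x; exact: measurable_set1.
move=> x /= nx; apply: contrapT => xN; apply: nx => e e0.
have cl : cvg (f y @[y --> x^'-]).
  apply: nondecreasing_at_left_is_cvgr.
    by near=> y => a b _ _; exact: nd.
  near=> y; exists (f x) => _ [a + <-].
  by rewrite /= in_itv/= => /andP[_ ax]; apply: nd; exact: ltW.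
have cr : f y @[y --> x^'+] --> f x.
  apply/cvgrPdist_le => u u0; have [h h0 Hh] := fr x u u0.
  near=> y; have xy : x <= y by [].
  have yh : y <= x + h by near: y; apply: nbhs_right_le; rewrite ltrDl.
  by have := nd _ _ xy; have := nd _ _ yh; rewrite ler_norml; lra.
have lx : lim (f y @[y --> x^'-]) = f x.
  apply: contrapT => /eqP ne; apply: xN.
  exists (Num.truncn `|x|).+1 => //; split.
    by rewrite in_itv/= -ltr_norml truncnS_gt.
  split; [exact: cl|by apply/cvg_ex; exists (f x)|].
  by rewrite (cvg_lim _ cr).
have {}cl : f y @[y --> x^'-] --> f x by rewrite -lx.
have [h1 h10 H1] := fr x e e0.
have [h2 h20 H2] : exists2 h, 0 < h & f x <= f (x - h) + e.
  have := cl; move=> /cvgrPdist_le/(_ _ e0) H.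
  have [y [yx yf]] : exists y, y < x /\ `|f x - f y| <= e.
    by near x^'- => y; exists y; split; near: y => //; exact: nbhs_left_lt.
  exists (x - y); first by rewrite subr_gt0.
  rewrite (_ : x - (x - y) = y); last by ring.
  by move: yf; rewrite ler_norml; lra.
exists (Num.min h1 h2); first by rewrite lt_min h10.
split; [apply: le_trans H1|apply: (le_trans H2)].
  by apply: nd; rewrite lerD2l ge_min lexx.
by rewrite lerD2r; apply: nd; rewrite lerD2l lerN2 ge_min lexx orbT.
Unshelve. all: by end_near. Qed.

Section ultralimit_convergence.
Variables (R : realType) (alpha : R) (psi : R -> R).
Variable dM1c : R -> (R -> R) -> (R -> R) -> R.
Hypothesis halpha : 0 < alpha < 1.
Hypothesis hpsi : dyadic_cutoff psi.
Hypothesis hdM1c : M1_metric_family dM1c.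
Implicit Types z : spatial_tree alpha.

Lemma evalM_modulus_weaken z r d e e' : e <= e' ->
  evalM_modulus z r d e -> evalM_modulus z r d e'.
Proof.
move=> ee md x y xr yr xy; apply: (le_trans (md x y xr yr xy)).
by rewrite ler_wpM2r ?powR_ge0.
Qed.

(** Continuity of the limit at [t] supplies the closeness of the final values that [M1_dist_levy]
    requires besides the Levy bounds. *)
Lemma M1_gap_cvg (w : nat -> spatial_tree alpha) z t : 0 <= t ->
  (forall e, 0 < e -> exists2 h, 0 < h &
     properness_map z (t + h) <= properness_map z t + e /\
     properness_map z t <= properness_map z (t - h) + e) ->
  (forall k x, x <= k%:R ->
     properness_map (w k) (x - k.+1%:R^-1) <= properness_map z x + k.+1%:R^-1 /\
     properness_map z (x - k.+1%:R^-1) <= properness_map (w k) x + k.+1%:R^-1) ->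
  M1_gap dM1c (w k) z t @[k --> \oo] --> 0.
Proof.
move=> t0 cont levy.
have cad z1 : cadlag t (properness_map z1) by exact: properness_map_cadlag.
apply/cvgrPdist_lt => e e0.
have [[eta eta0 H] _] := M1_topology hdM1c t0 (cad z) e0.
pose u := eta / 8; have u0 : 0 < u by rewrite divr_gt0.
have u2 : 0 < u / 2 by rewrite divr_gt0.
have [h h0 [hr hl]] := cont _ u2.
have m0 : 0 < Num.min (u / 2) h by rewrite lt_min u2.
have [N HN] := natSinv_lt m0.
near=> k.
have kN : (N <= k)%N by near: k; exact: nbhs_infty_ge.
have kt : t + 1 <= k%:R by near: k; exact: nbhs_infty_ger.
have := HN k kN; have := levy k.
have : (k.+1%:R^-1 : R) <= 1 by rewrite invf_le1// ler1n.
have : 0 < (k.+1%:R^-1 : R) by rewrite invr_gt0.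
move: (k.+1%:R^-1) => q q0 q1 Lk; rewrite lt_min => /andP[qu qh].
have nd1 := @properness_map_nd _ _ z; have nd2 := @properness_map_nd _ _ (w k).
have lt0 z1 : properness_map z1 (-1) = 0.
  by apply: properness_map_lt0; rewrite oppr_lt0.
suff : (M1_dist t (properness_map z) (properness_map (w k)) < eta%:E)%E.
  move=> /(H _ (cad _)) zw; rewrite sub0r normrN ger0_norm ?M1_gap_ge0//.
  by rewrite /M1_gap (M1_sym hdM1c t0 (cad (w k)) (cad z)) gt_min zw orbT.
apply: (@le_lt_trans _ _ (4 * u)%:E); last by rewrite lte_fin /u; lra.
apply: M1_dist_levy => //; first exact: ltW.
- move=> x _ xt; have xk : x <= k%:R by lra.
  have [L1 _] := Lk x xk; have xu : x - u <= x - q by lra.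
  by have := nd2 _ _ xu; lra.
- move=> x _ xt; have xk : x <= k%:R by lra.
  have [_ L2] := Lk x xk; have xu : x - u <= x - q by lra.
  by have := nd1 _ _ xu; lra.
(* The Levy bounds at [t] and [t + q] enclose the value of [w k] at [t] between the values of [z] at
   [t - q] and [t + q], up to [q]. *)
- have tk : t <= k%:R by lra.
  have tk' : t + q <= k%:R by lra.
  have [_ L2] := Lk _ tk; have [L1 _] := Lk _ tk'; rewrite addrK in L1.
  have tq : t + q <= t + h by lra.
  have tq' : t - h <= t - q by lra.
  have := nd1 _ _ tq; have := nd1 _ _ tq'.
  by rewrite ler_norml; lra.
Unshelve. all: by end_near. Qed.

Variables (U : set_system nat) (UU : UltraFilter U).
Variable zeta : nat -> spatial_tree alpha.
Hypothesis bounds : forall r, 0 < r ->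
  exists2 K, 0 <= K & forall n, evalM_bound (zeta n) r K.
Hypothesis moduli : forall r e, 0 < r -> 0 < e ->
  exists2 d, 0 < d & forall n, evalM_modulus (zeta n) r d e.
Variable z : spatial_tree alpha.
Hypothesis z_modulus : forall r e d, 0 <= r -> 0 < e -> 0 < d ->
  (forall n, evalM_modulus (zeta n) r d e) ->
  evalM_modulus z r (d / 2) (2 * e).
Hypothesis z_correspondence : forall r e, 0 <= r -> 0 < e ->
  U [set n | exists C : set (tree (zeta n) * tree z),
    [/\ correspondence (tball (zeta n) r) (tball z r) C,
        C (basept (zeta n), basept z),
        (forall x y x' y', C (x, y) -> C (x', y') ->
           `|mdist x x' - mdist y y'| <= e) &
        (forall x y, C (x, y) ->
           enorm (evalM (zeta n) x - evalM z y) <= e)]].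

(** The constant [e / 20] for the sequence becomes [e / 10] for the limit tree, and [DeltaC_small]
    multiplies it by 10. *)
Lemma ultra_Dball r e : 0 <= r -> 0 < e ->
  U [set n | (Dball psi (zeta n) z r r <= e%:E)%E].
Proof.
move=> r0 e0; have r1 : 0 < r + 1 by rewrite ltr_pwDr.
have e10 : 0 < e / 10 by rewrite divr_gt0.
have e20 : 0 < e / 20 by rewrite divr_gt0.
have [K K0 bd] := bounds r1; have [d d0 md] := moduli r1 e20.
have d2 : 0 < d / 2 by rewrite divr_gt0.
have [eta eta0 small] := DeltaC_small halpha hpsi e10 d2 K0.
apply: filterS (z_correspondence r0 eta0) => n /= [C [C1 C2 C3 C4]].
have r_le : r <= r + 1 by rewrite lerDl.
apply: (Dball_le C1 C2).
rewrite (_ : e = 10 * (e / 10)); last by lra.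
apply: (small _ _ r r) => //.
- exact: evalM_bound_le (bd n).
- apply: (@evalM_modulus_weaken _ _ _ (e / 20)); first by lra.
  by apply: evalM_modulus_le (md n) => //; lra.
- rewrite (_ : e / 10 = 2 * (e / 20)); last by lra.
  have := z_modulus (ltW r1) e20 d0 md; exact: evalM_modulus_le.
- by move/correspondenceP: C1 => [].
Qed.

(** An ultrafilter need not contain an intersection over a continuum of radii. A finite grid of
    radii suffices, because changing the radius is controlled uniformly over the sequence and for
    the limit tree. *)
Lemma ultra_Dball_unif T e : 0 < e ->
  U [set n | forall r, 0 <= r <= T -> (Dball psi (zeta n) z r r <= e%:E)%E].
Proof.
move=> e0; pose S := Num.max 1 T.
have S0 : 0 < S by rewrite lt_max ltr01.
have TS : T <= S by rewrite le_max lexx orbT.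
(* One third of [e] for each of the two changes of radius, costing [10 * (e / 30)], and one third
   for the grid point. *)
have e30 : 0 < e / 30 by rewrite divr_gt0.
have e3 : 0 < e / 3 by rewrite divr_gt0.
have [K K0 bd] := bounds S0; have [d d0 md] := moduli S0 e30.
have [h1 h10 H1] := Dball_radius halpha hpsi e30 d0 K0.
have [K' K'0 bd'] := evalM_bound_ex halpha z S.
have [d' d'0 md'] := evalM_modulus_ex z S e30.
have [h2 h20 H2] := Dball_radius halpha hpsi e30 d'0 K'0.
pose h := Num.min h1 h2; have h0 : 0 < h by rewrite lt_min h10.
have [hh1 hh2] : h <= h1 /\ h <= h2 by rewrite !ge_min !lexx orbT.
pose I := (Num.truncn (T / h)).+1.
have UI : U [set n | forall i, (i < I)%N ->
    (Dball psi (zeta n) z (i%:R * h) (i%:R * h) <= (e / 3)%:E)%E].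
  apply: (ultra_ord_all UU (P := fun i => [set n |
    (Dball psi (zeta n) z (i%:R * h) (i%:R * h) <= (e / 3)%:E)%E])) => i _.
  by apply: ultra_Dball => //; rewrite mulr_ge0// ltW.
apply: filterS UI => n /= HI r /andP[r0 rT].
pose i := Num.truncn (r / h).
have rd : 0 <= r / h by rewrite divr_ge0// ltW.
have iI : (i < I)%N.
  by rewrite ltnS; apply: le_truncn; rewrite ler_wpM2r// invr_ge0 ltW.
have gr : i%:R * h <= r by rewrite -ler_pdivlMr// truncn_le.
have rg : r <= i%:R * h + h.
  have := truncnS_gt (r / h); rewrite ltr_pdivrMr// -natr1 mulrDl mul1r.
  exact: ltW.
have g0 : 0 <= i%:R * h by rewrite mulr_ge0// ltW.
have rS : r <= S by exact: le_trans TS.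
have gS : i%:R * h <= S by exact: le_trans rS.
move: (i%:R * h) (HI i iI) gr rg g0 gS => g Hg gr rg g0 gS.
have D1 : (Dball psi (zeta n) (zeta n) r g <= (10 * (e / 30))%:E)%E.
  apply: H1 (bd n) (md n) _ _ _; rewrite ?r0 ?g0//.
  by rewrite ger0_norm ?subr_ge0//; lra.
have D2 : (Dball psi z z g r <= (10 * (e / 30))%:E)%E.
  apply: H2 bd' md' _ _ _; rewrite ?r0 ?g0//.
  by rewrite distrC ger0_norm ?subr_ge0//; lra.
apply: (le_trans (Dball_triangle psi _ (zeta n) _ _ g _)).
apply: (le_trans (leeD D1 (Dball_triangle psi _ z _ _ g _))).
apply: (le_trans (leeD (lexx _) (leeD Hg D2))).
by rewrite -!EFinD lee_fin; lra.
Qed.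

Hypothesis U_cofinite : forall N, U [set n | (N <= n)%N].
Hypothesis z_levy : forall T e, 0 < e -> U [set n | forall x, x <= T ->
  properness_map (zeta n) (x - e) <= properness_map z x + e /\
  properness_map z (x - e) <= properness_map (zeta n) x + e].

(** Limits along an ultrafilter do not pass under an integral, so indices [n_ k] are extracted for
    which all errors up to [k] are at most [k.+1%:R^-1]. *)
Lemma ultra_Delta_sp e N : 0 < e ->
  exists2 n, (N <= n)%N & (Delta_sp psi dM1c (zeta n) z < e%:E)%E.
Proof.
move=> e0.
have /choice[n_ nP] : forall k : nat, exists n, [/\ (k <= n)%N,
    forall r, 0 <= r <= k%:R -> (Dball psi (zeta n) z r r <= k.+1%:R^-1%:E)%E &
    forall x, x <= k%:R ->
      properness_map (zeta n) (x - k.+1%:R^-1) <= properness_map z x + k.+1%:R^-1 /\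
      properness_map z (x - k.+1%:R^-1) <= properness_map (zeta n) x + k.+1%:R^-1].
  move=> k; have k0 : 0 < k.+1%:R^-1 :> R by rewrite invr_gt0.
  have [n /= [n1 [n2 n3]]] := filter_ex (filterI (U_cofinite k)
    (filterI (ultra_Dball_unif k%:R k0) (z_levy k%:R k0))).
  by exists n.
pose w k := zeta (n_ k).
have c1 : (exp_integral (ball_gap psi (w k) z) @[k --> \oo] --> 0)%E.
  apply: exp_integral_cvg0 => [k|k t _|]; first exact: measurable_ball_gap.
    exact: ball_gap01.
  apply: aeW => t t0; apply/cvgrPdist_le => u u0.
  have [M HM] := natSinv_lt u0.
  near=> k; have kM : (M <= k)%N by near: k; exact: nbhs_infty_ge.
  have kt : t <= k%:R by near: k; exact: nbhs_infty_ger.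
  rewrite sub0r normrN ger0_norm ?ball_gap_ge0//.
  apply: (@le_trans _ _ k.+1%:R^-1); last by rewrite ltW// HM.
  by apply: ball_gap_le; have [_ + _] := nP k; apply; rewrite t0.
have c2 : (exp_integral (M1_gap dM1c (w k) z) @[k --> \oo] --> 0)%E.
  apply: exp_integral_cvg0 => [k|k t t0|]; first exact: measurable_M1_gap.
    by rewrite M1_gap_ge0// M1_gap_le1.
  have [N0 [mN N00 sN]] := monotone_continuity_ae (@properness_map_nd _ _ z)
    (@properness_map_right _ _ halpha z).
  exists N0; split => // t /= nt; apply: sN => /= ct; apply: nt => t0.
  apply: M1_gap_cvg => // k x xk.
  by have [_ _] := nP k; apply.
have e2 : 0 < e / 2 by rewrite divr_gt0.
have k1 : \forall k \near \oo, (exp_integral (ball_gap psi (w k) z) < (e / 2)%:E)%E.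
  exact: (c1 _ (@nbhs_open_ereal_lt _ 0 (fun=> e / 2) e2)).
have k2 : \forall k \near \oo, (exp_integral (M1_gap dM1c (w k) z) < (e / 2)%:E)%E.
  exact: (c2 _ (@nbhs_open_ereal_lt _ 0 (fun=> e / 2) e2)).
have [k [kN [h1 h2]]] := filter_ex (filterI (nbhs_infty_ge N) (filterI k1 k2)).
exists (n_ k).
  by have [+ _ _] := nP k; exact: leq_trans.
by rewrite Delta_spE [e]splitr EFinD lteD.
Unshelve. all: by end_near. Qed.

End ultralimit_convergence.

(** * The conditions of the theorem as uniform bounds and Hoelder moduli *)

Section uniform_conditions.
Variables (R : realType) (alpha : R).
Hypothesis halpha : 0 < alpha < 1.
Variables (A : Type) (zeta : A -> spatial_tree alpha).

Lemma evalM_boundP r C : 0 <= C ->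
  (nnsup [set nnsup [set (enorm (evalM (zeta a) z))%:E | z in tball (zeta a) r]
         | a in [set: A]] <= C%:E)%E <-> forall a, evalM_bound (zeta a) r C.
Proof.
move=> C0; split=> [H a x xr|H].
  rewrite -lee_fin; apply: le_trans H.
  apply: (@le_trans _ _ (nnsup [set (enorm (evalM (zeta a) z))%:E
                               | z in tball (zeta a) r])).
    by apply: nnsup_ubound; exists x.
  by apply: nnsup_ubound; exists a.
apply: ge_nnsup; rewrite ?lee_fin// => _ [a _ <-].
apply: ge_nnsup; rewrite ?lee_fin// => _ [x xr <-].
by rewrite lee_fin; exact: H.
Qed.

(** The scale [d'] is chosen as [mdist x y] itself, so a bound at all scales up to [d] is
    required. *)
Lemma modulus_le_evalM_modulus r d e : (forall d', 0 < d' <= d ->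
    (nnsup [set (d' `^ (- alpha))%:E * modulus (zeta a) r d' | a in [set: A]]
     < e%:E)%E) ->
  0 <= e -> forall a, evalM_modulus (zeta a) r d e.
Proof.
move=> H e0 a x y xr yr xyd.
have [xy0|xy0] := eqVneq (mdist x y) 0.
  by rewrite (mdist_positivity _ _ xy0) subrr enorm0 mulr_ge0 ?powR_ge0.
have {}xy0 : 0 < mdist x y by rewrite lt_def xy0 mdist_ge0.
have := H (mdist x y); rewrite xy0 xyd => /(_ isT) He.
have : ((mdist x y `^ (- alpha))%:E *
    (enorm (evalM (zeta a) x - evalM (zeta a) y))%:E <= e%:E)%E.
  apply: le_trans (ltW He).
  apply: (@le_trans _ _ ((mdist x y `^ (- alpha))%:E *
                         modulus (zeta a) r (mdist x y))%E).
    rewrite lee_wpmul2l ?lee_fin ?powR_ge0//.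
    by apply: nnsup_ubound; exists x, y.
  by apply: nnsup_ubound; exists a.
by rewrite -EFinM lee_fin powRN mulrC ler_pdivrMr ?powR_gt0.
Qed.

Lemma evalM_modulus_modulus_le r d e : 0 <= e ->
  (forall a, evalM_modulus (zeta a) r d e) -> forall d', 0 < d' <= d ->
  (nnsup [set (d' `^ (- alpha))%:E * modulus (zeta a) r d' | a in [set: A]]
     <= e%:E)%E.
Proof.
move=> e0 md d' /andP[d'0 d'd]; apply: ge_nnsup; rewrite ?lee_fin//.
move=> _ [a _ <-]; rewrite powRN lee_pdivrMl ?powR_gt0// -EFinM.
apply: ge_nnsup; first by rewrite lee_fin mulr_ge0 ?powR_ge0.
move=> _ [x [y [xr yr xy ->]]]; rewrite lee_fin.
apply: (le_trans (md a x y xr yr (le_trans xy d'd))).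
rewrite mulrC ler_wpM2r// ge0_ler_powR ?nnegrE ?mdist_ge0 ?(ltW d'0)//.
by case/andP: halpha => /ltW.
Qed.

End uniform_conditions.

Theorem proposition2p17 (R : realType) (alpha : R) (halpha : 0 < alpha < 1)
    (psi : R -> R) (hpsi : dyadic_cutoff psi)
    (dM1c : R -> (R -> R) -> (R -> R) -> R) (hdM1c : M1_metric_family dM1c)
    (A : Type) (zeta : A -> spatial_tree alpha) :
  compact (closure
    [set \pi_(T_sp alpha psi dM1c)%qT (zeta a) | a in [set: A]]) <->
  (forall r : R, 0 < r ->
    [/\ forall eps : R, 0 < eps -> exists N : nat, forall a : A,
          (net_number (tball (zeta a) r) eps <= N%:R%:E)%E,
        exists2 C : R, 0 < C &
          (nnsup [set nnsup [set (enorm (evalM (zeta a) z))%:E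
                            | z in tball (zeta a) r] | a in [set: A]]
           <= C%:E)%E,
        forall eps : R, 0 < eps -> exists2 delta : R, 0 < delta &
          forall delta' : R, 0 < delta' <= delta ->
          (nnsup [set (delta' `^ (- alpha))%:E * modulus (zeta a) r delta'
                 | a in [set: A]] < eps%:E)%E &
        exists2 C' : R, 0 < C' &
          forall a : A, properness_map (zeta a) r <= C']).
Proof.
split=> [cA r r0|H].
  have level := compact_closure_level halpha hpsi hdM1c cA.
  have r0' := ltW r0.
  split.
  - move=> eps eps0.
    have [|z|k Hk] := @level (fun k z => net_number (tball z r) eps <= k%:R%:E)%E.
    + by move=> k k' z kk /le_trans; apply; rewrite lee_fin ler_nat.
    + exact: net_number_local.
    by exists k.
  - have [|z|k Hk] := @level (fun k z => evalM_bound z r k%:R).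
    + by move=> k k' z kk bd x /bd/le_trans; apply; rewrite ler_nat.
    + exact: evalM_bound_local.
    exists k.+1%:R => //; apply/evalM_boundP => // a x /(Hk a)/le_trans; apply.
    by rewrite ler_nat.
  (* Half of [eps] restores the strict inequality, as the supremum only inherits a large one. *)
  - move=> eps eps0; have eps2 : 0 < eps / 2 by rewrite divr_gt0.
    have [|z|k Hk] := @level (fun k z => evalM_modulus z r k.+1%:R^-1 (eps / 2)).
    + move=> k k' z kk; apply: evalM_modulus_le => //.
      by rewrite lef_pV2 ?posrE// ler_nat.
    + exact: evalM_modulus_local.
    exists k.+1%:R^-1; first by rewrite invr_gt0.
    move=> d' d'k; apply: (@le_lt_trans _ _ (eps / 2)%:E).
      exact: (evalM_modulus_modulus_le halpha (ltW eps2) Hk).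
    by rewrite lte_fin; lra.
  - have [|z|k Hk] := @level (fun k z => properness_map z r <= k%:R).
    + by move=> k k' z kk /le_trans; apply; rewrite ler_nat.
    + exact: properness_map_local.
    by exists k.+1%:R => // a; rewrite (le_trans (Hk a))// ler_nat.
apply: compact_closure_sp => // u; pose w n := zeta (u n).
have nets r e : 0 < r -> 0 < e -> exists N, forall n,
    exists s : seq (tree (w n)), [/\ (size s <= N)%N,
    [set` s] `<=` tball (w n) r &
    forall x, tball (w n) r x -> exists2 v, v \in s & mdist x v <= e].
  move=> r0 e0; have [H1 _ _ _] := H r r0; have [N HN] := H1 e e0.
  by exists N => n; exact: (net_number_ex (HN (u n))).
have bounds r : 0 < r -> exists2 K, 0 <= K & forall n, evalM_bound (w n) r K.
  move=> r0; have [_ [C C0 HC] _ _] := H r r0; exists C; first exact: ltW.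
  by move=> n; apply: (evalM_boundP zeta r (ltW C0)).1.
have moduli r e : 0 < r -> 0 < e ->
    exists2 d, 0 < d & forall n, evalM_modulus (w n) r d e.
  move=> r0 e0; have [_ _ H3 _] := H r r0; have [d d0 Hd] := H3 e e0.
  by exists d => // n; apply: modulus_le_evalM_modulus Hd _ _; exact: ltW.
have proper r : 0 < r ->
    exists2 K, 0 <= K & forall n, properness_map (w n) r <= K.
  move=> r0; have [_ _ _ [K K0 HK]] := H r r0; exists K; first exact: ltW.
  by move=> n; exact: HK.
(* Refining [\oo] puts all cofinite sets into [U], as needed by the limits of Cauchy sequences and
   by the extraction of arbitrarily large indices. *)
have [U [UU Usub]] := @ultraFilterLemma _ \oo _.
have U_cofinite N : U [set n | (N <= n)%N] by apply: Usub; exact: nbhs_infty_ge.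
have [Q [p [p_surj p_dist]]] := ultralimit_space UU w.
have [M p_M] := ultralimit_evalM halpha UU bounds moduli p_surj p_dist.
pose z := ultralimit halpha UU U_cofinite nets moduli proper p_surj p_dist p_M.
exists z => e e0 N.
apply: (ultra_Delta_sp halpha hpsi hdM1c UU bounds moduli) => //.
- exact: ultralimit_evalM_modulus.
- exact: ultralimit_correspondence.
- exact: ultralimit_properness_levy.
Qed.
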